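(* Let $(A,\cdot_A,\sigma)$ be a braided algebra. Then the quintuple $(\overline{\mathcal{P}_A(A)},\prec_\sigma,\succ_\sigma,\cdot_\sigma,\sigma_{AT})$, together with $j_A:A\to\overline{\mathcal{P}_A(A)}$, $a\mapsto T[a]$, is the free braided tridendriform algebra on the braided algebra $(A,\cdot_A,\sigma)$. More precisely, for any braided tridendriform algebra $(R,\prec_R,\succ_R,\cdot_R,\tau)$ and any homomorphism $\psi:(A,\cdot_A,\sigma)\to(R,\cdot_R,\tau)$ of braided algebras, there exists a unique homomorphism $\hat\psi:\overline{\mathcal{P}_A(A)}\to R$ of braided tridendriform algebras such that $\psi=\hat\psi\circ j_A$.
   Context: Ground field $\mathbf{k}$ of characteristic $0$; all vector spaces, algebras and tensor products are over $\mathbf{k}$. Braidings. A braiding on a vector space $V$ is a linear map $\sigma\in\mathrm{End}(V\otimes V)$ with $(\sigma\otimes \mathrm{id})(\mathrm{id}\otimes\sigma)(\sigma\otimes \mathrm{id})=(\mathrm{id}\otimes\sigma)(\sigma\otimes \mathrm{id})(\mathrm{id}\otimes\sigma)$ on $V^{\otimes3}$ (invertibility is not required). For an operator on two adjacent tensor factors, the subscript $i$ (as in $\sigma_i$) means it acts on the $i$-th and $(i+1)$-th factors. For $w\in\mathfrak{S}_n$ with reduced expression $w=s_{i_1}\cdots s_{i_l}$ put $T^\sigma_w=\sigma_{i_1}\cdots\sigma_{i_l}$ on $V^{\otimes n}$; when $\sigma$ is the flip, $T_w(v_1\otimes\cdots\otimes v_n)=v_{w^{-1}(1)}\otimes\cdots\otimes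 v_{w^{-1}(n)}$. For $i,j\ge1$ let $\beta_{ij}=T^\sigma_{\chi_{ij}}:V^{\otimes i}\otimes V^{\otimes j}\to V^{\otimes j}\otimes V^{\otimes i}$, where $\chi_{ij}\in\mathfrak{S}_{i+j}$ sends $a\mapsto j+a$ for $1\le a\le i$ and $i+b\mapsto b$ for $1\le b\le j$; $\beta_{0i}=\beta_{i0}=\mathrm{id}$. A braided algebra $(A,\mu,\sigma)$ is an associative (not necessarily unital) algebra with a braiding $\sigma$ on $A$ satisfying $(\mu\otimes\mathrm{id})\sigma_2\sigma_1=\sigma(\mathrm{id}\otimes\mu)$ and $(\mathrm{id}\otimes\mu)\sigma_1\sigma_2=\sigma(\mu\otimes\mathrm{id})$; homomorphisms are algebra homomorphisms $f$ with $(f\otimes f)\sigma=\sigma'(f\otimes f)$. Braided tridendriform algebras. A tridendriform algebra $(R,\prec,\succ,\cdot)$ is a vector space with three bilinear operations satisfying, with $*:=\prec+\succ+\cdot$: $(x\prec y)\prec z=x\prec(y*z)$; $(x\succ y)\prec z=x\succ(y\prec z)$; $x\succ(y\succ z)=(x*y)\succ z$; $(x\cdot y)\prec z=x\cdot(y\prec z)$; $(x\prec y)\cdot z=x\cdot(y\succ z)$; $(x\succ y)\cdot z=x\succ(y\cdot z)$; $(x\cdot y)\cdot z=x\cdot(y\cdot z)$. A braided tridendriform algebra $(R,\prec,\succ,\cdot,\sigma)$ is a tridendriform algebra with a braiding $\sigma$ on $R$ such that for each $\odot\in\{\prec,\succ,\cdot\}$, $\sigma(\mathrm{id}\otimes\odot)=(\odot\otimes\mathrm{id})\sigma_2\sigma_1$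 and $\sigma(\odot\otimes\mathrm{id})=(\mathrm{id}\otimes\odot)\sigma_1\sigma_2$. Homomorphisms are linear maps preserving the three operations and commuting with the braidings. Dense angularly decorated trees. $\mathcal{D}_n$ is the set of planar rooted trees with $n+1$ leaves in which every internal vertex has at least two branches; $\mathcal{D}_0=\{|\}$. A tree in $\mathcal{D}_n$ has exactly $n$ angles (between adjacent branches at internal vertices), the $i$-th being the one located between the $i$-th and $(i+1)$-th leaves. A tree is dense if, at every internal vertex, a branch that is a leaf can only be the leftmost or the rightmost branch of that vertex; $\mathcal{G}_n\subset\mathcal{D}_n$ is the subset of dense trees. Set $\mathcal{P}_A(A)=\bigoplus_{n\ge0}\mathbf{k}\mathcal{G}_n\otimes A^{\otimes n}$ and $\overline{\mathcal{P}_A(A)}=\bigoplus_{n\ge1}\mathbf{k}\mathcal{G}_n\otimes A^{\otimes n}$; $T\otimes(a_1\otimes\cdots\otimes a_n)$ is identified with the tree whose $i$-th angle is decorated by $a_i$. Each decorated tree $T\ne|$ is uniquely $T_0\vee_{a_1}\cdots\vee_{a_k}T_k$ ($k\ge1$): the root vertex has branches $T_0,\dots,T_k$ from left to right with the angles at the root vertex decorated by $a_1,\dots,a_k$. Write $T[a]=|\vee_a|$ and $ab=a\cdot_Ab$. The operations are defined recursively: for dense decorated trees $T=T_0\vee_{a_1}\cdots\vee_{a_k}T_k$, $T'=T'_0\vee_{a_{k+1}}\cdots\vee_{a_{k+l}}T'_l$ ($k,l\ge1$), $$T\prec_\sigma T'=T_0\vee_{a_1}\cdots\vee_{a_k}(T_k*_\sigma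 T'),\quad T\succ_\sigma T'=(T*_\sigma T'_0)\vee_{a_{k+1}}\cdots\vee_{a_{k+l}}T'_l,$$ $$T\cdot_\sigma T'=\begin{cases}T_0\vee_{a_1}\cdots\vee_{a_ka_{k+1}}\cdots\vee_{a_{k+l}}T'_l,&\text{if }T_k=T'_0=|,\\ T_0\vee_{a_1}\cdots\vee_{a_k}(T_k*_\sigma T'_0)\vee_{a_{k+1}}\cdots\vee_{a_{k+l}}T'_l,&\text{otherwise,}\end{cases}$$ where in the first case the two leaves $T_k,T'_0$ are dropped and the adjacent angles merge into one angle decorated by $a_ka_{k+1}$, and $*_\sigma=\prec_\sigma+\succ_\sigma+\cdot_\sigma$ on $\overline{\mathcal{P}_A(A)}$, extended to $\mathcal{P}_A(A)$ with unit $|$. The braiding is $\sigma_{AT}((T;a_1,\dots,a_m)\otimes(T';a_{m+1},\dots,a_{m+n}))=(T'\otimes T)\beta_{mn}(a_1\otimes\cdots\otimes a_{m+n})$, with $\beta$ built from the braiding $\sigma$ of $A$ ($T'$ decorated by the first $n$ resulting factors, $T$ by the last $m$). *)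

(* Defs.v *)
From HB Require Import structures.
From mathcomp Require Import all_boot all_order all_algebra.
From mathcomp Require Import zify.
From mathcomp Require Import boolp.

Set Implicit Arguments.
Unset Strict Implicit.
Unset Printing Implicit Defensive.

Import GRing.Theory.
Local Open Scope ring_scope.
Local Open Scope quotient_scope.

(* [pres Rel] is the k-module with a generator [pgen x] for each [x : X],
   subject to the relations [Rel] between formal linear expressions.  Free
   modules, direct sums and tensor products below are instances of it. *)

Section Presentation.
Variables (k : fieldType) (X : Type).

Inductive lexp : Type :=
| LZero
| LGen of X
| LAdd of lexp & lexp
| LScale of k & lexp.

HB.instance Definition _ := gen_eqMixin lexp.
HB.instance Definition _ := gen_choiceMixin lexp.

Variable Rel : lexp -> lexp -> Prop.

Inductive lcong : lexp -> lexp -> Prop :=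
| lc_refl e : lcong e e
| lc_sym e f : lcong e f -> lcong f e
| lc_trans e f g : lcong e f -> lcong f g -> lcong e g
| lc_rel e f : Rel e f -> lcong e f
| lc_add e e' f f' : lcong e e' -> lcong f f' -> lcong (LAdd e f) (LAdd e' f')
| lc_scale a e e' : lcong e e' -> lcong (LScale a e) (LScale a e')
| lc_addA e f g : lcong (LAdd e (LAdd f g)) (LAdd (LAdd e f) g)
| lc_addC e f : lcong (LAdd e f) (LAdd f e)
| lc_add0 e : lcong (LAdd LZero e) e
| lc_addN e : lcong (LAdd (LScale (-1) e) e) LZero
| lc_scaleA a b e : lcong (LScale a (LScale b e)) (LScale (a * b) e)
| lc_scale1 e : lcong (LScale 1 e) e
| lc_scaleDr a e f :
    lcong (LScale a (LAdd e f)) (LAdd (LScale a e) (LScale a f))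
| lc_scaleDl a b e :
    lcong (LScale (a + b) e) (LAdd (LScale a e) (LScale b e)).

Definition lcongb (e f : lexp) : bool := `[< lcong e f >].

Lemma lcongb_equiv : equiv_class_of lcongb.
Proof.
split.
- by move=> e; apply/asboolP; exact: lc_refl.
- move=> e f; apply/asboolP/asboolP; exact: lc_sym.
- move=> f e g /asboolP h1 /asboolP h2; apply/asboolP; exact: lc_trans h1 h2.
Qed.

Canonical lcong_equiv : equiv_rel lexp := EquivRelPack lcongb_equiv.

Definition pres : Type := {eq_quot lcong_equiv}.

HB.instance Definition _ := Choice.on pres.
HB.instance Definition _ := EqQuotient.on pres.

Definition pclass (e : lexp) : pres := \pi_pres e.

Lemma pclassP e f : pclass e = pclass f <-> lcong e f.
Proof.
split; first by move=> /eqmodP /asboolP.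
by move=> h; apply/eqmodP/asboolP.
Qed.

Lemma pclassK (q : pres) : pclass (repr q) = q.
Proof. exact: reprK. Qed.

Lemma repr_cong e : lcong (repr (pclass e)) e.
Proof. by apply/pclassP; rewrite pclassK. Qed.

Definition pzero : pres := pclass LZero.
Definition padd (p q : pres) : pres := pclass (LAdd (repr p) (repr q)).
Definition pscale (a : k) (p : pres) : pres := pclass (LScale a (repr p)).
Definition popp (p : pres) : pres := pscale (-1) p.

Lemma paddE e f : padd (pclass e) (pclass f) = pclass (LAdd e f).
Proof. by apply/pclassP; apply: lc_add; apply: repr_cong. Qed.

Lemma pscaleE a e : pscale a (pclass e) = pclass (LScale a e).
Proof. by apply/pclassP; apply: lc_scale; apply: repr_cong. Qed.

Lemma paddA : associative padd.
Proof.
move=> p q r; rewrite -(pclassK p) -(pclassK q) -(pclassK r) !paddE.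
by apply/pclassP; apply: lc_addA.
Qed.

Lemma paddC : commutative padd.
Proof.
move=> p q; rewrite -(pclassK p) -(pclassK q) !paddE.
by apply/pclassP; apply: lc_addC.
Qed.

Lemma padd0 : left_id pzero padd.
Proof.
by move=> p; rewrite -(pclassK p) paddE; apply/pclassP; apply: lc_add0.
Qed.

Lemma paddN : left_inverse pzero popp padd.
Proof.
move=> p; rewrite -(pclassK p) /popp pscaleE paddE.
by apply/pclassP; apply: lc_addN.
Qed.

HB.instance Definition _ :=
  GRing.isZmodule.Build pres paddA paddC padd0 paddN.

Lemma pscaleA a b (p : pres) : pscale a (pscale b p) = pscale (a * b) p.
Proof.
by rewrite -(pclassK p) !pscaleE; apply/pclassP; apply: lc_scaleA.
Qed.

Lemma pscale1 : left_id 1 pscale.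
Proof.
by move=> p; rewrite -(pclassK p) pscaleE; apply/pclassP; apply: lc_scale1.
Qed.

Lemma pscaleDr : right_distributive pscale +%R.
Proof.
move=> a p q; rewrite -(pclassK p) -(pclassK q).
rewrite /GRing.add /= paddE !pscaleE paddE.
by apply/pclassP; apply: lc_scaleDr.
Qed.

Lemma pscaleDl (p : pres) : {morph pscale^~ p : a b / a + b}.
Proof.
move=> a b; rewrite -(pclassK p) !pscaleE.
rewrite [RHS]/GRing.add /= paddE.
by apply/pclassP; apply: lc_scaleDl.
Qed.

HB.instance Definition _ :=
  GRing.Zmodule_isLmodule.Build k pres pscaleA pscale1 pscaleDr pscaleDl.

Definition pgen (x : X) : pres := pclass (LGen x).

Fixpoint leval (M : lmodType k) (f : X -> M) (e : lexp) : M :=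
  match e with
  | LZero => 0
  | LGen x => f x
  | LAdd e1 e2 => leval f e1 + leval f e2
  | LScale a e1 => a *: leval f e1
  end.

(* The linear map sending [pgen x] to [f x].  It is defined for every [f], but
   meaningful only when [f] respects [Rel]: see [plift_linear], [plift_gen]. *)
Definition plift (M : lmodType k) (f : X -> M) (p : pres) : M :=
  leval f (repr p).

Definition respects (M : lmodType k) (f : X -> M) : Prop :=
  forall e e', Rel e e' -> leval f e = leval f e'.

Lemma leval_cong (M : lmodType k) (f : X -> M) e e' :
  respects f -> lcong e e' -> leval f e = leval f e'.
Proof.
move=> hf; elim=> //=.
- by move=> e1 e2 e3 _ -> _ ->.
- by move=> e1 e2 f1 f2 _ -> _ ->.
- by move=> a e1 e2 _ ->.
- by move=> *; rewrite addrA.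
- by move=> *; rewrite addrC.
- by move=> *; rewrite add0r.
- by move=> *; rewrite scaleN1r addNr.
- by move=> *; rewrite scalerA.
- by move=> *; rewrite scale1r.
- by move=> *; rewrite scalerDr.
- by move=> *; rewrite scalerDl.
Qed.

Lemma plift_class (M : lmodType k) (f : X -> M) e :
  respects f -> plift f (pclass e) = leval f e.
Proof. by move=> hf; apply: leval_cong => //; apply: repr_cong. Qed.

Lemma plift_gen (M : lmodType k) (f : X -> M) x :
  respects f -> plift f (pgen x) = f x.
Proof. by move=> hf; rewrite plift_class. Qed.

Lemma plift_linear (M : lmodType k) (f : X -> M) :
  respects f -> linear (plift f).
Proof.
move=> hf a p q; rewrite -(pclassK p) -(pclassK q).
rewrite [_ *: pclass _]pscaleE [pclass _ + pclass _]paddE.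
by rewrite !plift_class.
Qed.

Lemma plift_uniq (M : lmodType k) (g h : pres -> M) :
  linear g -> linear h -> (forall x, g (pgen x) = h (pgen x)) -> g =1 h.
Proof.
move=> lg lh gh p; rewrite -(pclassK p).
have z (u : pres -> M) : linear u -> u 0 = 0.
  by move=> lu; move: (lu (-1) 0 0); rewrite scaler0 addr0 scaleN1r addNr.
elim: (repr p) => [|x|e ihe f ihf|a e ihe]; first by rewrite (z g) // (z h).
- exact: gh.
- have -> : pclass (LAdd e f) = 1 *: pclass e + pclass f.
    by rewrite scale1r /GRing.add /= paddE.
  by rewrite lg lh ihe ihf.
- have -> : pclass (LScale a e) = a *: pclass e + 0.
    by rewrite addr0 /GRing.scale /= pscaleE.
  by rewrite lg lh ihe (z g) // (z h).
Qed.

Lemma plift_ext (M : lmodType k) (f g : X -> M) p :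
  f =1 g -> plift f p = plift g p.
Proof.
by move=> fg; rewrite /plift; elim: (repr p) => //= [e -> e' ->|a e ->].
Qed.

Lemma plift_fun_linear (M : lmodType k) a (f g : X -> M) p :
  plift (fun x => a *: f x + g x) p = a *: plift f p + plift g p.
Proof.
rewrite /plift; elim: (repr p) => //= [|e -> e' ->|b e ->].
- by rewrite scaler0 addr0.
- by rewrite scalerDr addrACA.
- by rewrite scalerDr !scalerA mulrC.
Qed.

Lemma lrel_pclass e f : Rel e f -> pclass e = pclass f.
Proof. by move=> h; apply/pclassP; apply: lc_rel. Qed.

Lemma pclass_lin a e f : pclass (LAdd (LScale a e) f) = a *: pclass e + pclass f.
Proof. by rewrite [_ *: _]pscaleE [_ + _]paddE. Qed.

End Presentation.

Section Constructions.
Variable k : fieldType.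

Definition free_mod (X : Type) : lmodType k :=
  pres (fun _ _ : lexp k X => False).
Definition fgen (X : Type) (x : X) : free_mod X := pgen _ x.
Definition flift (X : Type) (M : lmodType k) (f : X -> M) : free_mod X -> M :=
  plift f.

Variant dsum_rel (I : Type) (M : I -> lmodType k) :
  lexp k {i : I & M i} -> lexp k {i : I & M i} -> Prop :=
| DsumRel i a (x y : M i) :
    dsum_rel (LAdd (LScale a (LGen _ (existT _ i x))) (LGen _ (existT _ i y)))
             (LGen _ (existT _ i (a *: x + y))).

Definition dsum (I : Type) (M : I -> lmodType k) : lmodType k :=
  pres (@dsum_rel I M).
Definition dsin (I : Type) (M : I -> lmodType k) (i : I) (x : M i) : dsum M :=
  pgen (@dsum_rel I M) (existT _ i x).
Definition dslift (I : Type) (M : I -> lmodType k) (N : lmodType k)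
    (f : forall i, M i -> N) : dsum M -> N :=
  plift (fun p : {i : I & M i} => f (projT1 p) (projT2 p)).

Variant tensor_rel (V W : lmodType k) :
  lexp k (V * W) -> lexp k (V * W) -> Prop :=
| TensorRelL a v v' w :
    tensor_rel (LAdd (LScale a (LGen _ (v, w))) (LGen _ (v', w)))
               (LGen _ (a *: v + v', w))
| TensorRelR a v w w' :
    tensor_rel (LAdd (LScale a (LGen _ (v, w))) (LGen _ (v, w')))
               (LGen _ (v, a *: w + w')).

Definition tensor (V W : lmodType k) : lmodType k := pres (@tensor_rel V W).
Definition tens (V W : lmodType k) (v : V) (w : W) : tensor V W :=
  pgen (@tensor_rel V W) (v, w).
Definition tlift (V W M : lmodType k) (f : V -> W -> M) : tensor V W -> M :=
  plift (fun p : V * W => f p.1 p.2).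

Definition is_bilinear (V W M : lmodType k) (f : V -> W -> M) : Prop :=
  bilinear_for *:%R *:%R f.

Lemma flift_linear X (M : lmodType k) (f : X -> M) : linear (flift f).
Proof. exact: plift_linear. Qed.

Lemma flift_gen X (M : lmodType k) (f : X -> M) x : flift f (fgen x) = f x.
Proof. exact: plift_gen. Qed.

Lemma dsin_linear I (M : I -> lmodType k) (i : I) : linear (@dsin I M i).
Proof.
move=> a x y; rewrite /dsin /pgen -pclass_lin.
by apply/esym/lrel_pclass; constructor.
Qed.

Lemma dslift_linear I (M : I -> lmodType k) (N : lmodType k)
  (f : forall i, M i -> N) : (forall i, linear (f i)) -> linear (dslift f).
Proof. by move=> hf; apply: plift_linear => _ _ [i a x y] /=; rewrite hf. Qed.

Lemma dslift_in I (M : I -> lmodType k) (N : lmodType k)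
  (f : forall i, M i -> N) i (x : M i) :
  (forall i, linear (f i)) -> dslift f (dsin x) = f i x.
Proof. by move=> hf; apply: plift_gen => _ _ [j a u v] /=; rewrite hf. Qed.

Lemma tens_bilinear (V W : lmodType k) : is_bilinear (@tens V W).
Proof.
split=> [w a v v'|v a w w'] /=; rewrite /tens /pgen -pclass_lin.
  by apply/esym/lrel_pclass; constructor.
by apply/esym/lrel_pclass; constructor.
Qed.

Lemma tlift_linear (V W M : lmodType k) (f : V -> W -> M) :
  is_bilinear f -> linear (tlift f).
Proof.
by case=> h1 h2; apply: plift_linear => _ _ [a v v' w|a v w w'] /=;
  rewrite ?h1 ?h2.
Qed.

Lemma tlift_tens (V W M : lmodType k) (f : V -> W -> M) v w :
  is_bilinear f -> tlift f (tens v w) = f v w.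
Proof.
by case=> h1 h2; apply: (@plift_gen _ _ _ _ _ (v, w));
  move=> _ _ [a x x' y|a x y y'] /=; rewrite ?h1 ?h2.
Qed.

Definition tmap (V V' W W' : lmodType k) (f : V -> V') (g : W -> W') :
  tensor V W -> tensor V' W' := tlift (fun v w => tens (f v) (g w)).

Definition tassocl (U V W : lmodType k) :
    tensor U (tensor V W) -> tensor (tensor U V) W :=
  tlift (fun u => tlift (fun v w => tens (tens u v) w)).

Definition tassocr (U V W : lmodType k) :
    tensor (tensor U V) W -> tensor U (tensor V W) :=
  tlift (fun uv w => tlift (fun u v => tens u (tens v w)) uv).

(* Tensor powers are nested to the right: V^{⊗3} is V ⊗ (V ⊗ (V ⊗ k)). *)
Fixpoint tpow (V : lmodType k) (n : nat) : lmodType k :=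
  match n with
  | 0 => k^o
  | n'.+1 => tensor V (tpow V n')
  end.

(* The pure tensor on the first n terms of s. *)
Fixpoint tpure (V : lmodType k) (n : nat) (s : seq V) : tpow V n :=
  match n with
  | 0 => (1 : k^o)
  | n'.+1 => tens (head 0 s) (tpure n' (behead s))
  end.

(* The linear map on V^{⊗n} extending a multilinear F on sequences of size n. *)
Fixpoint tpow_lift (V M : lmodType k) (n : nat) (F : seq V -> M) :
    tpow V n -> M :=
  match n return tpow V n -> M with
  | 0 => fun c : k^o => c *: F [::]
  | n'.+1 => tlift (fun v t => tpow_lift (fun s => F (v :: s)) t)
  end.

Definition multilinear (V M : lmodType k) (n : nat) (F : seq V -> M) : Prop :=
  forall s1 s2 a x y, (size s1 + (size s2).+1 = n)%N ->
    F (s1 ++ (a *: x + y) :: s2) = a *: F (s1 ++ x :: s2) + F (s1 ++ y :: s2).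

Lemma tpow_lift_ext (V M : lmodType k) n (F G : seq V -> M) t :
  (forall s, size s = n -> F s = G s) ->
  tpow_lift (n := n) F t = tpow_lift G t.
Proof.
elim: n F G t => [|n IH] F G t h /=; first by rewrite h.
by apply: plift_ext => -[v u] /=; apply: IH => s sz; rewrite h //= sz.
Qed.

Lemma tpow_lift_fun_linear (V M : lmodType k) n a (F G : seq V -> M) t :
  tpow_lift (n := n) (fun s => a *: F s + G s) t =
  a *: tpow_lift F t + tpow_lift G t.
Proof.
elim: n F G t => [|n IH] F G t /=.
  by rewrite scalerDr !scalerA mulrC.
by rewrite /tlift -plift_fun_linear; apply: plift_ext => -[v u] /=.
Qed.

Lemma tpow_lift_linear (V M : lmodType k) n (F : seq V -> M) :
  multilinear n F -> linear (tpow_lift (n := n) F).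
Proof.
elim: n F => [|n IH] F h.
  by move=> a x y /=; rewrite scalerDl scalerA.
apply: tlift_linear; split=> [t a v v'|v] /=.
  rewrite -tpow_lift_fun_linear; apply: tpow_lift_ext => s sz.
  by rewrite (h [::]) //= sz.
by apply: IH => s1 s2 a x y sz; apply: (h (v :: s1)); rewrite /= addSn sz.
Qed.

Lemma tpow_lift_pure (V M : lmodType k) n (F : seq V -> M) s :
  multilinear n F -> size s = n -> tpow_lift F (tpure n s) = F s.
Proof.
elim: n F s => [|n IH] F [|v s] //= h; first by rewrite scale1r.
move=> [sz]; rewrite tlift_tens.
  rewrite IH // => s1 s2 a x y szs.
  by apply: (h (v :: s1)); rewrite /= addSn szs.
split=> [t a x y|x] /=.
  rewrite -tpow_lift_fun_linear; apply: tpow_lift_ext => s1 sz1.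
  by rewrite (h [::]) //= sz1.
apply: tpow_lift_linear => s1 s2 a y z szs.
by apply: (h (x :: s1)); rewrite /= addSn szs.
Qed.

Lemma tpure_multilinear (V : lmodType k) n :
  multilinear n (fun s => tpure n s : tpow V n).
Proof.
elim: n => [|n IH] [|v s1] s2 a x y //= sz.
  exact: (@tens_bilinear _ _).1.
by case: sz => sz; rewrite IH //; exact: (@tens_bilinear _ _).2.
Qed.

End Constructions.

Section Braidings.
Variable k : fieldType.

Section OnV.
Variables (V : lmodType k) (sigma : tensor V V -> tensor V V).

(* sigma acting on the first two factors of V ⊗ (V ⊗ W). *)
Definition brd_fst (W : lmodType k) (t : tensor V (tensor V W)) :
    tensor V (tensor V W) :=
  tassocr (tmap sigma id (tassocl t)).

Definition brd1 (t : tensor V (tensor V V)) : tensor V (tensor V V) :=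
  brd_fst t.
Definition brd2 (t : tensor V (tensor V V)) : tensor V (tensor V V) :=
  tmap id sigma t.

Definition braiding : Prop :=
  linear sigma /\
  forall t, brd1 (brd2 (brd1 t)) = brd2 (brd1 (brd2 t)).

(* The two compatibilities of sigma with a bilinear operation op:
   (op ⊗ id) sigma_2 sigma_1 = sigma (id ⊗ op),
   (id ⊗ op) sigma_1 sigma_2 = sigma (op ⊗ id). *)
Definition braid_compat (op : V -> V -> V) : Prop :=
  (forall t : tensor V (tensor V V),
     tmap (tlift op) id (tassocl (brd2 (brd1 t))) =
     sigma (tmap id (tlift op) t)) /\
  (forall t : tensor V (tensor V V),
     tmap id (tlift op) (brd1 (brd2 t)) =
     sigma (tmap (tlift op) id (tassocl t))).

(* sigma_i on V^{⊗n}, meaningful for 1 <= i < n. *)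
Fixpoint sigma_at (i n : nat) : tpow V n -> tpow V n :=
  match n return tpow V n -> tpow V n with
  | 0 => id
  | n'.+1 =>
      match i with
      | 0 => id
      | 1 => match n' return tpow V n'.+1 -> tpow V n'.+1 with
             | 0 => id
             | n''.+1 => @brd_fst (tpow V n'')
             end
      | i'.+1 => tmap id (sigma_at i' (n := n'))
      end
  end.

Fixpoint sigma_word (l : seq nat) (n : nat) (t : tpow V n) : tpow V n :=
  match l with
  | [::] => t
  | i :: l' => sigma_at i (sigma_word l' t)
  end.

End OnV.

End Braidings.

(* Permutations act on {1, 2, ...}; [word_perm [:: i1; ...; il]] is the
   composite s_{i1} o ... o s_{il} of the transpositions s_i = (i i+1). *)
Definition adj_transp (i x : nat) : nat :=
  if x == i then i.+1 else if x == i.+1 then i else x.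

Definition word_perm (l : seq nat) (x : nat) : nat := foldr adj_transp x l.

Definition reduced_expression (w : nat -> nat) (l : seq nat) : Prop :=
  word_perm l =1 w /\
  forall l', word_perm l' =1 w -> (size l <= size l')%N.

Definition chi (i j x : nat) : nat :=
  if x == 0%N then 0%N
  else if (x <= i)%N then (j + x)%N
  else if (x <= i + j)%N then (x - i)%N
  else x.

(* s_j ... s_1 . s_{j+1} ... s_2 . (...) . s_{i+j-1} ... s_i, a reduced
   expression of chi i j by [chi_word_reduced]. *)
Definition chi_word (i j : nat) : seq nat :=
  flatten (mkseq (fun a => rev (iota a.+1 j)) i).

Definition beta (k : fieldType) (V : lmodType k)
    (sigma : tensor V V -> tensor V V) (i j : nat) :
    tpow V (i + j) -> tpow V (i + j) :=
  sigma_word sigma (chi_word i j) (n := i + j).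

Lemma word_perm_cat l1 l2 x :
  word_perm (l1 ++ l2) x = word_perm l1 (word_perm l2 x).
Proof. by rewrite /word_perm foldr_cat. Qed.

Lemma word_perm_block a j x :
  word_perm (rev (iota a.+1 j)) x =
  (if x == a.+1 then a + j.+1
   else if (a.+1 < x) && (x <= a + j.+1) then x.-1 else x)%N.
Proof.
elim: j x => [|j IH] x; first by rewrite /=; do ?case: ifP; lia.
rewrite -[j.+1]addn1 iotaD rev_cat word_perm_cat IH /= /adj_transp.
by do ?case: ifP; lia.
Qed.

Lemma chi_wordE i j : (0 < j)%N -> word_perm (chi_word i j) =1 chi i j.
Proof.
move=> j0; elim: i => [|i IH] x.
  by rewrite /chi_word /chi /=; do ?case: ifP; lia.
rewrite /chi_word mkseqS flatten_rcons word_perm_cat IH word_perm_block /chi.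
by do ?case: ifP; lia.
Qed.

Lemma sumn_adj_transp i (s : seq nat) :
  uniq s -> (sumn (map (adj_transp i) s) <= (sumn s).+1)%N.
Proof.
move=> us; have h : (count_mem i s <= 1)%N by rewrite count_uniq_mem ?leq_b1.
suff : (sumn (map (adj_transp i) s) <= sumn s + count_mem i s)%N by lia.
elim: s {us h} => //= x s IH.
have : (adj_transp i x <= x + (x == i))%N.
  by rewrite /adj_transp; do ?case: eqP; lia.
lia.
Qed.

Lemma adj_transp_inj i : injective (adj_transp i).
Proof. by move=> x y; rewrite /adj_transp; do ?case: eqP; lia. Qed.

Lemma sumn_word_perm l (s : seq nat) :
  uniq s -> (sumn (map (word_perm l) s) <= sumn s + size l)%N.
Proof.
move=> us; elim: l => [|i l IH]; first by rewrite map_id addn0.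
have -> : map (word_perm (i :: l)) s =
          map (adj_transp i) (map (word_perm l) s) by rewrite -map_comp.
have inj : injective (word_perm l).
  elim: l {IH} => [|p l IHl] x y //= /adj_transp_inj; exact: IHl.
have := @sumn_adj_transp i (map (word_perm l) s).
by rewrite map_inj_uniq //= => /(_ us); lia.
Qed.

Lemma chi_word_reduced i j :
  (0 < j)%N -> reduced_expression (chi i j) (chi_word i j).
Proof.
move=> j0; split=> [|l hl]; first exact: chi_wordE.
have := sumn_word_perm l (iota_uniq 1 i).
rewrite (eq_map hl).
have -> : sumn (map (chi i j) (iota 1 i)) = (sumn (iota 1 i) + i * j)%N.
  have -> : map (chi i j) (iota 1 i) = map (addn j) (iota 1 i).
    apply/eq_in_map => x; rewrite mem_iota /chi => /andP[? ?].
    by do ?case: ifP; lia.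
  have e s : (sumn (map (addn j) s) = sumn s + size s * j)%N.
    by elim: s => //= x s ->; rewrite mulSn; lia.
  by rewrite e size_iota.
have -> : size (chi_word i j) = (i * j)%N.
  rewrite /chi_word size_flatten /shape -map_comp -[in RHS](size_iota 0 i).
  by elim: (iota 0 i) => //= a s ->; rewrite size_rev size_iota mulSn.
lia.
Qed.

Section Structures.
Variable k : fieldType.

Record braided_algebra (A : lmodType k) (mul : A -> A -> A)
    (sigma : tensor A A -> tensor A A) : Prop := {
  ba_bilinear : is_bilinear mul;
  ba_assoc : associative mul;
  ba_braiding : braiding sigma;
  ba_compat : braid_compat sigma mul
}.

Record braided_algebra_hom
    (A : lmodType k) (mulA : A -> A -> A) (sigma : tensor A A -> tensor A A)
    (B : lmodType k) (mulB : B -> B -> B) (tau : tensor B B -> tensor B B)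
    (f : A -> B) : Prop := {
  bah_linear : linear f;
  bah_mul : forall x y, f (mulA x y) = mulB (f x) (f y);
  bah_braid : forall t, tmap f f (sigma t) = tau (tmap f f t)
}.

Record tridendriform (R : lmodType k) (prec succ dot : R -> R -> R) : Prop := {
  td_prec_bilinear : is_bilinear prec;
  td_succ_bilinear : is_bilinear succ;
  td_dot_bilinear : is_bilinear dot;
  td_prec_prec : forall x y z,
    prec (prec x y) z = prec x (prec y z + succ y z + dot y z);
  td_succ_prec : forall x y z, prec (succ x y) z = succ x (prec y z);
  td_succ_succ : forall x y z,
    succ x (succ y z) = succ (prec x y + succ x y + dot x y) z;
  td_dot_prec : forall x y z, prec (dot x y) z = dot x (prec y z);
  td_prec_dot : forall x y z, dot (prec x y) z = dot x (succ y z);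
  td_succ_dot : forall x y z, dot (succ x y) z = succ x (dot y z);
  td_dot_dot : forall x y z, dot (dot x y) z = dot x (dot y z)
}.

Record braided_tridendriform (R : lmodType k) (prec succ dot : R -> R -> R)
    (sigma : tensor R R -> tensor R R) : Prop := {
  bt_tridendriform : tridendriform prec succ dot;
  bt_braiding : braiding sigma;
  bt_prec : braid_compat sigma prec;
  bt_succ : braid_compat sigma succ;
  bt_dot : braid_compat sigma dot
}.

Record braided_tridendriform_hom
    (R : lmodType k) (prec succ dot : R -> R -> R)
    (sigma : tensor R R -> tensor R R)
    (R' : lmodType k) (prec' succ' dot' : R' -> R' -> R')
    (sigma' : tensor R' R' -> tensor R' R')
    (f : R -> R') : Prop := {
  bth_linear : linear f;
  bth_prec : forall x y, f (prec x y) = prec' (f x) (f y);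
  bth_succ : forall x y, f (succ x y) = succ' (f x) (f y);
  bth_dot : forall x y, f (dot x y) = dot' (f x) (f y);
  bth_braid : forall t, tmap f f (sigma t) = sigma' (tmap f f t)
}.

End Structures.

(* [Vee T0 [:: (a1, T1); ...; (a_{k-1}, T_{k-1})] ak Tk] is
   T0 ∨_{a1} T1 ... ∨_{ak} Tk with k >= 1, so the first and the last branch of
   the root are immediate subterms and every internal vertex has at least two
   branches.  [tree unit] is the type of undecorated planar rooted trees. *)
Inductive tree (D : Type) : Type :=
| Leaf
| Vee of tree D & seq (D * tree D) & D & tree D.

Arguments Leaf {D}.

Section Trees.

Fixpoint tree_nested_ind (D : Type) (P : tree D -> Prop)
  (hL : P Leaf)
  (hV : forall t0 mid a t,
     P t0 -> foldr (fun p Q => P p.2 /\ Q) True mid -> P t ->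
     P (Vee t0 mid a t)) (T : tree D) : P T :=
  match T with
  | Leaf => hL
  | Vee t0 mid a t =>
      hV t0 mid a t (tree_nested_ind hL hV t0)
        ((fix go (m : seq (D * tree D)) :
            foldr (fun p Q => P p.2 /\ Q) True m :=
            match m with
            | [::] => I
            | p :: m' => conj (tree_nested_ind hL hV p.2) (go m')
            end) mid)
        (tree_nested_ind hL hV t)
  end.

Definition is_leaf (D : Type) (T : tree D) : bool :=
  if T is Leaf then true else false.

Fixpoint leaves (D : Type) (T : tree D) : nat :=
  match T with
  | Leaf => 1
  | Vee t0 mid _ t =>
      leaves t0 + sumn (map (fun p => leaves p.2) mid) + leaves t
  end.

(* [mid] holds exactly the branches other than the leftmost and rightmost. *)
Fixpoint dense (D : Type) (T : tree D) : bool :=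
  match T with
  | Leaf => true
  | Vee t0 mid _ t =>
      [&& dense t0, all (fun p => ~~ is_leaf p.2 && dense p.2) mid & dense t]
  end.

(* From left to right: the i-th angle lies between the i-th and (i+1)-th leaves. *)
Fixpoint angles (D : Type) (T : tree D) : seq D :=
  match T with
  | Leaf => [::]
  | Vee t0 mid a t =>
      angles t0 ++ flatten (map (fun p => p.1 :: angles p.2) mid)
      ++ a :: angles t
  end.

Fixpoint shape (D : Type) (T : tree D) : tree unit :=
  match T with
  | Leaf => Leaf
  | Vee t0 mid _ t =>
      Vee (shape t0) (map (fun p => (tt, shape p.2)) mid) tt (shape t)
  end.

Fixpoint decorate_mid (D E : Type) (d : E) (f : tree D -> seq E -> tree E)
    (mid : seq (D * tree D)) (s : seq E) : seq (E * tree E) * seq E :=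
  match mid with
  | [::] => ([::], s)
  | p :: mid' =>
      let r := decorate_mid d f mid' (drop (size (angles p.2)) (behead s)) in
      ((head d s, f p.2 (behead s)) :: r.1, r.2)
  end.

(* The tree of the same shape as T whose i-th angle is decorated by the i-th
   term of s; d is used when s is too short. *)
Fixpoint decorate (D E : Type) (d : E) (T : tree D) (s : seq E)
    {struct T} : tree E :=
  match T with
  | Leaf => Leaf
  | Vee t0 mid _ t =>
      let r := decorate_mid d (decorate d) mid (drop (size (angles t0)) s) in
      Vee (decorate d t0 s) r.1 (head d r.2) (decorate d t (behead r.2))
  end.

Lemma leavesE D (T : tree D) : leaves T = (size (angles T)).+1.
Proof.
elim/tree_nested_ind: T => //= t0 mid a t -> h ->.
rewrite !size_cat /=.
suff -> : sumn (map (fun p => leaves p.2) mid) =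
          size (flatten (map (fun p => p.1 :: angles p.2) mid)) by lia.
by elim: mid h => //= p mid IH [-> /IH ->]; rewrite size_cat; lia.
Qed.

Lemma split_size E (s : seq E) m n :
  size s = (m + n)%N -> exists u v, [/\ s = u ++ v, size u = m & size v = n].
Proof.
move=> h; exists (take m s), (drop m s).
by rewrite cat_take_drop size_drop size_takel; last lia; split=> //; lia.
Qed.

Lemma decorateP D E (d : E) (T : tree D) (s r : seq E) :
  size s = size (angles T) ->
  shape (decorate d T (s ++ r)) = shape T /\
  angles (decorate d T (s ++ r)) = s.
Proof.
elim/tree_nested_ind: T s r => [|t0 mid a t IH0 IHm IHt] s r /=.
  by move/size0nil->.
set go := decorate_mid d (decorate d).
have goP m s1 r1 :
    foldr (fun p Q => (forall s r, size s = size (angles p.2) ->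
      shape (decorate d p.2 (s ++ r)) = shape p.2 /\
      angles (decorate d p.2 (s ++ r)) = s) /\ Q) True m ->
    size s1 = size (flatten (map (fun p : D * tree D => p.1 :: angles p.2) m)) ->
    [/\ map (fun p => (tt, shape p.2)) (go m (s1 ++ r1)).1 =
          map (fun p => (tt, shape p.2)) m,
        flatten (map (fun p => p.1 :: angles p.2) (go m (s1 ++ r1)).1) = s1
      & (go m (s1 ++ r1)).2 = r1].
  elim: m s1 r1 => [|p m IH] [|x s1] r1 //= [hp hm].
  rewrite size_cat => -[/split_size[u [v [-> szu szv]]]].
  rewrite -catA; have [-> ->] := hp u (v ++ r1) szu.
  by rewrite -szu drop_size_cat //; have [-> -> ->] := IH v r1 hm szv.
rewrite !size_cat => /split_size[s0 [s' [-> sz0 /split_size[s1 [s2 [-> sz1]]]]]].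
case: s2 => //= x s2 [sz2].
rewrite -!catA drop_size_cat //.
have [-> ->] := IH0 s0 (s1 ++ (x :: s2) ++ r) sz0.
have [-> -> ->] := goP _ s1 ((x :: s2) ++ r) IHm sz1.
by rewrite /=; have [-> ->] := IHt s2 r sz2.
Qed.

Lemma shapeK D (d : D) (T : tree D) (r : seq D) :
  decorate d (shape T) (angles T ++ r) = T.
Proof.
have sz (T' : tree D) : size (angles (shape T')) = size (angles T').
  elim/tree_nested_ind: T' => //= t0 mid a t h0 hm h.
  rewrite !size_cat /= h0 h; congr (_ + (_ + _)%N)%N.
  elim: mid hm => //= p mid IH [hp /IH].
  by rewrite !size_cat hp => ->.
elim/tree_nested_ind: T r => [|t0 mid a t IH0 IHm IHt] r //=.
rewrite -!catA IH0 sz drop_size_cat //.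
suff -> : decorate_mid d (decorate d) (map (fun p => (tt, shape p.2)) mid)
    (flatten (map (fun p => p.1 :: angles p.2) mid)
     ++ (a :: angles t) ++ r) = (mid, (a :: angles t) ++ r) by rewrite /= IHt.
elim: mid IHm => //= -[b u] mid IH [/= hu hm].
by rewrite -catA sz drop_size_cat // IH // hu.
Qed.

Lemma dense_shape D (T : tree D) : dense (shape T) = dense T.
Proof.
elim/tree_nested_ind: T => //= t0 mid a t -> hm ->; congr [&& _, _ & _].
elim: mid hm => //= -[b u] mid IH [/= -> /IH ->].
by case: u.
Qed.

Lemma leaves_shape D (T : tree D) : leaves (shape T) = leaves T.
Proof.
elim/tree_nested_ind: T => //= t0 mid a t -> hm ->; congr (_ + _ + _)%N.
by elim: mid hm => //= -[b u] mid IH [/= -> /IH ->].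
Qed.

End Trees.

Section TreeProducts.
Variables (A : Type) (mul : A -> A -> A).

(* The root vertices of T0 ∨ mid ∨_a t and t0' ∨ mid' ∨_{a'} t' merged into one,
   with the branches t and t0' replaced by the single branch u. *)
Definition vee_join (t0 : tree A) (mid : seq (A * tree A)) (a : A) (u : tree A)
    (mid' : seq (A * tree A)) (a' : A) (t' : tree A) : tree A :=
  Vee t0 (mid ++ (a, u) :: mid') a' t'.

(* The same with both t and t0' dropped and the angles on both sides of them
   merged. *)
Definition vee_merge (t0 : tree A) (mid : seq (A * tree A)) (a : A)
    (mid' : seq (A * tree A)) (a' : A) (t' : tree A) : tree A :=
  match mid' with
  | [::] => Vee t0 mid (mul a a') t'
  | (b, u) :: m => Vee t0 (mid ++ (mul a b, u) :: m) a' t'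
  end.

(* The products of two trees are sums of trees, represented by sequences;
   see [tree_starE] for the recursion in terms of the three operations. *)
Fixpoint tree_star (T : tree A) : tree A -> seq (tree A) :=
  match T with
  | Leaf => fun T' => [:: T']
  | Vee t0 mid a t =>
      fix star_T (T' : tree A) : seq (tree A) :=
        match T' with
        | Leaf => [:: T]
        | Vee t0' mid' a' t' =>
            [seq Vee t0 mid a U | U <- tree_star t T']
            ++ [seq Vee U mid' a' t' | U <- star_T t0']
            ++ (if is_leaf t && is_leaf t0'
                then [:: vee_merge t0 mid a mid' a' t']
                else [seq vee_join t0 mid a U mid' a' t' | U <- tree_star t t0'])
        end
  end.

(* These are only used when neither T nor T' is the trivial tree. *)
Definition tree_prec (T T' : tree A) : seq (tree A) :=
  match T with
  | Leaf => [::]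
  | Vee t0 mid a t => [seq Vee t0 mid a U | U <- tree_star t T']
  end.

Definition tree_succ (T T' : tree A) : seq (tree A) :=
  match T' with
  | Leaf => [::]
  | Vee t0' mid' a' t' => [seq Vee U mid' a' t' | U <- tree_star T t0']
  end.

Definition tree_dot (T T' : tree A) : seq (tree A) :=
  match T, T' with
  | Vee t0 mid a t, Vee t0' mid' a' t' =>
      if is_leaf t && is_leaf t0'
      then [:: vee_merge t0 mid a mid' a' t']
      else [seq vee_join t0 mid a U mid' a' t' | U <- tree_star t t0']
  | _, _ => [::]
  end.

Lemma tree_starE T T' :
  tree_star T T' =
  if is_leaf T then [:: T'] else if is_leaf T' then [:: T]
  else tree_prec T T' ++ tree_succ T T' ++ tree_dot T T'.
Proof. by case: T T' => [|t0 mid a t] [|t0' mid' a' t']. Qed.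

End TreeProducts.

Definition dense_tree (n : nat) : Type :=
  {T : tree unit | dense T && (leaves T == n.+1)}.

Section AngularlyDecorated.
Variables (k : fieldType) (A : lmodType k).

Definition angular_component (n : nat) : lmodType k :=
  tensor (free_mod k (dense_tree n)) (tpow A n).

(* The sum over n >= 1, reindexed to start at 0. *)
Definition PAbar : lmodType k := dsum (fun n => angular_component n.+1).

(* The basis element of the free module on dense trees given by a tree (0 if
   the tree is not a dense tree with n+1 leaves). *)
Definition shape_vect (n : nat) (T : tree unit) : free_mod k (dense_tree n) :=
  if insub T is Some g then fgen k (g : dense_tree n) else 0.

(* The element of [PAbar] identified with a decorated dense tree other than the
   trivial one. *)
Definition tree_vect (T : tree A) : PAbar :=
  let n := (size (angles T)).-1 in
  dsin (M := fun n => angular_component n.+1) (i := n)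
    (tens (shape_vect n.+1 (shape T)) (tpure n.+1 (angles T))).

(* The linear map on [PAbar] extending a map F on decorated trees which is
   multilinear in the decorations. *)
Definition PA_lift (M : lmodType k) (F : tree A -> M) : PAbar -> M :=
  dslift (fun n =>
    tlift (fun (g : free_mod k (dense_tree n.+1)) (t : tpow A n.+1) =>
      flift (fun T : dense_tree n.+1 =>
        tpow_lift (fun s => F (decorate 0 (val T) s)) t) g)).

Lemma PA_lift_tree (M : lmodType k) (F : tree A -> M) (T : tree A) :
  (forall S : tree unit, dense S ->
     multilinear (leaves S).-1 (fun s => F (decorate 0 S s))) ->
  dense T -> ~~ is_leaf T -> PA_lift F (tree_vect T) = F T.
Proof.
move=> hF dT nT.
have bil n : is_bilinear (fun (g : free_mod k (dense_tree n)) (t : tpow A n) =>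
    flift (fun S : dense_tree n =>
      tpow_lift (fun s => F (decorate 0 (val S) s)) t) g).
  split=> [t|g a t t'] /=; first exact: flift_linear.
  rewrite -plift_fun_linear; apply: plift_ext => -[S hS] /=.
  have /andP[dS /eqP lS] := hS; apply: tpow_lift_linear.
  by have := hF S dS; rewrite lS.
have n0 : (size (angles T)).-1.+1 = size (angles T).
  case: {hF dT} T nT => //= t0 mid a t _.
  by rewrite !size_cat /= !addnS.
rewrite /PA_lift /tree_vect dslift_in => [|i]; last exact: tlift_linear.
rewrite tlift_tens // /shape_vect insubT.
  by rewrite dense_shape dT leaves_shape leavesE n0 eqxx.
move=> hT; rewrite flift_gen tpow_lift_pure /=.
- by rewrite -[angles T]cats0 shapeK.
- have := hF (shape T); rewrite dense_shape leaves_shape leavesE n0 => h.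
  exact: h.
- by rewrite n0.
Qed.

(* The bilinear operation extending a product on decorated trees. *)
Definition PA_op (F : tree A -> tree A -> seq (tree A)) (x y : PAbar) : PAbar :=
  PA_lift (fun T => PA_lift (fun T' => \sum_(U <- F T T') tree_vect U) y) x.

Variables (mul : A -> A -> A) (sigma : tensor A A -> tensor A A).

(* The decorations keep their left-to-right order in these products, so that
   sigma does not occur in them. *)
Definition PA_prec : PAbar -> PAbar -> PAbar := PA_op (tree_prec mul).
Definition PA_succ : PAbar -> PAbar -> PAbar := PA_op (tree_succ mul).
Definition PA_dot : PAbar -> PAbar -> PAbar := PA_op (tree_dot mul).

Definition tree_braid (T T' : tree A) : tensor PAbar PAbar :=
  let m := size (angles T) in
  let n := size (angles T') in
  tpow_lift
    (fun s => tens (tree_vect (decorate 0 T' (take n s)))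
                   (tree_vect (decorate 0 T (drop n s))))
    (beta sigma (i := m) (j := n) (tpure (m + n) (angles T ++ angles T'))).

Definition PA_sigma : tensor PAbar PAbar -> tensor PAbar PAbar :=
  tlift (fun x y => PA_lift (fun T => PA_lift (fun T' => tree_braid T T') y) x).

Definition PA_incl (a : A) : PAbar := tree_vect (Vee Leaf [::] a Leaf).

End AngularlyDecorated.

(* Main.v *)
Require Import Defs.
From HB Require Import structures.
From mathcomp Require Import all_boot all_algebra.
From mathcomp Require Import zify.
From mathcomp Require Import boolp.

Set Implicit Arguments.
Unset Strict Implicit.
Unset Printing Implicit Defensive.

Import GRing.Theory.
Local Open Scope ring_scope.

(** Two things have to be explained: why decorated dense trees form the free
tridendriform algebra on the associative algebra A, and why the braiding
follows.

The products of trees never permute decorations, so the first question does not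
involve sigma.  A tree T0 \/_{a1} T1 ... \/_{ak} Tk is the value of the expression
  T0 succ ((a1 prec T1) . ((a2 prec T2) . ... (ak prec Tk)))
in the generators a_i, where an operation with a trivial tree is left out.  For
dense trees this is an identity in the algebra of trees ([tree_eval_incl]): the
inner branches are not trivial, so none of these dot products merges two
angles.  Hence the trees are generated by A, and a homomorphism is determined
by its restriction to A.  Conversely, evaluating the expression in any
tridendriform algebra R turns the three products of trees into the products of
R ([tree_eval_prec], [tree_eval_succ], [tree_eval_dot]), by an induction along
the recursive definition of the products that uses the axioms of R.  The
axioms for the trees themselves all come down to associativity of the total
product on smaller trees ([tree_star_assoc]).

For the braiding, the main point is that for a vector space W and a
tridendriform algebra B the linear maps W -> W (x) B form a tridendriform
algebra under composition combined with a product of B, in either order of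
composition ([convolution_tridendriform], [coconvolution_tridendriform]).  The
two compatibilities of a braiding tau of B with the products say that
p |-> tau (p (x) -) and, up to the flip, q |-> tau (- (x) q) are homomorphisms to
algebras of this kind.  Freeness therefore produces the braiding in two steps:
the crossings of one generator with an arbitrary element ([crossing_exists]),
and then those of two arbitrary elements ([braid_exists]); what makes each step
possible is the compatibility of sigma with the product of A.  The remaining
properties of the braiding -- compatibility on the other side, Yang-Baxter,
naturality along the induced homomorphism -- are equalities of linear maps that
propagate from two arguments to their products, so they reduce to generators,
where they are the hypotheses on sigma and psi ([sw_braid_right],
[braid_yang_baxter], [braid_natural]).

Finally, this braiding is the one defined on trees through beta: the chosen
reduced word of chi makes the letters of the first tree, from the last to the
first, cross all letters of the second one ([beta_link]), and so does the
braiding obtained from freeness ([braid_eval]). *)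

(** * Calculus of tensors in Sweedler notation *)

(** Sweedler notation.  A tensor has a chosen representative, a finite formal sum
of pure tensors, over which [tlift F] sums the values of F.  Hence congruence
([tlift_ext]), exchange of two sums ([tlift_exch]) and passage through a linear
map ([tlift_comp]) hold for every F; bilinearity of F is only needed to compute
the value on a given pure tensor ([sw_tens]). *)
Notation "'sw' ( x , y ) <- t ; F" := (tlift (fun x y => F) t)
  (at level 200, x name, y name, t at level 100, F at level 200,
   format "'[v' 'sw'  ( x , y )  <-  t ; '/' F ']'") : ring_scope.

(** Linearity with its scaling operation fixed, so that the tactic [lin] below can
match on it; it is convertible to [linear]. *)
Definition islin (k : fieldType) (U V : lmodType k) (f : U -> V) : Prop :=
  forall a x y, f (a *: x + y) = a *: f x + f y.

Definition isbil (k : fieldType) (U V W : lmodType k) (f : U -> V -> W) : Prop :=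
  (forall y, islin (fun x => f x y)) /\ (forall x, islin (f x)).

Section Sweedler.
Variable k : fieldType.
Implicit Types U V W M N : lmodType k.

Lemma isbilP U V W (f : U -> V -> W) : isbil f <-> is_bilinear f.
Proof. by split=> -[h1 h2]; split. Qed.

Lemma islin0 U V (f : U -> V) : islin f -> f 0 = 0.
Proof. by move=> lf; have := lf (-1) 0 0; rewrite scaler0 addr0 scaleN1r addNr. Qed.

Lemma islinD U V (f : U -> V) x y : islin f -> f (x + y) = f x + f y.
Proof. by move=> lf; have := lf 1 x y; rewrite !scale1r. Qed.

Lemma islinZ U V (f : U -> V) a x : islin f -> f (a *: x) = a *: f x.
Proof. by move=> lf; have := lf a x 0; rewrite (islin0 lf) !addr0. Qed.

Lemma islin_sum U V (f : U -> V) I (s : seq I) (F : I -> U) : islin f ->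
  f (\sum_(i <- s) F i) = \sum_(i <- s) f (F i).
Proof.
move=> lf; elim: s => [|i s IH]; first by rewrite !big_nil (islin0 lf).
by rewrite !big_cons islinD // IH.
Qed.

Lemma lin_id U : islin (fun x : U => x).
Proof. by []. Qed.

Lemma lin_comp U V W (f : V -> W) (g : U -> V) :
  islin f -> islin g -> islin (fun x => f (g x)).
Proof. by move=> lf lg a x y; rewrite lg lf. Qed.

Lemma lin_add U V (f g : U -> V) : islin f -> islin g ->
  islin (fun x => f x + g x).
Proof. by move=> lf lg a x y; rewrite lf lg scalerDr addrACA. Qed.

Lemma lin_scale U V (c : k) (f : U -> V) : islin f ->
  islin (fun x => c *: f x).
Proof. by move=> lf a x y; rewrite lf scalerDr !scalerA mulrC. Qed.

Lemma tlift0 V W M (t : tensor V W) : tlift (fun _ _ => 0 : M) t = 0.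
Proof.
rewrite /tlift /plift; elim: (repr t) => //= [e -> f ->|a e ->].
  exact: addr0.
exact: scaler0.
Qed.

Lemma tliftD V W M (F G : V -> W -> M) t :
  tlift (fun x y => F x y + G x y) t = tlift F t + tlift G t.
Proof.
rewrite -[tlift F t]scale1r -plift_fun_linear.
by apply: plift_ext => p; rewrite scale1r.
Qed.

Section Tensor.
Variables V W : lmodType k.
Implicit Type t : tensor V W.

Lemma tlift_ext M (F G : V -> W -> M) t :
  (forall x y, F x y = G x y) -> tlift F t = tlift G t.
Proof. by move=> FG; apply: plift_ext => -[x y] /=. Qed.

Lemma tlift_comp M N (h : M -> N) (F : V -> W -> M) t : islin h ->
  h (tlift F t) = tlift (fun x y => h (F x y)) t.
Proof.
move=> lh; rewrite /tlift /plift; elim: (repr t) => /= [|p|e IHe f IHf|a e IHe].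
- exact: islin0.
- by [].
- by rewrite islinD // IHe IHf.
- by rewrite islinZ // IHe.
Qed.

Lemma lin_sw_fun U M (F : U -> V -> W -> M) t :
  (forall x y, islin (fun u => F u x y)) -> islin (fun u => tlift (F u) t).
Proof.
move=> lF a u v; rewrite -plift_fun_linear; apply: plift_ext => -[x y] /=.
exact: lF.
Qed.

Lemma tlift_exch V' W' M (F : V -> W -> V' -> W' -> M) t (t' : tensor V' W') :
  tlift (fun x y => tlift (fun x' y' => F x y x' y') t') t =
  tlift (fun x' y' => tlift (fun x y => F x y x' y') t) t'.
Proof.
rewrite {1}/tlift /plift.
transitivity (tlift (fun x' y' =>
   leval (fun p : V * W => F p.1 p.2 x' y') (repr t)) t'); last first.
  by apply: plift_ext.
elim: (repr t) => /= [|p|e -> f ->|a e ->] //.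
- by rewrite tlift0.
- by rewrite -[X in X + _]scale1r -plift_fun_linear; apply: plift_ext => p;
    rewrite scale1r.
- rewrite -[LHS]addr0 -[X in _ + X](@tlift0 _ _ _ t') -plift_fun_linear.
  by apply: plift_ext => p; rewrite addr0.
Qed.

Lemma tensor_ext M (g h : tensor V W -> M) : islin g -> islin h ->
  (forall x y, g (tens x y) = h (tens x y)) -> g =1 h.
Proof. by move=> lg lh gh; apply: plift_uniq => // -[x y]; apply: gh. Qed.

Lemma tlift_tensE t : tlift (fun x y => tens x y) t = t.
Proof.
apply: (@tensor_ext _ _ id) => //; first exact/tlift_linear/tens_bilinear.
by move=> x y; rewrite tlift_tens //; apply: tens_bilinear.
Qed.

Lemma lin_tensl (y : W) : islin (fun x : V => tens x y).
Proof. exact: (@tens_bilinear _ _ _).1. Qed.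

Lemma lin_tensr (x : V) : islin (fun y : W => tens x y).
Proof. exact: (@tens_bilinear _ _ _).2. Qed.

End Tensor.

Lemma tmap_linear V V' W W' (f : V -> V') (g : W -> W') :
  islin f -> islin g -> islin (tmap f g).
Proof. by move=> lf lg; apply: tlift_linear; split=> ? a x y /=;
  rewrite ?lf ?lg ?lin_tensl ?lin_tensr. Qed.

End Sweedler.

Section TensorLemmas.
Variable k : fieldType.
Implicit Types U V W M N : lmodType k.

Lemma lin_sw V W M (F : V -> W -> M) : isbil F -> islin (tlift F).
Proof. by move=> /isbilP/tlift_linear. Qed.

Lemma sw_tens V W M (F : V -> W -> M) x y :
  isbil F -> tlift F (tens x y) = F x y.
Proof. by move=> /isbilP bF; apply: tlift_tens. Qed.

End TensorLemmas.

Section LinearMaps.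
Variables (k : fieldType) (U V : lmodType k).

(** The space of linear maps, needed as a module because homomorphisms with values
in it are obtained from freeness. *)
Record linmap : Type := Linmap { lapp :> U -> V; lappP : islin lapp }.

HB.instance Definition _ := gen_eqMixin linmap.
HB.instance Definition _ := gen_choiceMixin linmap.

Lemma linmapP (f g : linmap) : (forall x, f x = g x) -> f = g.
Proof.
case: f g => [f lf] [g lg] /= /funext fg; subst g.
by congr Linmap; apply: Prop_irrelevance.
Qed.

Lemma islin_zero : islin (fun _ : U => 0 : V).
Proof. by move=> a x y; rewrite scaler0 addr0. Qed.

Lemma islin_opp (f : linmap) : islin (fun x => - f x).
Proof. by move=> a x y; rewrite lappP opprD scalerN. Qed.

Definition linmap_zero := Linmap islin_zero.
Definition linmap_opp f := Linmap (islin_opp f).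
Definition linmap_add (f g : linmap) := Linmap (lin_add (lappP f) (lappP g)).
Definition linmap_scale a (f : linmap) := Linmap (lin_scale a (lappP f)).

Fact linmap_addA : associative linmap_add.
Proof. by move=> f g h; apply: linmapP => x /=; rewrite addrA. Qed.
Fact linmap_addC : commutative linmap_add.
Proof. by move=> f g; apply: linmapP => x /=; rewrite addrC. Qed.
Fact linmap_add0 : left_id linmap_zero linmap_add.
Proof. by move=> f; apply: linmapP => x /=; rewrite add0r. Qed.
Fact linmap_addN : left_inverse linmap_zero linmap_opp linmap_add.
Proof. by move=> f; apply: linmapP => x /=; rewrite addNr. Qed.

HB.instance Definition _ := GRing.isZmodule.Build linmap
  linmap_addA linmap_addC linmap_add0 linmap_addN.

Fact linmap_scaleA a b (f : linmap) :
  linmap_scale a (linmap_scale b f) = linmap_scale (a * b) f.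
Proof. by apply: linmapP => x /=; rewrite scalerA. Qed.
Fact linmap_scale1 : left_id 1 linmap_scale.
Proof. by move=> f; apply: linmapP => x /=; rewrite scale1r. Qed.
Fact linmap_scaleDr : right_distributive linmap_scale +%R.
Proof. by move=> a f g; apply: linmapP => x /=; rewrite scalerDr. Qed.
Fact linmap_scaleDl f : {morph linmap_scale^~ f : a b / a + b}.
Proof. by move=> a b; apply: linmapP => x /=; rewrite scalerDl. Qed.

HB.instance Definition _ := GRing.Zmodule_isLmodule.Build k linmap
  linmap_scaleA linmap_scale1 linmap_scaleDr linmap_scaleDl.

Lemma lapp_lin x : islin (fun f : linmap => f x).
Proof. by []. Qed.

Lemma lappD (f g : linmap) x : (f + g) x = f x + g x.
Proof. by []. Qed.

(** Defined for every function, so that a family of linear maps can be named before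
its linearity is proved. *)
Definition lmap (f : U -> V) : linmap :=
  if pselect (islin f) is left lf then Linmap lf else 0.

Lemma lmapE (f : U -> V) : islin f -> lmap f = f :> (U -> V).
Proof. by rewrite /lmap; case: pselect. Qed.

End LinearMaps.

(** Proves that a nested Sweedler sum is linear or bilinear in variables that each
occur once in it, using the linear and bilinear maps found in the context. *)
Ltac lin :=
  lazymatch goal with
  | |- isbil _ => first [assumption | split; intro; cbv beta; lin]
  | |- islin _ => first [assumption | exact: lin_id | lin_split]
  | |- forall _, _ => intro; cbv beta; lin
  | |- _ => assumption
  end
with lin_split :=
  match goal with
  | |- islin (fun x => _ *: _) => apply: lin_scale; lin
  | |- islin (fun x => _ + _) => apply: lin_add; lin
  | |- islin (fun x => tens (@?g x) ?c) =>
      apply: (@lin_comp _ _ _ _ (fun y => tens y c) g); [exact: lin_tensl | lin]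
  | |- islin (fun x => tens ?c (@?g x)) =>
      apply: (@lin_comp _ _ _ _ (tens c) g); [exact: lin_tensr | lin]
  | |- islin (tens _) => exact: lin_tensr
  | |- islin (fun x => tlift ?F (@?g x)) =>
      apply: (@lin_comp _ _ _ _ (tlift F) g); [apply: lin_sw; lin | lin]
  | |- islin (tlift _) => apply: lin_sw; lin
  | |- islin (fun x => tlift _ _) => apply: lin_sw_fun; intros; cbv beta; lin
  | |- islin (fun x => tmap ?f ?h (@?g x)) =>
      apply: (@lin_comp _ _ _ _ (tmap f h) g); [apply: tmap_linear; lin | lin]
  | |- islin (tmap _ _) => apply: tmap_linear; lin
  | |- islin (fun x => lapp ?f (@?g x)) =>
      apply: (@lin_comp _ _ _ _ f g); [exact: lappP | lin]
  | |- islin (lapp _) => exact: lappP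
  | |- islin (fun x => lapp (@?f x) ?c) =>
      apply: (@lin_comp _ _ _ _ (fun h => lapp h c) f); [exact: lapp_lin | lin]
  | H : islin ?f |- islin (fun x => ?f (@?g x)) =>
      apply: (@lin_comp _ _ _ _ f g); [exact: H | lin]
  | H : isbil ?f |- islin (fun x => ?f (@?g x) ?c) =>
      apply: (@lin_comp _ _ _ _ (fun y => f y c) g); [exact: H.1 | lin]
  | H : isbil ?f |- islin (fun x => ?f ?c (@?g x)) =>
      apply: (@lin_comp _ _ _ _ (f c) g); [exact: H.2 | lin]
  | H : isbil ?f |- islin (?f ?c) => exact: H.2
  | H : forall _, islin _ |- _ => solve [apply: H]
  | H : forall _ _, islin _ |- _ => solve [apply: H]
  end.

Lemma tmap_tens (k : fieldType) (V V' W W' : lmodType k)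
    (f : V -> V') (g : W -> W') x y :
  islin f -> islin g -> tmap f g (tens x y) = tens (f x) (g y).
Proof. by move=> lf lg; rewrite /tmap sw_tens //; lin. Qed.

Definition istri (k : fieldType) (U V W M : lmodType k) (F : U -> V -> W -> M) :=
  [/\ forall y z, islin (fun x => F x y z), forall x z, islin (fun y => F x y z)
    & forall x y, islin (fun z => F x y z)].

Lemma sw_sw (k : fieldType) (X Y U V M : lmodType k) (F : U -> V -> M)
    (G : X -> Y -> tensor U V) t : isbil F ->
  tlift F (tlift G t) = sw (x, y) <- t; tlift F (G x y).
Proof. by move=> bF; rewrite tlift_comp //; apply: lin_sw. Qed.

(** This turns an equality of tensors into a rule that applies under any further
bilinear map. *)
Lemma sw_nested (k : fieldType) (X Y X' Y' U V M : lmodType k)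
    (F : U -> V -> M) (s : tensor X Y) (s' : X -> Y -> tensor X' Y')
    (u : X -> Y -> X' -> Y' -> U) (v : X -> Y -> X' -> Y' -> V) : isbil F ->
  tlift F (sw (x, y) <- s; sw (x', y') <- s' x y; tens (u x y x' y') (v x y x' y')) =
  sw (x, y) <- s; sw (x', y') <- s' x y; F (u x y x' y') (v x y x' y').
Proof.
move=> bF; rewrite sw_sw; last by lin.
apply: tlift_ext => x y; rewrite sw_sw; last by lin.
by apply: tlift_ext => x' y'; rewrite sw_tens.
Qed.

Definition tri_lift (k : fieldType) (U V W M : lmodType k) (F : U -> V -> W -> M)
  (t : tensor U (tensor V W)) : M := sw (x, t) <- t; sw (y, z) <- t; F x y z.

Lemma sw_tens3 (k : fieldType) (U1 U2 U3 M : lmodType k)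
    (F : U1 -> U2 -> U3 -> M) x y z : istri F ->
  (sw (x, t) <- tens x (tens y z); sw (y, z) <- t; F x y z) = F x y z.
Proof.
move=> [F1 F2 F3]; rewrite !sw_tens //; lin.
Qed.

Lemma sw_nested3 (k : fieldType) (X1 Y1 X2 Y2 X3 Y3 U V W M : lmodType k)
    (F : U -> V -> W -> M) (s1 : tensor X1 Y1) (s2 : X1 -> Y1 -> tensor X2 Y2)
    (s3 : X1 -> Y1 -> X2 -> Y2 -> tensor X3 Y3) u v w : istri F ->
  tri_lift F (sw (x1, y1) <- s1; sw (x2, y2) <- s2 x1 y1;
    sw (x3, y3) <- s3 x1 y1 x2 y2; tens (u x1 y1 x2 y2 x3 y3)
      (tens (v x1 y1 x2 y2 x3 y3) (w x1 y1 x2 y2 x3 y3))) =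
  sw (x1, y1) <- s1; sw (x2, y2) <- s2 x1 y1; sw (x3, y3) <- s3 x1 y1 x2 y2;
    F (u x1 y1 x2 y2 x3 y3) (v x1 y1 x2 y2 x3 y3) (w x1 y1 x2 y2 x3 y3).
Proof.
move=> tF; have [F1 F2 F3] := tF.
have L : islin (tri_lift F) by rewrite /tri_lift; lin.
rewrite tlift_comp //; apply: tlift_ext => x1 y1.
rewrite tlift_comp //; apply: tlift_ext => x2 y2.
by rewrite tlift_comp //; apply: tlift_ext => x3 y3; rewrite /tri_lift sw_tens3.
Qed.

Ltac tri := split; intros; cbv beta; lin.

(** * Trees as expressions in a tridendriform algebra *)

Variant operation : Type := Prec | Succ | Dot.

(** Expressions in the three operations.  They have two branches at each node and
so give simpler inductions than trees; every nontrivial tree is read as one by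
[tree_term]. *)
Inductive term (D : Type) : Type :=
| Gen of D
| App of operation & term D & term D.

Section Terms.
Variables (D : Type) (d : D).

Fixpoint letters (e : term D) : seq D :=
  match e with
  | Gen a => [:: a]
  | App _ e1 e2 => letters e1 ++ letters e2
  end.

Fixpoint relabel (e : term D) (s : seq D) : term D :=
  match e with
  | Gen _ => Gen (head d s)
  | App o e1 e2 => App o (relabel e1 s) (relabel e2 (drop (size (letters e1)) s))
  end.

(** The expression T0 succ ((a1 prec T1) . ... (ak prec Tk)).  The value on the
trivial tree is a dummy. *)
Fixpoint tree_term (T : tree D) : term D :=
  match T with
  | Leaf => Gen d
  | Vee t0 mid a t =>
      let body := foldr (fun p e =>
          App Dot (if p.2 is Leaf then Gen p.1
                   else App Prec (Gen p.1) (tree_term p.2)) e)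
        (if t is Leaf then Gen a else App Prec (Gen a) (tree_term t)) mid in
      if t0 is Leaf then body else App Succ (tree_term t0) body
  end.

Definition graft_right (a : D) (t : tree D) : term D :=
  if is_leaf t then Gen a else App Prec (Gen a) (tree_term t).

Definition graft_left (t : tree D) (e : term D) : term D :=
  if is_leaf t then e else App Succ (tree_term t) e.

Definition term_join (mid : seq (D * tree D)) (e : term D) : term D :=
  foldr (fun p e => App Dot (graft_right p.1 p.2) e) e mid.

Lemma tree_term_Vee t0 mid a t :
  tree_term (Vee t0 mid a t) =
  graft_left t0 (term_join mid (graft_right a t)).
Proof.
rewrite /= /graft_left /term_join /graft_right.
suff -> : foldr (fun p e => App Dot (if p.2 is Leaf then Gen p.1
                   else App Prec (Gen p.1) (tree_term p.2)) e)
        (if t is Leaf then Gen a else App Prec (Gen a) (tree_term t)) mid =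
  foldr (fun p e => App Dot (if is_leaf p.2 then Gen p.1
                   else App Prec (Gen p.1) (tree_term p.2)) e)
        (if is_leaf t then Gen a else App Prec (Gen a) (tree_term t)) mid.
  by case: t0.
elim: mid => [|[b u] mid IH]; first by case: t.
by rewrite [LHS]/= [RHS]/= IH; case: u.
Qed.

Lemma letters_tree_term T : ~~ is_leaf T -> letters (tree_term T) = angles T.
Proof.
elim/tree_nested_ind: T => // t0 mid a t IH0 IHm IHt _.
rewrite tree_term_Vee.
have R b u : (~~ is_leaf u -> letters (tree_term u) = angles u) ->
    letters (graft_right b u) = b :: angles u.
  by rewrite /graft_right; case: (u) => //= u0 m c v ->.
have -> : letters (graft_left t0 (term_join mid (graft_right a t))) =
    angles t0 ++ letters (term_join mid (graft_right a t)).
  by rewrite /graft_left; case: t0 IH0 => [|u0 m c v] //= ->.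
rewrite [RHS]/=; congr (_ ++ _).
elim: mid IHm => [|[b u] mid IH] /=; first by rewrite R.
by case=> hu /IH hm; rewrite R //= hm catA.
Qed.

Lemma size_letters_relabel e s : size (letters (relabel e s)) = size (letters e).
Proof. by elim: e s => //= o e1 IH1 e2 IH2 s; rewrite !size_cat IH1 IH2. Qed.

Lemma relabel_relabel e s s' : relabel (relabel e s) s' = relabel e s'.
Proof.
by elim: e s s' => //= o e1 IH1 e2 IH2 s s'; rewrite IH1 IH2 size_letters_relabel.
Qed.

Lemma is_leaf_decorate E (T : tree E) s : is_leaf (decorate d T s) = is_leaf T.
Proof. by case: T. Qed.

End Terms.

Section TermRelabel.
Variables (D : Type) (d : D).

Lemma relabel_cat (e : term D) s r : (size (letters e) <= size s)%N ->
  relabel d e (s ++ r) = relabel d e s.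
Proof.
elim: e s => [a|o e1 IH1 e2 IH2] /= s; first by case: s.
rewrite size_cat => sz; rewrite IH1; last by lia.
rewrite drop_cat; case: ltnP => sz1; first by rewrite IH2 // size_drop; lia.
rewrite (drop_oversize sz1) (_ : (_ - _)%N = 0) ?drop0; last by lia.
by rewrite -[in LHS](cat0s r) IH2 //=; lia.
Qed.

Lemma letters_relabel (e : term D) s : size s = size (letters e) ->
  letters (relabel d e s) = s.
Proof.
move=> sz; suff -> : letters (relabel d e s) = take (size (letters e)) s.
  by rewrite -sz take_size.
have {sz} : (size (letters e) <= size s)%N by rewrite sz.
elim: e s => [a|o e1 IH1 e2 IH2] /= s; first by case: s => //= x s; rewrite take0.
rewrite size_cat => sz; rewrite IH1 ?IH2 ?size_drop ?takeD //; lia.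
Qed.

End TermRelabel.

Lemma tree_term_decorate (D : Type) (d : D) (T : tree D) (s : seq D) :
  ~~ is_leaf T -> tree_term d (decorate d T s) = relabel d (tree_term d T) s.
Proof.
elim/tree_nested_ind: T s => // t0 mid a t IH0 IHm IHt s _.
rewrite [decorate d _ s]/= !tree_term_Vee.
have szR (b : D) u : size (letters (graft_right d b u)) = (size (angles u)).+1.
  rewrite /graft_right; case: ifP => [|/negbT nu] /=; first by case: u.
  by rewrite letters_tree_term.
have R b u v : (forall v, ~~ is_leaf u ->
      tree_term d (decorate d u v) = relabel d (tree_term d u) v) ->
    graft_right d (head d v) (decorate d u (behead v)) =
    relabel d (graft_right d b u) v.
  rewrite /graft_right is_leaf_decorate; case: ifP => //= /negbT nu IH.
  by rewrite IH // drop1.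
have -> : graft_left d t0 (term_join d mid (graft_right d a t)) =
   if is_leaf t0 then term_join d mid (graft_right d a t)
   else App Succ (tree_term d t0) (term_join d mid (graft_right d a t)) by [].
rewrite /graft_left is_leaf_decorate.
set r := drop _ s.
suff E : term_join d (decorate_mid d (decorate d) mid r).1
    (graft_right d (head d (decorate_mid d (decorate d) mid r).2)
      (decorate d t (behead (decorate_mid d (decorate d) mid r).2))) =
    relabel d (term_join d mid (graft_right d a t)) r.
  rewrite E; case: ifP => [t0leaf|/negbT nt0] /=.
    by congr relabel; rewrite /r; case: (t0) t0leaf => //=; rewrite drop0.
  by rewrite IH0 // letters_tree_term.
elim: mid IHm r => [|[b u] mid IH] /=; first by move=> _ r; apply: R.
case=> hu hm r; rewrite IH // (R b) //; congr (App _ _ (relabel _ _ _)).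
by rewrite szR -drop1 drop_drop addn1.
Qed.

Section Evaluation.
Variables (k : fieldType) (A R : lmodType k).
Variables (precR succR dotR : R -> R -> R).

Definition operate (o : operation) : R -> R -> R :=
  match o with Prec => precR | Succ => succR | Dot => dotR end.

Fixpoint eval (psi : A -> R) (e : term A) : R :=
  match e with
  | Gen a => psi a
  | App o e1 e2 => operate o (eval psi e1) (eval psi e2)
  end.

Definition tree_eval (psi : A -> R) (T : tree A) : R :=
  eval psi (tree_term 0 T).

End Evaluation.

Lemma tree_star_node (A : Type) (mul : A -> A -> A) T T' :
  ~~ is_leaf T -> ~~ is_leaf T' ->
  tree_star mul T T' =
  tree_prec mul T T' ++ tree_succ mul T T' ++ tree_dot mul T T'.
Proof. by move=> /negbTE nT /negbTE nT'; rewrite tree_starE nT nT'. Qed.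

Lemma eq_big_all (M : nmodType) I (P : pred I) (s : seq I) (F G : I -> M) :
  all P s -> (forall i, P i -> F i = G i) ->
  \sum_(i <- s) F i = \sum_(i <- s) G i.
Proof.
move=> + FG; elim: s => [|i s IH] /=; first by rewrite !big_nil.
by case/andP=> Pi /IH h; rewrite !big_cons h FG.
Qed.

Lemma tree_star_not_leaf (A : Type) (mul : A -> A -> A) T T' :
  ~~ is_leaf T || ~~ is_leaf T' ->
  all (fun U => ~~ is_leaf U) (tree_star mul T T').
Proof.
case: T T' => [|t0 mid a t] [|t0' mid' a' t'] //= _.
have all_mapT (I J : Type) (f : I -> J) (p : pred J) s :
    (forall i, p (f i)) -> all p [seq f i | i <- s].
  by move=> pf; elim: s => //= i s ->; rewrite pf.
rewrite !all_cat !all_mapT //=.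
case: ifP => _; last exact: all_mapT.
by case: mid' => [|[]].
Qed.

Section TreeEvalHom.
Variables (k : fieldType) (A R : lmodType k).
Variables (precR succR dotR : R -> R -> R) (mul : A -> A -> A) (psi : A -> R).
Hypothesis tdR : tridendriform precR succR dotR.
Hypothesis psiM : forall a b, psi (mul a b) = dotR (psi a) (psi b).

Local Notation ev := (tree_eval precR succR dotR psi).
Local Notation star x y := (precR x y + succR x y + dotR x y).

Let bp : isbil precR. Proof. by apply/isbilP; case: tdR. Qed.
Let bs : isbil succR. Proof. by apply/isbilP; case: tdR. Qed.
Let bd : isbil dotR. Proof. by apply/isbilP; case: tdR. Qed.

Definition act_right (x : R) (t : tree A) : R :=
  if is_leaf t then x else precR x (ev t).
Definition act_left (t : tree A) (x : R) : R :=
  if is_leaf t then x else succR (ev t) x.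
Definition dot_join (mid : seq (A * tree A)) (x : R) : R :=
  foldr (fun p y => dotR (act_right (psi p.1) p.2) y) x mid.

Lemma tree_eval_Vee t0 mid a t :
  ev (Vee t0 mid a t) = act_left t0 (dot_join mid (act_right (psi a) t)).
Proof.
rewrite /tree_eval tree_term_Vee /graft_left /act_left.
suff E : eval precR succR dotR psi (term_join 0 mid (graft_right 0 a t)) =
    dot_join mid (act_right (psi a) t) by case: ifP => //= _; rewrite E.
elim: mid => [|p mid /= ->]; first by rewrite /= /graft_right /act_right; case: ifP.
by congr dotR; rewrite /graft_right /act_right; case: ifP.
Qed.

Lemma act_left_lin t : islin (act_left t).
Proof. by rewrite /act_left; case: (is_leaf t); lin. Qed.

Lemma dot_join_lin mid : islin (dot_join mid).
Proof.
elim: mid => [|p mid IH] /=; first exact: lin_id.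
by have := lin_comp (bd.2 (act_right (psi p.1) p.2)) IH.
Qed.

(** The branches and angles to the left of the last angle of a root act by linear
operators that commute with right multiplications by prec and dot.  So T prec T'
and T . T' are computed at the last angle and the last branch of T. *)
Lemma dot_join_prec mid x y : dot_join mid (precR x y) = precR (dot_join mid x) y.
Proof. by elim: mid => //= p mid ->; rewrite (td_dot_prec tdR). Qed.

Lemma dot_join_dot mid x y : dot_join mid (dotR x y) = dotR (dot_join mid x) y.
Proof. by elim: mid => //= p mid ->; rewrite (td_dot_dot tdR). Qed.

Lemma act_left_prec t x y : act_left t (precR x y) = precR (act_left t x) y.
Proof. by rewrite /act_left; case: ifP => // _; rewrite (td_succ_prec tdR). Qed.

Lemma act_left_dot t x y : act_left t (dotR x y) = dotR (act_left t x) y.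
Proof. by rewrite /act_left; case: ifP => // _; rewrite (td_succ_dot tdR). Qed.

Lemma dot_act_right x y t : dotR x (act_right y t) = act_right (dotR x y) t.
Proof. by rewrite /act_right; case: ifP => // _; rewrite (td_dot_prec tdR). Qed.

Let eval_star T T' := ~~ is_leaf T -> ~~ is_leaf T' ->
  \sum_(U <- tree_star mul T T') ev U = star (ev T) (ev T').

(** The axiom (x prec y) prec z = x prec (y * z), extended to a trivial second
argument. *)
Lemma act_right_star x t T' : eval_star t T' -> ~~ is_leaf T' ->
  \sum_(U <- tree_star mul t T') act_right x U = precR (act_right x t) (ev T').
Proof.
move=> E nT'; rewrite {2}/act_right; case: ifP => [|/negbT nt].
  by case: t {E} => // _; rewrite big_seq1 /act_right (negbTE nT').
rewrite (eq_big_all (G := fun U => precR x (ev U)) (@tree_star_not_leaf _ mul t T' _)).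
- by rewrite -(islin_sum _ _ (bp.2 x)) E // (td_prec_prec tdR).
- by rewrite nt.
- by move=> U /negbTE nU; rewrite /act_right nU.
Qed.

(** The axiom x succ (y succ z) = (x * y) succ z, extended to a trivial second
argument. *)
Lemma act_left_star x T t : eval_star T t -> ~~ is_leaf T ->
  \sum_(U <- tree_star mul T t) act_left U x = succR (ev T) (act_left t x).
Proof.
move=> E nT; rewrite {2}/act_left; case: ifP => [|/negbT nt].
  by case: t {E} => // _; rewrite tree_starE (negbTE nT) big_seq1 /act_left (negbTE nT).
rewrite (eq_big_all (G := fun U => succR (ev U) x) (@tree_star_not_leaf _ mul T t _)).
- by rewrite -(islin_sum _ _ (bs.1 x)) E // (td_succ_succ tdR).
- by rewrite nT.
- by move=> U /negbTE nU; rewrite /act_left nU.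
Qed.

(** The axiom (x prec y) . z = x . (y succ z), extended to trivial trees.  When
both are trivial the product of trees merges the angles instead, so that case is
excluded. *)
Lemma act_mid_star x y t t' : eval_star t t' -> ~~ (is_leaf t && is_leaf t') ->
  \sum_(U <- tree_star mul t t') dotR (act_right x U) y =
  dotR (act_right x t) (act_left t' y).
Proof.
move=> E; case lt': (is_leaf t').
  rewrite andbT => /negbTE nt; case: t' lt' {E} => // _.
  by rewrite tree_starE nt big_seq1.
move/negbT: lt' => nt' _.
by rewrite -(islin_sum _ _ (bd.1 y)) act_right_star // (td_prec_dot tdR)
  /act_left (negbTE nt').
Qed.

Let eval_dot_step t0 mid a t t0' mid' a' t' : eval_star t t0' ->
  \sum_(U <- tree_dot mul (Vee t0 mid a t) (Vee t0' mid' a' t')) ev U =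
  dotR (ev (Vee t0 mid a t)) (ev (Vee t0' mid' a' t')).
Proof.
move=> E; rewrite !tree_eval_Vee /= -act_left_dot -dot_join_dot.
case: ifP => [/andP[lt lt']|/negbT nl].
  rewrite big_seq1 /act_right lt /act_left lt'.
  case: mid' => [|[b u] m] /=; rewrite tree_eval_Vee.
    by rewrite psiM -dot_act_right.
  rewrite /dot_join foldr_cat /= psiM -dot_act_right.
  by rewrite (td_dot_dot tdR).
rewrite big_map -act_mid_star // (islin_sum _ _ (dot_join_lin mid)).
rewrite (islin_sum _ _ (act_left_lin t0)); apply: eq_bigr => U _.
by rewrite /vee_join tree_eval_Vee /dot_join foldr_cat.
Qed.

Let eval_prec_step t0 mid a t T' : eval_star t T' -> ~~ is_leaf T' ->
  \sum_(U <- tree_prec mul (Vee t0 mid a t) T') ev U =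
  precR (ev (Vee t0 mid a t)) (ev T').
Proof.
move=> E nT'; rewrite tree_eval_Vee -act_left_prec -dot_join_prec.
rewrite -act_right_star // (islin_sum _ _ (dot_join_lin mid)).
rewrite (islin_sum _ _ (act_left_lin t0)) /= big_map; apply: eq_bigr => U _.
by rewrite tree_eval_Vee.
Qed.

Let eval_succ_step T t0 mid a t : eval_star T t0 -> ~~ is_leaf T ->
  \sum_(U <- tree_succ mul T (Vee t0 mid a t)) ev U =
  succR (ev T) (ev (Vee t0 mid a t)).
Proof.
move=> E nT; rewrite tree_eval_Vee -act_left_star // /= big_map.
by apply: eq_bigr => U _; rewrite tree_eval_Vee.
Qed.

(** Structural induction on both trees: the last branch of T is multiplied by T' or
by the first branch of T', and T by the first branch of T'. *)
Lemma tree_eval_star T T' : eval_star T T'.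
Proof.
elim/tree_nested_ind: T T' => [//|t0 mid a t _ _ IHt] T'.
elim/tree_nested_ind: T' => [//|t0' mid' a' t' IH0' _ _] nT nT'.
rewrite tree_star_node // !big_cat -addrA eval_prec_step //.
by rewrite eval_succ_step // eval_dot_step.
Qed.

Lemma tree_eval_prec T T' : ~~ is_leaf T -> ~~ is_leaf T' ->
  \sum_(U <- tree_prec mul T T') ev U = precR (ev T) (ev T').
Proof.
case: T => // t0 mid a t _; apply: eval_prec_step; exact: tree_eval_star.
Qed.

Lemma tree_eval_succ T T' : ~~ is_leaf T -> ~~ is_leaf T' ->
  \sum_(U <- tree_succ mul T T') ev U = succR (ev T) (ev T').
Proof.
by case: T' => // t0 mid a t nT _; apply: eval_succ_step => //; apply: tree_eval_star.
Qed.

Lemma tree_eval_dot T T' : ~~ is_leaf T -> ~~ is_leaf T' ->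
  \sum_(U <- tree_dot mul T T') ev U = dotR (ev T) (ev T').
Proof.
case: T T' => // t0 mid a t [//|t0' mid' a' t'] _ _.
by apply: eval_dot_step; apply: tree_eval_star.
Qed.

End TreeEvalHom.

(** * The tridendriform identities for sums of trees *)

Section TreeIdentities.
Variables (A : Type) (mul : A -> A -> A).

Local Notation star := (tree_star mul).
Local Notation prec := (tree_prec mul).
Local Notation succ := (tree_succ mul).
Local Notation dot := (tree_dot mul).

(** The trees that span the algebra: dense and nontrivial. *)
Definition dense_node (T : tree A) : bool := dense T && ~~ is_leaf T.

Lemma all_map_of (I J : Type) (f : I -> J) (p : pred I) (q : pred J) s :
  (forall i, p i -> q (f i)) -> all p s -> all q [seq f i | i <- s].
Proof.
by move=> pq; elim: s => //= i s IH /andP[/pq -> /IH ->].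
Qed.

Lemma vee_merge_dense t0 mid a mid' a' t t0' t' :
  dense (Vee t0 mid a t) -> dense (Vee t0' mid' a' t') ->
  dense (vee_merge mul t0 mid a mid' a' t').
Proof.
move=> /= /and3P[d0 dm _] /and3P[_ dm' d'].
by case: mid' dm' => [|[b u] m] /= dm'; rewrite d0 ?all_cat dm //= dm' d'.
Qed.

Lemma tree_star_dense T T' : dense T -> dense T' -> all (@dense A) (star T T').
Proof.
elim/tree_nested_ind: T T' => [|t0 mid a t _ _ IH] T'; first by move=> /= _ ->.
elim/tree_nested_ind: T' => [|t0' mid' a' t' IH' _ _] dT dT'.
  by rewrite tree_starE /= [X in X && _]dT.
rewrite tree_star_node // !all_cat /=.
move: (dT) (dT') => /= /and3P[d0 dm d] /and3P[d0' dm' d'].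
apply/and3P; split.
- by apply: all_map_of (IH _ d dT') => U dU /=; rewrite d0 dm.
- by apply: all_map_of (IH' dT d0') => U dU /=; rewrite dU dm'.
- case: ifP => [_|/negbT nl]; first by rewrite /= (vee_merge_dense dT dT').
  apply: (@all_map_of _ _ _ (fun U => dense U && ~~ is_leaf U)).
    by move=> U /andP[dU nU] /=; rewrite d0 all_cat dm /= nU dU dm'.
  rewrite negb_and in nl; have := tree_star_not_leaf mul nl.
  by elim: (star t t0') (IH _ d d0') => //= U s IHs /andP[-> /IHs h] /andP[-> /h ->].
Qed.

Definition closed_op (op : tree A -> tree A -> seq (tree A)) :=
  forall T T', dense_node T -> dense_node T' -> all dense_node (op T T').

Lemma star_closed : closed_op star.
Proof.
move=> T T' /andP[dT nT] /andP[dT' nT']; have := tree_star_not_leaf mul (T := T) (T' := T').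
rewrite nT => /(_ isT); elim: (star T T') (tree_star_dense dT dT') => //= U s IH.
by move=> /andP[dU /IH h] /andP[nU /h ->]; rewrite /dense_node dU nU.
Qed.

Lemma ops_closed : [/\ closed_op prec, closed_op succ & closed_op dot].
Proof.
by split=> T T' gT gT'; have := star_closed gT gT'; move: gT gT' => /andP[_ nT]
  /andP[_ nT']; rewrite tree_star_node // !all_cat => /and3P[].
Qed.

Hypothesis mulA : associative mul.
Variable M : nmodType.
Implicit Type F : tree A -> M.

(** The products are lists of trees.  Their identities hold up to reordering only,
so they are stated after summing an arbitrary function over the lists. *)
Let assoc x y z := forall F,
  \sum_(U <- star x y) \sum_(V <- star U z) F V =
  \sum_(U <- star y z) \sum_(V <- star x U) F V.

(** In the next seven lemmas, either the two products act on different ends of the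
tree in the middle and the sums are exchanged, or both sides meet in one branch,
where the associativity of * on smaller trees is used. *)
Lemma tree_prec_prec F x0 xm a x y z : assoc x y z ->
  \sum_(U <- prec (Vee x0 xm a x) y) \sum_(V <- prec U z) F V =
  \sum_(U <- star y z) \sum_(V <- prec (Vee x0 xm a x) U) F V.
Proof.
move=> E; rewrite /= big_map; under eq_bigr do rewrite /= big_map.
under [RHS]eq_bigr do rewrite big_map.
exact: (E (fun U => F (Vee x0 xm a U))).
Qed.

Lemma tree_succ_prec F x y z : ~~ is_leaf y ->
  \sum_(U <- succ x y) \sum_(V <- prec U z) F V =
  \sum_(U <- prec y z) \sum_(V <- succ x U) F V.
Proof.
case: y => // y0 ym b y _.
rewrite /= !big_map; under eq_bigr do rewrite /= big_map.
under [RHS]eq_bigr do rewrite /= big_map.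
exact: exchange_big.
Qed.

Lemma tree_succ_succ F x y z0 zm c z : assoc x y z0 ->
  \sum_(U <- star x y) \sum_(V <- succ U (Vee z0 zm c z)) F V =
  \sum_(U <- succ y (Vee z0 zm c z)) \sum_(V <- succ x U) F V.
Proof.
move=> E; rewrite /= big_map; under eq_bigr do rewrite /= big_map.
under [RHS]eq_bigr do rewrite /= big_map.
exact: (E (fun U => F (Vee U zm c z))).
Qed.

Lemma tree_dot_prec F x y z : ~~ is_leaf x -> ~~ is_leaf y ->
  \sum_(U <- dot x y) \sum_(V <- prec U z) F V =
  \sum_(U <- prec y z) \sum_(V <- dot x U) F V.
Proof.
case: x y => // x0 xm a x [//|y0 ym b y] _ _ /=; rewrite big_map.
case: ifP => _.
  rewrite big_seq1; under [RHS]eq_bigr do rewrite big_seq1.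
  by case: ym => [|[e u] ym] /=; rewrite big_map.
rewrite !big_map; under eq_bigr do rewrite /= big_map.
under [RHS]eq_bigr do rewrite big_map.
exact: exchange_big.
Qed.

Lemma tree_prec_dot F x0 xm a x y z0 zm c z : ~~ is_leaf y -> assoc x y z0 ->
  \sum_(U <- prec (Vee x0 xm a x) y) \sum_(V <- dot U (Vee z0 zm c z)) F V =
  \sum_(U <- succ y (Vee z0 zm c z)) \sum_(V <- dot (Vee x0 xm a x) U) F V.
Proof.
move=> ny E; rewrite /= !big_map.
rewrite (eq_big_all (G := fun U => \sum_(V <- star U z0) F (vee_join x0 xm a V zm c z))
  (@tree_star_not_leaf _ mul x y _)); first last.
- by move=> U /negbTE nU /=; rewrite nU /= big_map.
- by rewrite ny orbT.
rewrite [RHS](eq_big_all (G := fun U => \sum_(V <- star x U) F (vee_join x0 xm a V zm c z))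
  (@tree_star_not_leaf _ mul y z0 _)); first last.
- by move=> U /negbTE nU /=; rewrite nU andbF /= big_map.
- by rewrite ny.
exact: (E (fun U => F (vee_join x0 xm a U zm c z))).
Qed.

Lemma tree_succ_dot F x y z : ~~ is_leaf y -> ~~ is_leaf z ->
  \sum_(U <- succ x y) \sum_(V <- dot U z) F V =
  \sum_(U <- dot y z) \sum_(V <- succ x U) F V.
Proof.
case: y z => // y0 ym b y [//|z0 zm c z] _ _ /=; rewrite big_map /=.
case: ifP => _.
  rewrite big_seq1; under eq_bigr do rewrite big_seq1.
  by case: zm => [|[e u] zm] /=; rewrite big_map.
rewrite !big_map; under eq_bigr do rewrite /= big_map.
under [RHS]eq_bigr do rewrite /= big_map.
exact: exchange_big.
Qed.

(** Whether the two angles on either side of y are merged or joined by a branch is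
decided independently; if y has a single angle and both merge, the associativity
of the product of A is what makes the two orders agree. *)
Lemma tree_dot_dot F x y z : ~~ is_leaf x -> ~~ is_leaf y -> ~~ is_leaf z ->
  \sum_(U <- dot x y) \sum_(V <- dot U z) F V =
  \sum_(U <- dot y z) \sum_(V <- dot x U) F V.
Proof.
case: x y z => // x0 xm a x [//|y0 ym b y] [//|z0 zm c z] _ _ _ /=.
case E1: (is_leaf x && is_leaf y0); case E2: (is_leaf y && is_leaf z0);
  rewrite ?big_seq1 ?big_map /=.
- by case: ym zm => [|[e u] ym] [|[e' u'] zm] /=;
    rewrite ?E1 ?E2 /= ?E1 ?E2 !big_seq1 /= -?catA /= ?mulA.
- by case: ym => [|[e u] ym] /=; rewrite E1 E2 big_map; apply: eq_bigr => U _;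
    rewrite big_seq1 /vee_join -?catA.
- by case: zm => [|[e u] zm] /=; rewrite E1 E2 big_map; apply: eq_bigr => U _;
    rewrite big_seq1 /vee_join -?catA.
- under eq_bigr do rewrite /= E2 big_map.
  under [RHS]eq_bigr do rewrite /= E1 big_map.
  rewrite exchange_big; apply: eq_bigr => U _; apply: eq_bigr => V _.
  by rewrite /vee_join -?catA.
Qed.

Lemma sum_star F T T' : ~~ is_leaf T -> ~~ is_leaf T' ->
  \sum_(U <- star T T') F U = \sum_(U <- prec T T') F U +
    \sum_(U <- succ T T') F U + \sum_(U <- dot T T') F U.
Proof. by move=> nT nT'; rewrite tree_star_node // !big_cat /= addrA. Qed.

Lemma sum_add3 I (s : seq I) (F1 F2 F3 : I -> M) :
  \sum_(i <- s) (F1 i + F2 i + F3 i) =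
  \sum_(i <- s) F1 i + \sum_(i <- s) F2 i + \sum_(i <- s) F3 i.
Proof. by rewrite !big_split. Qed.

(** Expanding the two products of * on each side gives seven terms, which are
matched by the seven axioms; only those with associativity on smaller trees as
an assumption need the induction hypotheses. *)
Lemma tree_star_assoc x y z : assoc x y z.
Proof.
elim/tree_nested_ind: x y z => [|x0 xm a x _ _ IHx] y z F.
  by rewrite /= big_seq1; under [RHS]eq_bigr do rewrite big_seq1.
elim/tree_nested_ind: z F => [|z0 zm c z IHz _ _] F.
  have sL U : star U Leaf = [:: U] by case: U.
  by rewrite sL big_seq1; apply: eq_bigr => U _; rewrite sL big_seq1.
case: (boolP (is_leaf y)) => ny; first by case: y ny IHz => // _ _; rewrite /= !big_seq1.
rewrite (eq_big_all (G := fun U => \sum_(V <- prec U (Vee z0 zm c z)) F V +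
    \sum_(V <- succ U (Vee z0 zm c z)) F V + \sum_(V <- dot U (Vee z0 zm c z)) F V)
  (@tree_star_not_leaf _ mul _ y _)); first last.
- by move=> U nU; rewrite sum_star.
- by [].
rewrite [RHS](eq_big_all (G := fun U => \sum_(V <- prec (Vee x0 xm a x) U) F V +
    \sum_(V <- succ (Vee x0 xm a x) U) F V + \sum_(V <- dot (Vee x0 xm a x) U) F V)
  (@tree_star_not_leaf _ mul y _ _)); first last.
- by move=> U nU; rewrite sum_star.
- by rewrite ny.
rewrite !sum_add3.
rewrite -tree_prec_prec; last exact: IHx.
rewrite tree_succ_succ; last exact: IHz.
rewrite !sum_star //.
rewrite tree_succ_prec // tree_dot_prec // tree_prec_dot //.
rewrite tree_succ_dot // tree_dot_dot //.
by rewrite (AC (3*1*3) (1*(2*4*6)*(3*5*7))).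
Qed.
End TreeIdentities.

(** * Multilinearity in the decorations *)

Section TreeLinearity.
Variables (k : fieldType) (A : lmodType k).

(** [tree_lin a T1 T2 T3]: the three trees differ in one decoration only, which in
T3 is a *: x + y for the decorations x of T1 and y of T2.  Multilinearity in the
decorations is linearity along these triples; unlike the formulation with a
shape and a word of decorations it follows the recursive structure of trees. *)
Inductive tree_lin (a : k) : tree A -> tree A -> tree A -> Prop :=
| TreeLinFirst t0 t0' t0'' mid b t :
    tree_lin a t0 t0' t0'' ->
    tree_lin a (Vee t0 mid b t) (Vee t0' mid b t) (Vee t0'' mid b t)
| TreeLinMidAngle t0 m1 x y u m2 b t :
    tree_lin a (Vee t0 (m1 ++ (x, u) :: m2) b t) (Vee t0 (m1 ++ (y, u) :: m2) b t)
      (Vee t0 (m1 ++ (a *: x + y, u) :: m2) b t)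
| TreeLinMidBranch t0 m1 x u u' u'' m2 b t :
    tree_lin a u u' u'' ->
    tree_lin a (Vee t0 (m1 ++ (x, u) :: m2) b t) (Vee t0 (m1 ++ (x, u') :: m2) b t)
      (Vee t0 (m1 ++ (x, u'') :: m2) b t)
| TreeLinLastAngle t0 mid x y t :
    tree_lin a (Vee t0 mid x t) (Vee t0 mid y t) (Vee t0 mid (a *: x + y) t)
| TreeLinLast t0 mid b t t' t'' :
    tree_lin a t t' t'' ->
    tree_lin a (Vee t0 mid b t) (Vee t0 mid b t') (Vee t0 mid b t'').

Definition tree_linear (M : lmodType k) (G : tree A -> M) : Prop :=
  forall a T1 T2 T3, tree_lin a T1 T2 T3 -> G T3 = a *: G T1 + G T2.

Lemma tree_lin_not_leaf a T1 T2 T3 : tree_lin a T1 T2 T3 ->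
  [/\ is_leaf T1 = false, is_leaf T2 = false & is_leaf T3 = false].
Proof. by case. Qed.

Lemma sum_lin (M : lmodType k) I (s : seq I) (F1 F2 F3 : I -> M) a :
  (forall i, F3 i = a *: F1 i + F2 i) ->
  \sum_(i <- s) F3 i = a *: (\sum_(i <- s) F1 i) + \sum_(i <- s) F2 i.
Proof.
by move=> E; rewrite scaler_sumr -big_split /=; apply: eq_bigr => i _; rewrite E.
Qed.

Variable mul : A -> A -> A.
Hypothesis bmul : isbil mul.

Definition last_branch (T : tree A) : tree A :=
  if T is Vee _ _ _ t then t else Leaf.
Definition first_branch (T : tree A) : tree A :=
  if T is Vee t _ _ _ then t else Leaf.

(** Multilinearity of a list-valued product, tested against all functions that are
themselves multilinear. *)
Section Op.
Variable op : tree A -> tree A -> seq (tree A).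
Definition lin_in_left a T1 T2 T3 T' := tree_lin a T1 T2 T3 ->
  forall (M : lmodType k) (G : tree A -> M), tree_linear G ->
  \sum_(U <- op T3 T') G U =
  a *: (\sum_(U <- op T1 T') G U) + \sum_(U <- op T2 T') G U.
Definition lin_in_right a T T1 T2 T3 := tree_lin a T1 T2 T3 ->
  forall (M : lmodType k) (G : tree A -> M), tree_linear G ->
  \sum_(U <- op T T3) G U =
  a *: (\sum_(U <- op T T1) G U) + \sum_(U <- op T T2) G U.
End Op.

Local Ltac one_place hG := rewrite ?big_map; apply: sum_lin => U /=;
  apply: hG; rewrite /vee_join -?catA /=; by constructor.

Local Ltac branch S hG := rewrite !big_map; apply: S => // c U1 U2 U3 hU;
  apply: hG; by constructor.

(** Each product is reduced to the total product * of branches, where the induction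
of [star_left] and [star_right] applies; a place that is not in such a branch is
untouched by the product. *)
Lemma prec_left_step a T1 T2 T3 T' :
  lin_in_left (tree_star mul) a (last_branch T1) (last_branch T2)
    (last_branch T3) T' ->
  lin_in_left (tree_prec mul) a T1 T2 T3 T'.
Proof.
move=> + h; case: T1 T2 T3 / h.
- by move=> t0 t0' t0'' mid b t h _ M G hG /=; one_place hG.
- by move=> t0 m1 x y u m2 b t _ M G hG /=; one_place hG.
- by move=> t0 m1 x u u' u'' m2 b t h _ M G hG /=; one_place hG.
- by move=> t0 mid x y t _ M G hG /=; one_place hG.
- by move=> t0 mid b t t' t'' h S M G hG /=; branch S hG.
Qed.

Lemma prec_right_step a T T1 T2 T3 :
  lin_in_right (tree_star mul) a (last_branch T) T1 T2 T3 ->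
  lin_in_right (tree_prec mul) a T T1 T2 T3.
Proof.
move=> + h; case: T => [|t0 mid b t] /= S M G hG.
  by rewrite !big_nil scaler0 addr0.
by branch S hG.
Qed.

Lemma succ_left_step a T1 T2 T3 T' :
  lin_in_left (tree_star mul) a T1 T2 T3 (first_branch T') ->
  lin_in_left (tree_succ mul) a T1 T2 T3 T'.
Proof.
move=> + h; case: T' => [|t0 mid b t] /= S M G hG.
  by rewrite !big_nil scaler0 addr0.
by branch S hG.
Qed.

Lemma succ_right_step a T T1 T2 T3 :
  lin_in_right (tree_star mul) a T (first_branch T1) (first_branch T2)
    (first_branch T3) ->
  lin_in_right (tree_succ mul) a T T1 T2 T3.
Proof.
move=> + h; case: T1 T2 T3 / h.
- by move=> t0 t0' t0'' mid b t h S M G hG /=; branch S hG.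
- by move=> t0 m1 x y u m2 b t _ M G hG /=; one_place hG.
- by move=> t0 m1 x u u' u'' m2 b t h _ M G hG /=; one_place hG.
- by move=> t0 mid x y t _ M G hG /=; one_place hG.
- by move=> t0 mid b t t' t'' h _ M G hG /=; one_place hG.
Qed.

Local Ltac merged hG := rewrite !big_seq1; apply: hG.
Local Ltac joined S hG := rewrite ?big_map; apply: S => // c U1 U2 U3 hU;
  apply: hG; rewrite /vee_join; by constructor.

Lemma dot_left_step a T1 T2 T3 T' :
  lin_in_left (tree_star mul) a (last_branch T1) (last_branch T2)
    (last_branch T3) (first_branch T') ->
  lin_in_left (tree_dot mul) a T1 T2 T3 T'.
Proof.
move=> + h; case: T' => [|t0 mid b t] /=.
  by case: T1 T2 T3 / h => *; rewrite !big_nil scaler0 addr0.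
case: T1 T2 T3 / h.
- move=> s0 s0' s0'' ms b' s h _ M G hG /=; case: ifP => _; last by one_place hG.
  by merged hG; case: mid => [|[c v] mid] /=; constructor.
- move=> s0 m1 x y u m2 b' s _ M G hG /=; case: ifP => _; last by one_place hG.
  by merged hG; case: mid => [|[c v] mid] /=; rewrite -?catA; constructor.
- move=> s0 m1 x u u' u'' m2 b' s h _ M G hG /=.
  case: ifP => _; last by one_place hG.
  by merged hG; case: mid => [|[c v] mid] /=; rewrite -?catA; constructor.
- move=> s0 ms x y s _ M G hG /=; case: ifP => _; last by one_place hG.
  by merged hG; case: mid => [|[c v] mid] /=; rewrite bmul.1; constructor.
- move=> s0 ms b' s s' s'' h S M G hG /=.
  by have [-> -> ->] := tree_lin_not_leaf h; joined S hG.
Qed.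

Lemma dot_right_step a T T1 T2 T3 :
  lin_in_right (tree_star mul) a (last_branch T) (first_branch T1)
    (first_branch T2) (first_branch T3) ->
  lin_in_right (tree_dot mul) a T T1 T2 T3.
Proof.
move=> + h; case: T => [|t0 mid b t] /=.
  by case: T1 T2 T3 / h => *; rewrite !big_nil scaler0 addr0.
case: T1 T2 T3 / h.
- move=> s0 s0' s0'' ms b' s h S M G hG /=.
  by have [-> -> ->] := tree_lin_not_leaf h; rewrite andbF; joined S hG.
- move=> s0 m1 x y u m2 b' s _ M G hG /=; case: ifP => _; last first.
    rewrite ?big_map; apply: sum_lin => U /=.
    by apply: hG; rewrite /vee_join -!cat_cons !catA; constructor.
  merged hG; case: m1 => [|[c v] m1] /=; rewrite ?bmul.2; first by constructor.
  by rewrite -!cat_cons !catA; constructor.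
- move=> s0 m1 x u u' u'' m2 b' s h _ M G hG /=; case: ifP => _; last first.
    rewrite ?big_map; apply: sum_lin => U /=.
    by apply: hG; rewrite /vee_join -!cat_cons !catA; constructor.
  merged hG; case: m1 => [|[c v] m1] /=; first by constructor.
  by rewrite -!cat_cons !catA; constructor.
- move=> s0 ms x y s _ M G hG /=; case: ifP => _; last by one_place hG.
  by merged hG; case: ms => [|[c v] ms] /=; rewrite ?bmul.2; constructor.
- move=> s0 ms b' s s' s'' h _ M G hG /=; case: ifP => _; last by one_place hG.
  by merged hG; case: ms => [|[c v] ms] /=; constructor.
Qed.
Lemma star_left_step a T1 T2 T3 T' : ~~ is_leaf T' ->
  lin_in_left (tree_prec mul) a T1 T2 T3 T' ->
  lin_in_left (tree_succ mul) a T1 T2 T3 T' ->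
  lin_in_left (tree_dot mul) a T1 T2 T3 T' ->
  lin_in_left (tree_star mul) a T1 T2 T3 T'.
Proof.
move=> n' P S D h M G hG; have [n1 n2 n3] := tree_lin_not_leaf h.
rewrite !tree_star_node ?n1 ?n2 ?n3 // !big_cat (P h M G hG) (S h M G hG).
by rewrite /= (D h M G hG) [X in _ + X = _]addrACA [LHS]addrACA !scalerDr.
Qed.

Lemma star_right_step a T T1 T2 T3 : ~~ is_leaf T ->
  lin_in_right (tree_prec mul) a T T1 T2 T3 ->
  lin_in_right (tree_succ mul) a T T1 T2 T3 ->
  lin_in_right (tree_dot mul) a T T1 T2 T3 ->
  lin_in_right (tree_star mul) a T T1 T2 T3.
Proof.
move=> n' P S D h M G hG; have [n1 n2 n3] := tree_lin_not_leaf h.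
rewrite !tree_star_node ?n1 ?n2 ?n3 // !big_cat (P h M G hG) (S h M G hG).
by rewrite /= (D h M G hG) [X in _ + X = _]addrACA [LHS]addrACA !scalerDr.
Qed.

Lemma star_left a T1 T2 T3 T' : lin_in_left (tree_star mul) a T1 T2 T3 T'.
Proof.
elim/tree_nested_ind: T3 T1 T2 T' => [|t0 mid b t _ _ IH] T1 T2 T'.
  by move=> /tree_lin_not_leaf[].
elim/tree_nested_ind: T' => [|t0' mid' b' t' IH' _ _].
  move=> h M G hG; have [n1 n2 n3] := tree_lin_not_leaf h.
  by rewrite !tree_starE n1 n2 n3 !big_seq1; apply: hG.
by apply: star_left_step => //; [apply: prec_left_step | apply: succ_left_step
  | apply: dot_left_step]; first [exact: IH | exact: IH'].
Qed.

Lemma star_right a T T1 T2 T3 : lin_in_right (tree_star mul) a T T1 T2 T3.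
Proof.
elim/tree_nested_ind: T T1 T2 T3 => [|t0 mid b t _ _ IH] T1 T2 T3.
  by move=> h M G hG; rewrite !big_seq1; apply: hG.
elim/tree_nested_ind: T3 T1 T2 => [|t0' mid' b' t' IH' _ _] T1 T2.
  by move=> /tree_lin_not_leaf[].
by apply: star_right_step => //; [apply: prec_right_step | apply: succ_right_step
  | apply: dot_right_step]; first [exact: IH | exact: IH'].
Qed.

Definition lin_op op := (forall a T1 T2 T3 T, lin_in_left op a T1 T2 T3 T) /\
  (forall a T T1 T2 T3, lin_in_right op a T T1 T2 T3).

Lemma tree_prec_lin : lin_op (tree_prec mul).
Proof.
split=> *; [apply: prec_left_step | apply: prec_right_step];
  by [apply: star_left | apply: star_right].
Qed.

Lemma tree_succ_lin : lin_op (tree_succ mul).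
Proof.
split=> *; [apply: succ_left_step | apply: succ_right_step];
  by [apply: star_left | apply: star_right].
Qed.

Lemma tree_dot_lin : lin_op (tree_dot mul).
Proof.
split=> *; [apply: dot_left_step | apply: dot_right_step];
  by [apply: star_left | apply: star_right].
Qed.

End TreeLinearity.

Section Decorate.
Variables (k : fieldType) (A : lmodType k).

(** [decorate] reads a prefix of the word, so a letter placed further on does not
matter; this is what localises a changed letter in one branch. *)
Lemma decorate_prefix D E (d : E) (T : tree D) (s s' : seq E) :
  take (size (angles T)) s = take (size (angles T)) s' ->
  decorate d T s = decorate d T s'.
Proof.
elim/tree_nested_ind: T s s' => //= t0 mid a t IH0 IHm IHt s s'.
set n0 := size (angles t0); rewrite !size_cat /= -/n0 => E0.
have -> : decorate d t0 s = decorate d t0 s'.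
  apply: IH0; rewrite -/n0; move/(congr1 (take n0)): E0.
  by rewrite !take_takel //; apply: leq_addr.
have {E0} : take (size (flatten [seq p.1 :: angles p.2 | p <- mid])
      + (size (angles t)).+1) (drop n0 s) =
    take (size (flatten [seq p.1 :: angles p.2 | p <- mid])
      + (size (angles t)).+1) (drop n0 s').
  by rewrite !take_drop addnC E0.
move: (decorate d t0 s') (drop n0 s) (drop n0 s') => T0 {}s {}s'.
suff H : take (size (flatten [seq p.1 :: angles p.2 | p <- mid])
      + (size (angles t)).+1) s =
    take (size (flatten [seq p.1 :: angles p.2 | p <- mid])
      + (size (angles t)).+1) s' ->
    (decorate_mid d (decorate d) mid s).1 = (decorate_mid d (decorate d) mid s').1
    /\ take (size (angles t)).+1 (decorate_mid d (decorate d) mid s).2 =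
    take (size (angles t)).+1 (decorate_mid d (decorate d) mid s').2.
  move=> /H[-> E1]; congr Vee.
    by move: E1; case: (_.2) => [|x r]; case: (_.2) => [|x' r'] //= [].
  by apply: IHt; move: E1; case: (_.2) => [|x r]; case: (_.2) => [|x' r'] //= [].
elim: mid IHm s s' {T0} => //= -[b u] mid IH [hu hm] s s' /=.
rewrite size_cat addSn -addnA => E1.
have hh : head d s = head d s' by move: E1; case: (s) (s') => [|x r] [|x' r'] //= [].
have {}E1 : take (size (angles u) + (size (flatten [seq p.1 :: angles p.2 | p <- mid])
      + (size (angles t)).+1)) (behead s) =
    take (size (angles u) + (size (flatten [seq p.1 :: angles p.2 | p <- mid])
      + (size (angles t)).+1)) (behead s').
  by move: E1; case: (s) (s') => [|x r] [|x' r'] //= [].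
have -> : decorate d u (behead s) = decorate d u (behead s').
  apply: hu; move/(congr1 (take (size (angles u)))): E1.
  by rewrite !take_takel //; apply: leq_addr.
rewrite hh.
have /(IH hm)[-> ->] : take (size (flatten [seq p.1 :: angles p.2 | p <- mid])
      + (size (angles t)).+1) (drop (size (angles u)) (behead s)) =
    take (size (flatten [seq p.1 :: angles p.2 | p <- mid])
      + (size (angles t)).+1) (drop (size (angles u)) (behead s')).
  by rewrite !take_drop addnC E1.
by [].
Qed.

Lemma decorate_lin (X : Type) (S : tree X) s1 s2 a (x y : A) :
  (size s1 < size (angles S))%N ->
  tree_lin a (decorate 0 S (s1 ++ x :: s2)) (decorate 0 S (s1 ++ y :: s2))
    (decorate 0 S (s1 ++ (a *: x + y) :: s2)).
Proof.
elim/tree_nested_ind: S s1 => //= t0 mid c t IH0 IHm IHt s1.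
rewrite !size_cat /=; set n0 := size (angles t0) => hs.
have [lt0|ge0] := ltnP (size s1) n0.
  have D z : drop n0 (s1 ++ z :: s2) = drop (n0 - size s1).-1 s2.
    rewrite drop_cat ltnNge ltnW //=; case E: (n0 - size s1)%N => //; lia.
  by rewrite !D; constructor; apply: IH0.
have D0 z : decorate 0 t0 (s1 ++ z :: s2) = decorate 0 t0 s1.
  by apply: decorate_prefix; rewrite takel_cat.
rewrite !{}D0.
have D z : drop n0 (s1 ++ z :: s2) = drop n0 s1 ++ z :: s2.
  rewrite drop_cat; case: ltngtP ge0 => // E _.
  by rewrite E subnn drop_size.
rewrite !{}D.
move: (decorate 0 t0 s1) (drop n0 s1) (size_drop n0 s1) => T0 r szr.
have {szr ge0 hs} hr : (size r < size (flatten [seq p.1 :: angles p.2 | p <- mid])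
    + (size (angles t)).+1)%N by rewrite szr; lia.
pose dm (s : seq A) := decorate_mid 0 (decorate 0) mid s.
pose vee m1 (s : seq A) := Vee T0 (m1 ++ (dm s).1) (head 0 (dm s).2)
  (decorate 0 t (behead (dm s).2)).
suff H m1 : tree_lin a (vee m1 (r ++ x :: s2)) (vee m1 (r ++ y :: s2))
    (vee m1 (r ++ (a *: x + y) :: s2)) by exact: (H [::]).
rewrite {}/vee {}/dm {s1 t0 IH0 n0}.
elim: mid IHm m1 r hr => [|[b u] mid IH] /= IHm m1 r hr.
  rewrite !cats0; case: r hr => [|z r] /= hr; first by constructor.
  by constructor; apply: IHt.
case: IHm => hu hm; case: r hr => [|z r] /=; first by constructor.
rewrite size_cat addSn -addnA => hr.
set nu := size (angles u) in hr *.
have [ltu|geu] := ltnP (size r) nu.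
  have D w : drop nu (r ++ w :: s2) = drop (nu - size r).-1 s2.
    rewrite drop_cat ltnNge ltnW //=; case E: (nu - size r)%N => //; lia.
  by rewrite !D; constructor; apply: hu.
have D0 w : decorate 0 u (r ++ w :: s2) = decorate 0 u r.
  by apply: decorate_prefix; rewrite takel_cat.
have D w : drop nu (r ++ w :: s2) = drop nu r ++ w :: s2.
  rewrite drop_cat; case: ltngtP geu => // E _.
  by rewrite E subnn drop_size.
rewrite !{}D0 !{}D.
have := IH hm (rcons m1 (z, decorate 0 u r)) (drop nu r).
by rewrite !cat_rcons; apply; rewrite size_drop; lia.
Qed.

Lemma multilinear_decorate (X : Type) (M : lmodType k) (G : tree A -> M) (S : tree X) :
  tree_linear G -> multilinear (leaves S).-1 (fun s => G (decorate 0 S s)).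
Proof.
move=> hG s1 s2 a x y; rewrite leavesE /= => E.
by apply: hG; apply: decorate_lin; lia.
Qed.

Lemma tree_lin_shape_angles a (T1 T2 T3 : tree A) : tree_lin a T1 T2 T3 ->
  [/\ Defs.shape T1 = Defs.shape T3, Defs.shape T2 = Defs.shape T3 & exists s1 x y s2,
    [/\ angles T1 = s1 ++ x :: s2, angles T2 = s1 ++ y :: s2
      & angles T3 = s1 ++ (a *: x + y) :: s2]].
Proof.
elim=> {T1 T2 T3}.
- move=> t0 t0' t0'' mid b t _ [/= -> -> [s1 [x [y [s2 [-> -> ->]]]]]].
  split=> //; set r := flatten _ ++ _.
  by exists s1, x, y, (s2 ++ r); do !rewrite -?catA /=.
- move=> t0 m1 x y u m2 b t /=; rewrite !map_cat /= !flatten_cat /=.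
  split=> //; exists (angles t0 ++ flatten [seq p.1 :: angles p.2 | p <- m1]), x, y.
  by exists (angles u ++ flatten [seq p.1 :: angles p.2 | p <- m2] ++ b :: angles t);
    do !rewrite -?catA /=.
- move=> t0 m1 c u u' u'' m2 b t _ [/= E1 E2 [s1 [x [y [s2 [F1 F2 F3]]]]]].
  rewrite !map_cat /= !flatten_cat /= E1 E2 F1 F2 F3; split=> //.
  exists (angles t0 ++ flatten [seq p.1 :: angles p.2 | p <- m1] ++ c :: s1), x, y.
  by exists (s2 ++ flatten [seq p.1 :: angles p.2 | p <- m2] ++ b :: angles t);
    do !rewrite -?catA /=.
- move=> t0 mid x y t /=; split=> //.
  exists (angles t0 ++ flatten [seq p.1 :: angles p.2 | p <- mid]), x, y, (angles t).
  by do !rewrite -?catA /=.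
- move=> t0 mid b t t' t'' _ [/= -> -> [s1 [x [y [s2 [-> -> ->]]]]]].
  split=> //.
  exists (angles t0 ++ flatten [seq p.1 :: angles p.2 | p <- mid] ++ b :: s1), x, y, s2.
  by do !rewrite -?catA /=.
Qed.

Lemma tree_vectE n (T : tree A) : size (angles T) = n.+1 ->
  tree_vect T = dsin (M := fun n => angular_component A n.+1) (i := n)
    (tens (shape_vect k n.+1 (Defs.shape T)) (tpure n.+1 (angles T))).
Proof. by rewrite /tree_vect => ->. Qed.

Lemma tree_vect_lin : tree_linear (@tree_vect k A).
Proof.
move=> a T1 T2 T3 /tree_lin_shape_angles[E1 E2 [s1 [x [y [s2 [F1 F2 F3]]]]]].
pose n := (size s1 + size s2)%N.
rewrite !(@tree_vectE n) ?F1 ?F2 ?F3 ?size_cat ?addnS // E1 E2.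
rewrite (@tpure_multilinear _ A n.+1) ?addnS //.
by rewrite (lin_tensr _ a) (@dsin_linear _ _ _ n a).
Qed.

Section TreeEvalLinear.
Variables (R : lmodType k) (precR succR dotR : R -> R -> R) (psi : A -> R).
Hypothesis tdR : tridendriform precR succR dotR.
Hypothesis lpsi : islin psi.
Local Notation ev := (tree_eval precR succR dotR psi).
Local Notation actR := (act_right precR succR dotR psi).
Local Notation actL := (act_left precR succR dotR psi).
Local Notation djoin := (dot_join precR succR dotR psi).

Lemma tree_eval_lin : tree_linear ev.
Proof.
have [/isbilP bp /isbilP bs /isbilP bd _ _ _ _ _ _ _] := tdR.
have AR a b t t' t'' : tree_lin a t t' t'' ->
    ev t'' = a *: ev t + ev t' ->
    actR b t'' = a *: actR b t + actR b t'.
  by rewrite /act_right => /tree_lin_not_leaf[-> -> ->] ->; rewrite bp.2.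
have AA u : islin (fun x => actR (psi x) u).
  by rewrite /act_right; case: (is_leaf u); lin.
have J mid : islin (djoin mid) by apply: (dot_join_lin _ tdR).
have L t : islin (actL t) by apply: (act_left_lin _ tdR).
have JM m1 (p : A * tree A) m2 x : djoin (m1 ++ p :: m2) x =
    djoin m1 (dotR (actR (psi p.1) p.2) (djoin m2 x)).
  by rewrite /dot_join foldr_cat.
move=> a T1 T2 T3; elim=> {T1 T2 T3}.
- move=> t0 t0' t0'' mid b t h E; rewrite !tree_eval_Vee /act_left.
  by have [-> -> ->] := tree_lin_not_leaf h; rewrite E bs.1.
- move=> t0 m1 x y u m2 b t; rewrite !tree_eval_Vee !JM /= AA.
  by rewrite bd.1 J L.
- move=> t0 m1 x u u' u'' m2 b t h E; rewrite !tree_eval_Vee !JM /= (AR _ _ _ _ _ h E).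
  by rewrite bd.1 J L.
- by move=> t0 mid x y t; rewrite !tree_eval_Vee AA J L.
- by move=> t0 mid b t t' t'' h E; rewrite !tree_eval_Vee (AR _ _ _ _ _ h E) J L.
Qed.
End TreeEvalLinear.
End Decorate.

(** * The tridendriform algebra of decorated dense trees *)

Section PAbarExtensionality.
Variables (k : fieldType) (A : lmodType k).

Lemma tpow_ext n (M : lmodType k) (g h : tpow A n -> M) : islin g -> islin h ->
  (forall s, size s = n -> g (tpure n s) = h (tpure n s)) -> g =1 h.
Proof.
elim: n g h => [|n IH] /= g h lg lh gh x.
  have -> : x = x *: (1 : k^o) by rewrite /GRing.scale /= mulr1.
  by rewrite (islinZ _ _ lg) (islinZ _ _ lh) (gh [::]).
move: x; apply: tensor_ext => // v; apply: IH.
- by apply: (lin_comp lg); apply: lin_tensr.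
- by apply: (lin_comp lh); apply: lin_tensr.
- by move=> s sz; apply: (gh (v :: s)); rewrite /= sz.
Qed.

(** The pure tensors that span the module are the decorated dense trees. *)
Lemma dense_tree_vect n (S : dense_tree n.+1) (s : seq A) : size s = n.+1 ->
  dsin (M := fun n => angular_component A n.+1) (i := n)
    (tens (fgen k S) (tpure n.+1 s)) = tree_vect (decorate 0 (val S) s) /\
  dense_node (decorate 0 (val S) s).
Proof.
case: S => T hT sz /=; have /andP[dT /eqP lT] := hT.
have sT : size (angles T) = n.+1 by move: lT; rewrite leavesE => -[].
have := @decorateP _ _ 0 T s [::]; rewrite cats0 sz sT => /(_ erefl)[shT aT].
split; last first.
  rewrite /dense_node -dense_shape shT dense_shape dT.
  by case: (T) sT.
rewrite (@tree_vectE _ _ n) ?aT // shT.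
have shS (T0 : tree unit) : Defs.shape T0 = T0.
  elim/tree_nested_ind: T0 => //= t0 mid [] t -> hm ->; congr Vee.
  by elim: mid hm => //= -[[] u] mid IH [/= -> /IH ->].
rewrite shS /shape_vect; case: insubP => [S _ /= E|]; last by rewrite hT.
by have -> : S = exist _ T hT :> dense_tree n.+1 by apply: val_inj.
Qed.

Lemma PAbar_ext (M : lmodType k) (g h : PAbar A -> M) : islin g -> islin h ->
  (forall T, dense_node T -> g (tree_vect T) = h (tree_vect T)) -> g =1 h.
Proof.
move=> lg lh gh; apply: plift_uniq => // -[n u].
have lin_in f : islin f -> islin (fun u : angular_component A n.+1 =>
    f (dsin (M := fun n => angular_component A n.+1) u) : M).
  by move=> lf a x y; rewrite (@dsin_linear _ _ _ n a) lf.
apply: (tensor_ext (lin_in _ lg) (lin_in _ lh)) => {u} p t; move: p.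
apply: plift_uniq => [||S].
- by apply: (lin_comp (lin_in _ lg)); apply: lin_tensl.
- by apply: (lin_comp (lin_in _ lh)); apply: lin_tensl.
move: t; apply: tpow_ext => [||s sz].
- by apply: (lin_comp (lin_in _ lg)); apply: lin_tensr.
- by apply: (lin_comp (lin_in _ lh)); apply: lin_tensr.
by have [-> dn] := dense_tree_vect S sz; apply: gh.
Qed.

Section Lift.
Variable M : lmodType k.

Lemma PA_lift_lin (G : tree A -> M) : tree_linear G -> islin (PA_lift G).
Proof.
move=> hG; apply: dslift_linear => n; apply: tlift_linear; move: n.+1 => {}n.
split=> [t|g a t t'] /=; first exact: flift_linear.
rewrite -plift_fun_linear; apply: plift_ext => -[S hS] /=.
have /andP[dS /eqP lS] := hS; apply: tpow_lift_linear.
by have := multilinear_decorate (S := S) hG; rewrite lS.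
Qed.

Lemma PA_lift_node (G : tree A -> M) T : tree_linear G -> dense_node T ->
  PA_lift G (tree_vect T) = G T.
Proof.
move=> hG /andP[dT nT]; apply: PA_lift_tree => // S _.
exact: multilinear_decorate.
Qed.

Lemma PA_lift_ext (G H : tree A -> M) x :
  (forall T, dense_node T -> G T = H T) -> PA_lift G x = PA_lift H x.
Proof.
move=> GH; apply: plift_ext => -[n u]; apply: plift_ext => -[p t].
apply: plift_ext => S; apply: (@tpow_lift_ext _ _ _ n.+1) => s sz.
by apply: GH; have [] := dense_tree_vect S sz.
Qed.

(** Allows a function given on trees to be replaced by a linear map that agrees with
it there; no multilinearity of that function has to be checked. *)
Lemma PA_lift_tree_vect (h : PAbar A -> M) x : islin h ->
  PA_lift (fun T => h (tree_vect T)) x = h x.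
Proof.
move=> lh; have hG : tree_linear (fun T => h (tree_vect T)).
  by move=> a T1 T2 T3 E; rewrite (tree_vect_lin E) lh.
move: x; apply: PAbar_ext => //; first exact: PA_lift_lin.
by move=> T dT; rewrite PA_lift_node.
Qed.

End Lift.

Section Op.
Variable op : tree A -> tree A -> seq (tree A).
Hypothesis lop : lin_op op.

Let tl_right T : tree_linear (fun T' => \sum_(U <- op T T') tree_vect U).
Proof.
by move=> a T1 T2 T3 h; apply: (lop.2 a T T1 T2 T3 h); apply: tree_vect_lin.
Qed.

Let tl_left y : tree_linear (fun T =>
  PA_lift (fun T' => \sum_(U <- op T T') tree_vect U) y).
Proof.
move=> a T1 T2 T3 h; move: y; apply: PAbar_ext.
- exact: PA_lift_lin.
- by apply: lin_add; [apply: lin_scale|]; apply: PA_lift_lin.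
- move=> T dT; rewrite !PA_lift_node //.
  by apply: (lop.1 a T1 T2 T3 T h); apply: tree_vect_lin.
Qed.

Lemma PA_op_bil : isbil (PA_op op).
Proof.
have left y : islin (fun x => PA_op op x y) by apply: PA_lift_lin.
split=> // x a y z; move: x; apply: PAbar_ext => //.
  by apply: lin_add; [apply: lin_scale|]; apply: left.
move=> T dT; rewrite /PA_op !PA_lift_node //.
exact: PA_lift_lin.
Qed.

Lemma PA_op_node T T' : dense_node T -> dense_node T' ->
  PA_op op (tree_vect T) (tree_vect T') = \sum_(U <- op T T') tree_vect U.
Proof. by move=> dT dT'; rewrite /PA_op !PA_lift_node. Qed.

End Op.

(** Trilinear identities may be checked on trees. *)
Lemma PAbar_ext3 (M : lmodType k) (g h : PAbar A -> PAbar A -> PAbar A -> M) :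
  (forall y z, islin (fun x => g x y z)) -> (forall x z, islin (fun y => g x y z)) ->
  (forall x y, islin (g x y)) ->
  (forall y z, islin (fun x => h x y z)) -> (forall x z, islin (fun y => h x y z)) ->
  (forall x y, islin (h x y)) ->
  (forall x y z, dense_node x -> dense_node y -> dense_node z ->
    g (tree_vect x) (tree_vect y) (tree_vect z) =
    h (tree_vect x) (tree_vect y) (tree_vect z)) ->
  forall x y z, g x y z = h x y z.
Proof.
move=> g1 g2 g3 h1 h2 h3 gh x y z; move: x.
apply: PAbar_ext => // x dx; move: y; apply: PAbar_ext => // y dy; move: z.
by apply: PAbar_ext => // z dz; apply: gh.
Qed.

End PAbarExtensionality.

Section PAbarTridendriform.
Variables (k : fieldType) (A : lmodType k) (mul : A -> A -> A).
Hypotheses (bmul : isbil mul) (mulA : associative mul).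

Local Notation prec := (PA_prec mul).
Local Notation succ := (PA_succ mul).
Local Notation dot := (PA_dot mul).

Lemma PA_prec_bil : isbil prec. Proof. exact/PA_op_bil/tree_prec_lin. Qed.
Lemma PA_succ_bil : isbil succ. Proof. exact/PA_op_bil/tree_succ_lin. Qed.
Lemma PA_dot_bil : isbil dot. Proof. exact/PA_op_bil/tree_dot_lin. Qed.

Lemma PA_op_suml (op : PAbar A -> PAbar A -> PAbar A) I (s : seq I) (F : I -> PAbar A) y :
  isbil op -> op (\sum_(i <- s) F i) y = \sum_(i <- s) op (F i) y.
Proof. by case=> h _; rewrite (islin_sum _ _ (h y)). Qed.

Lemma PA_op_sumr (op : PAbar A -> PAbar A -> PAbar A) I (s : seq I) (F : I -> PAbar A) y :
  isbil op -> op y (\sum_(i <- s) F i) = \sum_(i <- s) op y (F i).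
Proof. by case=> _ h; rewrite (islin_sum _ _ (h y)). Qed.

Lemma PA_op_op_l op1 op2 x y z : lin_op op1 -> lin_op op2 -> closed_op op1 ->
  dense_node x -> dense_node y -> dense_node z ->
  PA_op op2 (PA_op op1 (tree_vect x) (tree_vect y)) (tree_vect z : PAbar A) =
  \sum_(U <- op1 x y) \sum_(V <- op2 U z) tree_vect V.
Proof.
move=> l1 l2 c1 dx dy dz; rewrite (PA_op_node l1) // PA_op_suml; last exact: PA_op_bil.
by apply: eq_big_all (c1 _ _ dx dy) _ => U dU; rewrite (PA_op_node l2).
Qed.

Lemma PA_op_op_r op1 op2 x y z : lin_op op1 -> lin_op op2 -> closed_op op1 ->
  dense_node x -> dense_node y -> dense_node z ->
  PA_op op2 (tree_vect x : PAbar A) (PA_op op1 (tree_vect y) (tree_vect z)) =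
  \sum_(U <- op1 y z) \sum_(V <- op2 x U) tree_vect V.
Proof.
move=> l1 l2 c1 dx dy dz; rewrite (PA_op_node l1) // PA_op_sumr; last exact: PA_op_bil.
by apply: eq_big_all (c1 _ _ dy dz) _ => U dU; rewrite (PA_op_node l2).
Qed.

Lemma PA_op_assoc op1 op2 op3 op4 :
  lin_op op1 -> lin_op op2 -> lin_op op3 -> lin_op op4 ->
  closed_op op1 -> closed_op op3 ->
  (forall x y z, dense_node x -> dense_node y -> dense_node z ->
    \sum_(U <- op1 x y) \sum_(V <- op2 U z) tree_vect V =
    \sum_(U <- op3 y z) \sum_(V <- op4 x U) tree_vect V :> PAbar A) ->
  forall x y z : PAbar A,
    PA_op op2 (PA_op op1 x y) z = PA_op op4 x (PA_op op3 y z).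
Proof.
move=> l1 l2 l3 l4 c1 c3 E.
have [b1 b2] := (PA_op_bil l1, PA_op_bil l2).
have [b3 b4] := (PA_op_bil l3, PA_op_bil l4).
apply: PAbar_ext3 => [||||||x y z dx dy dz]; try by lin.
by rewrite PA_op_op_l // PA_op_op_r // E.
Qed.

Lemma PA_starE (x y : PAbar A) :
  prec x y + succ x y + dot x y = PA_op (tree_star mul) x y.
Proof.
have [bp bs bd] := And3 PA_prec_bil PA_succ_bil PA_dot_bil.
have lst : lin_op (tree_star mul) by split=> *; [apply: star_left|apply: star_right].
have bst := PA_op_bil lst.
move: x; apply: PAbar_ext; try by lin.
move=> T dT; move: y; apply: PAbar_ext; try by lin.
move=> T' dT'; rewrite (PA_op_node lst) //.
case/andP: (dT) (dT') => _ nT /andP[_ nT'].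
by rewrite sum_star // /PA_prec /PA_succ /PA_dot !PA_op_node; try exact: tree_prec_lin;
  try exact: tree_succ_lin; try exact: tree_dot_lin.
Qed.

Lemma PA_tridendriform : tridendriform prec succ dot.
Proof.
have [cp cs cd] := ops_closed mul.
have [lp ls ld] := And3 (tree_prec_lin bmul) (tree_succ_lin bmul) (tree_dot_lin bmul).
have lst : lin_op (tree_star mul) by split=> *; [apply: star_left|apply: star_right].
have cst := @star_closed A mul.
split; [exact/isbilP/PA_prec_bil | exact/isbilP/PA_succ_bil
  | exact/isbilP/PA_dot_bil | | | | | | | ]; move=> x y z; rewrite ?PA_starE;
  try apply: PA_op_assoc => //; try (symmetry; apply: PA_op_assoc => //);
  move=> {}x {}y {}z /andP[_ nx] /andP[_ ny] /andP[_ nz].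
- case: x nx => // x0 xm a x _; apply: tree_prec_prec; exact: tree_star_assoc.
- exact: tree_succ_prec.
- case: z nz => // z0 zm c z _; apply: tree_succ_succ; exact: tree_star_assoc.
- exact: tree_dot_prec.
- case: x z nx nz => // x0 xm a x [//|z0 zm c z] _ _.
  by apply: tree_prec_dot => //; apply: tree_star_assoc.
- exact: tree_succ_dot.
- exact: tree_dot_dot.
Qed.

End PAbarTridendriform.

(** * The universal property without braidings *)

Section Generation.
Variables (k : fieldType) (A : lmodType k) (mul : A -> A -> A).
Hypotheses (bmul : isbil mul) (mulA : associative mul).

Local Notation prec := (PA_prec mul).
Local Notation succ := (PA_succ mul).
Local Notation dot := (PA_dot mul).
Local Notation incl := (@PA_incl k A).
Local Notation ev := (tree_eval prec succ dot incl).

Lemma PA_prec_node T T' : dense_node T -> dense_node T' ->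
  prec (tree_vect T) (tree_vect T') = \sum_(U <- tree_prec mul T T') tree_vect U.
Proof. exact/PA_op_node/tree_prec_lin. Qed.

Lemma PA_succ_node T T' : dense_node T -> dense_node T' ->
  succ (tree_vect T) (tree_vect T') = \sum_(U <- tree_succ mul T T') tree_vect U.
Proof. exact/PA_op_node/tree_succ_lin. Qed.

Lemma PA_dot_node T T' : dense_node T -> dense_node T' ->
  dot (tree_vect T) (tree_vect T') = \sum_(U <- tree_dot mul T T') tree_vect U.
Proof. exact/PA_op_node/tree_dot_lin. Qed.

(** The expression of a tree, evaluated in the algebra of trees, is the tree itself.
Density enters here: an inner branch u is nontrivial, so the product of
|\/_b u with the tree to its right joins the two roots and does not merge
angles. *)
Lemma tree_eval_incl T : dense_node T -> ev T = tree_vect T.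
Proof.
elim/tree_nested_ind: T => [/andP[]//|t0 mid a t IH0 IHm IHt].
move=> /andP[/= /and3P[d0 dm dt] _].
have R b u : dense u -> (dense_node u -> ev u = tree_vect u) ->
    act_right prec succ dot incl (incl b) u = tree_vect (Vee Leaf [::] b u).
  rewrite /act_right => du; case: ifP => [|/negbT nu]; first by case: u du.
  have gu : dense_node u by rewrite /dense_node du.
  by move=> -> //; rewrite /PA_incl PA_prec_node //= big_seq1.
have sL u : tree_star mul u Leaf = [:: u] by case: u.
rewrite tree_eval_Vee R //.
have -> : dot_join prec succ dot incl mid (tree_vect (Vee Leaf [::] a t)) =
    tree_vect (Vee Leaf mid a t).
  elim: mid IHm dm => //= -[b u] mid IH [hu hm] /= /andP[/andP[nu du] dm].
  rewrite IH // R // PA_dot_node /dense_node /= ?du ?dm ?dt //.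
  by rewrite (negbTE nu) /= sL big_seq1.
rewrite /act_left; case: ifP => [|/negbT n0]; first by case: (t0).
have g0 : dense_node t0 by rewrite /dense_node d0.
rewrite IH0 // PA_succ_node //; last by rewrite /dense_node /= dm dt.
by rewrite /= sL big_seq1.
Qed.

(** Induction on generators for equalities of linear maps.  The family index I
carries the other arguments, over which the induction hypotheses have to be
quantified. *)
Lemma PAbar_gen (I : Type) (M : lmodType k) (g h : I -> PAbar A -> M) :
  (forall i, islin (g i)) -> (forall i, islin (h i)) ->
  (forall a i, g i (incl a) = h i (incl a)) ->
  (forall o x y, (forall i, g i x = h i x) -> (forall i, g i y = h i y) ->
    forall i, g i (operate prec succ dot o x y) = h i (operate prec succ dot o x y)) ->
  forall i x, g i x = h i x.
Proof.
move=> lg lh base step i; apply: PAbar_ext => // T dT; rewrite -tree_eval_incl //.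
rewrite /tree_eval; elim: (tree_term 0 T) i => [a|o e1 IH1 e2 IH2] //= i.
exact: step.
Qed.

Lemma incl_lin : islin incl.
Proof.
move=> a x y; apply: tree_vect_lin; exact: TreeLinLastAngle.
Qed.

Lemma inclM a b : incl (mul a b) = dot (incl a) (incl b).
Proof. by rewrite PA_dot_node //= big_seq1. Qed.

Section Universal.
Variables (R : lmodType k) (precR succR dotR : R -> R -> R) (psi : A -> R).
Hypothesis tdR : tridendriform precR succR dotR.
Hypotheses (lpsi : islin psi) (psiM : forall a b, psi (mul a b) = dotR (psi a) (psi b)).

Definition PA_hat : PAbar A -> R := PA_lift (tree_eval precR succR dotR psi).

Lemma PA_hat_lin : islin PA_hat.
Proof. exact/PA_lift_lin/tree_eval_lin. Qed.

Lemma PA_hat_node T : dense_node T ->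
  PA_hat (tree_vect T) = tree_eval precR succR dotR psi T.
Proof. by move=> dT; rewrite /PA_hat PA_lift_node //; apply: tree_eval_lin. Qed.

Lemma PA_hat_incl a : PA_hat (incl a) = psi a.
Proof. exact: PA_hat_node. Qed.

Lemma PA_hat_op op opR : lin_op op -> closed_op op -> isbil opR ->
  (forall T T', ~~ is_leaf T -> ~~ is_leaf T' ->
    \sum_(U <- op T T') tree_eval precR succR dotR psi U =
    opR (tree_eval precR succR dotR psi T) (tree_eval precR succR dotR psi T')) ->
  forall x y, PA_hat (PA_op op x y) = opR (PA_hat x) (PA_hat y).
Proof.
move=> lop cop bR E x y; have bop := PA_op_bil lop; have lh := PA_hat_lin.
move: x; apply: PAbar_ext; try by lin.
move=> T dT; move: y; apply: PAbar_ext; try by lin.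
move=> T' dT'; rewrite (PA_op_node lop) // (islin_sum _ _ lh).
rewrite (eq_big_all (cop _ _ dT dT') PA_hat_node).
by rewrite !PA_hat_node // E; case/andP: dT dT' => _ nT /andP[].
Qed.

Lemma PA_hat_operate o x y : PA_hat (operate prec succ dot o x y) =
  operate precR succR dotR o (PA_hat x) (PA_hat y).
Proof.
have [cp cs cd] := ops_closed mul.
have [/isbilP bp /isbilP bs /isbilP bd _ _ _ _ _ _ _] := tdR.
case: o; apply: PA_hat_op => //.
- exact: tree_prec_lin.
- exact: tree_eval_prec.
- exact: tree_succ_lin.
- exact: tree_eval_succ.
- exact: tree_dot_lin.
- exact: tree_eval_dot.
Qed.

End Universal.
End Generation.

(** * Convolution tridendriform algebras *)

Section Convolution.
Variables (k : fieldType) (W B : lmodType k).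
Implicit Types (op : B -> B -> B) (f g h : linmap W (tensor W B)).

(** First g, then f; the factors in B, produced from right to left, are multiplied
in the order f, g.  For f = tau (p (x) -) and g = tau (q (x) -) this is the way
in which a product of p and q passes w. *)
Definition circ op f g : linmap W (tensor W B) :=
  lmap (fun w => sw (w1, b1) <- g w; sw (w2, b2) <- f w1; tens w2 (op b2 b1)).

Lemma circE op f g w : isbil op ->
  circ op f g w = sw (w1, b1) <- g w; sw (w2, b2) <- f w1; tens w2 (op b2 b1).
Proof. by move=> bop; rewrite lmapE //; lin. Qed.

Lemma sw_circ (M : lmodType k) (F : W -> B -> M) op f g w : isbil op -> isbil F ->
  (sw (w1, b1) <- circ op f g w; F w1 b1) =
  sw (w1, b1) <- g w; sw (w2, b2) <- f w1; F w2 (op b2 b1).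
Proof.
move=> bop bF; rewrite circE // [LHS]tlift_comp; last by lin.
apply: tlift_ext => w1 b1; rewrite tlift_comp; last by lin.
by apply: tlift_ext => w2 b2; rewrite sw_tens.
Qed.

Lemma circ_bil op : isbil op -> isbil (circ op).
Proof.
move=> bop; split=> [g|f] a x y; apply: linmapP => w.
  have L : islin (fun f : linmap W (tensor W B) =>
      sw (w1, b1) <- g w; sw (w2, b2) <- f w1; tens w2 (op b2 b1)) by lin.
  by rewrite circE // L -!circE.
have L : islin (fun g : linmap W (tensor W B) =>
    sw (w1, b1) <- g w; sw (w2, b2) <- f w1; tens w2 (op b2 b1)) by lin.
by rewrite circE // L -!circE.
Qed.

(** An identity between iterated products holds in the convolution algebra as soon as
it holds in B, because composition of linear maps is associative. *)
Lemma circ_assoc p q r s f g h :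
  isbil p -> isbil q -> isbil r -> isbil s ->
  (forall x y z, p x (q y z) = r (s x y) z) ->
  circ p f (circ q g h) = circ r (circ s f g) h.
Proof.
move=> bp bq br bs E; apply: linmapP => w.
rewrite [LHS]circE // [RHS]circE // sw_circ //; last by lin.
apply: tlift_ext => w1 z; rewrite sw_circ //; last by lin.
apply: tlift_ext => w2 y; apply: tlift_ext => w3 x.
by rewrite E.
Qed.

Lemma circ_add3 p q r f g : isbil p -> isbil q -> isbil r ->
  circ (fun x y => p x y + q x y + r x y) f g =
  circ p f g + circ q f g + circ r f g.
Proof.
move=> bp bq br; apply: linmapP => w; rewrite !lappD !circE //; last first.
  by split=> ?; lin; apply: lin_add; try apply: lin_add; lin.
rewrite -tliftD -tliftD; apply: tlift_ext => w1 b1.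
rewrite -tliftD -tliftD; apply: tlift_ext => w2 b2.
by rewrite !(islinD _ _ (lin_tensr _)).
Qed.

Lemma convolution_tridendriform prec succ dot :
  tridendriform prec succ dot ->
  tridendriform (circ prec) (circ succ) (circ dot).
Proof.
case=> /isbilP bp /isbilP bs /isbilP bd *.
have bt : isbil (fun x y => prec x y + succ x y + dot x y) by lin.
split; try by apply/isbilP; apply: circ_bil.
all: move=> x y z; rewrite -?circ_add3 //.
all: by first [apply: circ_assoc | symmetry; apply: circ_assoc].
Qed.

(** First f, then g: the way in which a product passes from right to left. *)
Definition cocirc op f g := circ (fun x y => op y x) g f.

Lemma coconvolution_tridendriform prec succ dot :
  tridendriform prec succ dot ->
  tridendriform (cocirc prec) (cocirc succ) (cocirc dot).
Proof.
rewrite /cocirc.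
case=> /isbilP bp /isbilP bs /isbilP bd *.
have bil (o : B -> B -> B) : isbil o -> isbil (fun x y => o y x) by case.
have bt : isbil (fun x y => prec x y + succ x y + dot x y) by lin.
split; try by apply/isbilP; split=> ?; first [apply: (circ_bil _).1 | apply: (circ_bil _).2]; apply: bil.
all: move=> x y z; rewrite -?circ_add3; try exact: bil.
all: first [apply: circ_assoc | symmetry; apply: circ_assoc];
  first [exact: bil | done | idtac].
Qed.

End Convolution.

(** * Braid relations in Sweedler notation *)

Section SweedlerBraid.
Variables (k : fieldType) (V : lmodType k) (sigma : tensor V V -> tensor V V).
Hypothesis lsigma : islin sigma.

Lemma tens3_ext (U1 U2 U3 M : lmodType k) (g h : tensor U1 (tensor U2 U3) -> M) :
  islin g -> islin h ->
  (forall x y z, g (tens x (tens y z)) = h (tens x (tens y z))) -> g =1 h.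
Proof.
move=> lg lh gh; apply: tensor_ext => // x; apply: tensor_ext => //.
- by apply: (lin_comp lg); apply: lin_tensr.
- by apply: (lin_comp lh); apply: lin_tensr.
Qed.

Lemma tassocl_tens (U1 U2 U3 : lmodType k) (x : U1) (y : U2) (z : U3) :
  tassocl (tens x (tens y z)) = tens (tens x y) z.
Proof. by rewrite /tassocl !sw_tens //; lin. Qed.

Lemma tassocl_lin (U1 U2 U3 : lmodType k) : islin (@tassocl k U1 U2 U3).
Proof. by rewrite /tassocl; lin. Qed.

Lemma tassocr_lin (U1 U2 U3 : lmodType k) : islin (@tassocr k U1 U2 U3).
Proof. by rewrite /tassocr; lin. Qed.

Lemma tassocr_tens (U1 U2 U3 : lmodType k) (t : tensor U1 U2) (z : U3) :
  tassocr (tens t z) = sw (x, y) <- t; tens x (tens y z).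
Proof. by rewrite /tassocr sw_tens //; lin. Qed.

Lemma brd_fst_lin (W : lmodType k) : islin (@brd_fst k V sigma W).
Proof.
rewrite /brd_fst; have l1 := @tassocl_lin V V W; have l2 := @tassocr_lin V V W.
by have l3 := tmap_linear lsigma (@lin_id _ W); lin.
Qed.

Lemma brd_fst_tens (W : lmodType k) x y (w : W) :
  brd_fst sigma (tens x (tens y w)) =
  sw (y, x) <- sigma (tens x y); tens y (tens x w).
Proof.
rewrite /brd_fst tassocl_tens tmap_tens //.
exact: tassocr_tens.
Qed.

Lemma brd2_tens x t : brd2 sigma (tens x t) = tens x (sigma t).
Proof. by rewrite /brd2 tmap_tens. Qed.

Lemma brd2_lin : islin (brd2 sigma).
Proof. by rewrite /brd2; apply: tmap_linear => //; apply: lin_id. Qed.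

(** The three strands x, y, z in reversed order: both sides of the braid relation,
on pure tensors. *)
Definition yb_left x y z :=
  sw (y, x) <- sigma (tens x y); sw (z, x) <- sigma (tens x z);
  sw (z, y) <- sigma (tens y z); tens z (tens y x).
Definition yb_right x y z :=
  sw (z, y) <- sigma (tens y z); sw (z, x) <- sigma (tens x z);
  sw (y, x) <- sigma (tens x y); tens z (tens y x).

Lemma brd_yb_left x y z :
  brd1 sigma (brd2 sigma (brd1 sigma (tens x (tens y z)))) = yb_left x y z.
Proof.
have l1 := @brd_fst_lin V; have l2 := brd2_lin.
rewrite /brd1 brd_fst_tens !(tlift_comp _ _ l1, tlift_comp _ _ l2).
apply: tlift_ext => y1 x1; rewrite brd2_tens.
rewrite -[sigma (tens x1 z)]tlift_tensE.
rewrite (tlift_comp _ _ (lin_tensr y1)) (tlift_comp _ _ l1) tlift_tensE.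
by apply: tlift_ext => z1 x2; rewrite brd_fst_tens.
Qed.

Lemma brd_yb_right x y z :
  brd2 sigma (brd1 sigma (brd2 sigma (tens x (tens y z)))) = yb_right x y z.
Proof.
have l1 := @brd_fst_lin V; have l2 := brd2_lin.
rewrite /brd1 brd2_tens -[sigma (tens y z)]tlift_tensE.
rewrite (tlift_comp _ _ (lin_tensr x)) (tlift_comp _ _ l1) (tlift_comp _ _ l2).
apply: tlift_ext => z1 y1.
rewrite brd_fst_tens (tlift_comp _ _ l2); apply: tlift_ext => z2 x1.
by rewrite brd2_tens -{1}[sigma (tens x1 y1)]tlift_tensE (tlift_comp _ _ (lin_tensr z2)).
Qed.

Lemma yang_baxterP : (forall t, brd1 sigma (brd2 sigma (brd1 sigma t)) =
    brd2 sigma (brd1 sigma (brd2 sigma t))) <->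
  forall x y z, yb_left x y z = yb_right x y z.
Proof.
have l1 := @brd_fst_lin V; have l2 := brd2_lin.
split=> [E x y z|E]; first by rewrite -brd_yb_left E brd_yb_right.
apply: tens3_ext; rewrite /brd1; try by lin.
by move=> x y z; have := E x y z; rewrite -brd_yb_left -brd_yb_right.
Qed.

Section Compat.
Variable op : V -> V -> V.
Hypothesis bop : isbil op.

Definition compat_right := forall x y z, sigma (tens x (op y z)) =
  sw (y, x) <- sigma (tens x y); sw (z, x) <- sigma (tens x z); tens (op y z) x.
Definition compat_left := forall x y z, sigma (tens (op x y) z) =
  sw (z, y) <- sigma (tens y z); sw (z, x) <- sigma (tens x z); tens z (op x y).

Lemma braid_compatP : braid_compat sigma op <-> compat_right /\ compat_left.
Proof.
have l1 := @brd_fst_lin V; have l2 := brd2_lin.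
have la := @tassocl_lin V V V; have lop := lin_sw bop.
have lm1 := tmap_linear lop (@lin_id _ V).
have lm2 := tmap_linear (@lin_id _ V) lop.
have E1 x y z : tmap (tlift op) id (tassocl (brd2 sigma (brd1 sigma (tens x (tens y z))))) =
    sw (y, x) <- sigma (tens x y); sw (z, x) <- sigma (tens x z); tens (op y z) x.
  rewrite /brd1 brd_fst_tens (tlift_comp _ _ l2) (tlift_comp _ _ la).
  rewrite (tlift_comp _ _ lm1); apply: tlift_ext => y1 x1.
  rewrite brd2_tens -{1}[sigma (tens x1 z)]tlift_tensE.
  rewrite (tlift_comp _ _ (lin_tensr y1)) (tlift_comp _ _ la) (tlift_comp _ _ lm1).
  by apply: tlift_ext => z1 x2; rewrite tassocl_tens tmap_tens // sw_tens.
have E2 x y z : tmap id (tlift op) (brd1 sigma (brd2 sigma (tens x (tens y z)))) =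
    sw (z, y) <- sigma (tens y z); sw (z, x) <- sigma (tens x z); tens z (op x y).
  rewrite /brd1 brd2_tens -{1}[sigma (tens y z)]tlift_tensE.
  rewrite (tlift_comp _ _ (lin_tensr x)) (tlift_comp _ _ l1) (tlift_comp _ _ lm2).
  apply: tlift_ext => z1 y1; rewrite brd_fst_tens (tlift_comp _ _ lm2).
  by apply: tlift_ext => z2 x1; rewrite tmap_tens // sw_tens.
have F1 x y z : sigma (tmap id (tlift op) (tens x (tens y z))) = sigma (tens x (op y z)).
  by rewrite tmap_tens // sw_tens.
have F2 x y z : sigma (tmap (tlift op) id (tassocl (tens x (tens y z)))) =
    sigma (tens (op x y) z).
  by rewrite tassocl_tens tmap_tens // sw_tens.
split=> [[c1 c2]|[cr cl]].
  by split=> x y z; [rewrite -E1 c1 F1 | rewrite -E2 c2 F2].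
split; apply: tens3_ext; rewrite /brd1; try by lin.
- by move=> x y z; rewrite F1 cr; apply: E1.
- by move=> x y z; rewrite F2 cl; apply: E2.
Qed.

End Compat.
End SweedlerBraid.

(** * The braiding of a free tridendriform algebra *)

(** What the construction of the braiding needs to know about trees.  It holds for
every model of the free tridendriform algebra on A. *)
Record free_tridendriform (k : fieldType) (A P : lmodType k) (mul : A -> A -> A)
    (prec succ dot : P -> P -> P) (incl : A -> P) : Prop := {
  ft_tridendriform : tridendriform prec succ dot;
  ft_incl_lin : islin incl;
  ft_incl_mul : forall a b, incl (mul a b) = dot (incl a) (incl b);
  ft_extend : forall (R : lmodType k) (precR succR dotR : R -> R -> R) (psi : A -> R),
    tridendriform precR succR dotR -> islin psi ->
    (forall a b, psi (mul a b) = dotR (psi a) (psi b)) ->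
    exists h : P -> R, [/\ islin h, forall o x y, h (operate prec succ dot o x y) =
      operate precR succR dotR o (h x) (h y) & forall a, h (incl a) = psi a];
  ft_generated : forall (I : Type) (M : lmodType k) (g h : I -> P -> M),
    (forall i, islin (g i)) -> (forall i, islin (h i)) ->
    (forall a i, g i (incl a) = h i (incl a)) ->
    (forall o x y, (forall i, g i x = h i x) -> (forall i, g i y = h i y) ->
      forall i, g i (operate prec succ dot o x y) = h i (operate prec succ dot o x y)) ->
    forall i x, g i x = h i x
}.

Section BraidedGeneration.
Variables (k : fieldType) (A P : lmodType k) (mul : A -> A -> A).
Variable sigma : tensor A A -> tensor A A.
Hypothesis bmul : isbil mul.
Hypothesis lsigma : islin sigma.
Hypothesis mulR : compat_right sigma mul.
Hypothesis mulL : compat_left sigma mul.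
Hypothesis ybA : forall a b c, yb_left sigma a b c = yb_right sigma a b c.

Variables (prec succ dot : P -> P -> P) (incl : A -> P).
Hypothesis free : free_tridendriform mul prec succ dot incl.
Local Notation op := (operate prec succ dot).
Let tdP := ft_tridendriform free.
Let lincl := ft_incl_lin free.
Let inclM := ft_incl_mul free.
Let gen := ft_generated free.

Let op_bil o : isbil (op o).
Proof. by apply/isbilP; case: tdP => *; case: o. Qed.

(** [cross y a] is the image of a (x) y under the braiding, for a generator a: the
letter a, which passes from left to right, stays a single letter.  It comes
first in A (x) P because the convolution algebra is that of W = A. *)
Record crossing (cross : P -> A -> tensor A P) : Prop := {
  cross_bil : isbil cross;
  cross_incl : forall b a,
    cross (incl b) a = sw (b, a) <- sigma (tens a b); tens a (incl b);
  sw_cross_op : forall (M : lmodType k) (F : A -> P -> M) o x y a, isbil F ->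
    (sw (a, z) <- cross (op o x y) a; F a z) =
    sw (a, x) <- cross x a; sw (a, y) <- cross y a; F a (op o x y)
}.

(** y |-> cross y is the extension to P of b |-> flip (sigma (- (x) b)), which is a
homomorphism from A by the compatibility of sigma with products on the right. *)
Lemma crossing_exists : exists cross, crossing cross.
Proof.
pose c b : linmap A (tensor A P) :=
  lmap (fun a => sw (b, a) <- sigma (tens a b); tens a (incl b)).
have cE b a : c b a = sw (b, a) <- sigma (tens a b); tens a (incl b).
  by rewrite /c lmapE //; lin.
have lc : islin c.
  move=> d x y; apply: linmapP => a.
  have L : islin (fun b => sw (b, a) <- sigma (tens a b); tens a (incl b)) by lin.
  by rewrite cE L -!cE.
have cM b d : c (mul b d) = cocirc dot (c b) (c d).
  have bdot := op_bil Dot.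
  have bdot' : isbil (fun x y => dot y x) by case: bdot.
  apply: linmapP => a; rewrite [RHS]circE // !cE mulR sw_sw; last by lin.
  rewrite [RHS]sw_sw; last by lin.
  apply: tlift_ext => b1 a1; rewrite sw_tens; last by lin.
  rewrite sw_sw; last by lin.
  rewrite cE sw_sw; last by lin.
  by apply: tlift_ext => c1 a2; rewrite !sw_tens ?inclM //; lin.
have [h [lh hM hi]] :=
  ft_extend free (coconvolution_tridendriform A tdP) lc cM.
exists (fun y a => h y a); split.
- by split=> [a|y]; [lin | exact: lappP].
- by move=> b a; rewrite hi cE.
- move=> M F o x y a bF; rewrite hM.
  have bo := op_bil o; have bo' : isbil (fun x y => op o y x) by case: bo.
  by case: o bo bo' => bo bo'; apply: sw_circ.
Qed.

Variable cross : P -> A -> tensor A P.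
Hypothesis crossP : crossing cross.
Let bcross := cross_bil crossP.
Let cross_incl := cross_incl crossP.
Let sw_cross_op := sw_cross_op crossP.

(** By induction on y: to pass x op y, the letters a and b meet x first and then y,
and the crossings of a with x and of b with y are independent. *)
Lemma cross_mul y a b : cross y (mul a b) =
  sw (b, y) <- cross y b; sw (a, y) <- cross y a; tens (mul a b) y.
Proof.
pose g (i : A * A) y := cross y (mul i.1 i.2).
pose h (i : A * A) y :=
  sw (b, y) <- cross y i.2; sw (a, y) <- cross y i.1; tens (mul a b) y.
apply: (@gen _ _ g h _ _ _ _ (a, b)) => {y a b}.
- by move=> i; rewrite /g; lin.
- by move=> i; rewrite /h; lin.
- move=> c [a b]; rewrite /g /h /= !cross_incl mulL.
  rewrite sw_nested; last by lin.
  rewrite [RHS]sw_sw; last by lin.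
  apply: tlift_ext => c1 b1; rewrite sw_tens; last by lin.
  rewrite cross_incl [RHS]sw_sw; last by lin.
  by apply: tlift_ext => c2 a1; rewrite !sw_tens; try by lin.
- move=> o x y hx hy [a b]; have bo := op_bil o.
  have Fx (M : lmodType k) (F : A -> P -> M) c d : isbil F ->
      (sw (e, z) <- cross x (mul c d); F e z) =
      sw (b, x) <- cross x d; sw (a, x) <- cross x c; F (mul a b) x.
    by move=> bF; have := congr1 (tlift F) (hx (c, d)); rewrite /g /h /= sw_nested.
  have Fy (M : lmodType k) (F : A -> P -> M) c d : isbil F ->
      (sw (e, z) <- cross y (mul c d); F e z) =
      sw (b, x) <- cross y d; sw (a, x) <- cross x c; F (mul a b) x.
    by move=> bF; have := congr1 (tlift F) (hy (c, d)); rewrite /g /h /= sw_nested.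
  rewrite /g /h /= -[cross (op o x y) (mul a b)]tlift_tensE.
  rewrite sw_cross_op; last by lin.
  rewrite sw_cross_op; last by lin.
  rewrite Fx; last by lin.
  apply: tlift_ext => b1 x1.
  under tlift_ext => a1 x2 do (rewrite Fy; last by lin).
  rewrite tlift_exch; apply: tlift_ext => b2 y1.
  by rewrite sw_cross_op //; lin.
Qed.

(** The braiding is pinned down by its values on a generator and its compatibility
with products in the first argument. *)
Record braid_extension (braid : P -> P -> tensor P P) : Prop := {
  braid_bil : isbil braid;
  braid_incl : forall a y, braid (incl a) y = sw (a, y) <- cross y a; tens y (incl a);
  sw_braid_left : forall (M : lmodType k) (F : P -> P -> M) o u v y, isbil F ->
    (sw (y, x) <- braid (op o u v) y; F y x) =
    sw (y, v) <- braid v y; sw (y, u) <- braid u y; F y (op o u v)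
}.

(** a |-> (y |-> image of a (x) y) is a homomorphism from A by [cross_mul], and it is
extended to P. *)
Lemma braid_exists : exists braid, braid_extension braid.
Proof.
pose c a : linmap P (tensor P P) :=
  lmap (fun y => sw (a, y) <- cross y a; tens y (incl a)).
have cE a y : c a y = sw (a, y) <- cross y a; tens y (incl a).
  by rewrite /c lmapE //; lin.
have lc : islin c.
  move=> d a b; apply: linmapP => y.
  have L : islin (fun a => sw (a, y) <- cross y a; tens y (incl a)) by lin.
  by rewrite cE L -!cE.
have cM a b : c (mul a b) = circ dot (c a) (c b).
  have bdot := op_bil Dot; apply: linmapP => y.
  rewrite [RHS]circE // !cE cross_mul sw_nested; last by lin.
  rewrite [RHS]sw_sw; last by lin.
  apply: tlift_ext => b1 y1; rewrite sw_tens; last by lin.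
  rewrite cE [RHS]sw_sw; last by lin.
  by apply: tlift_ext => a1 y2; rewrite sw_tens ?inclM //; lin.
have [h [lh hM hi]] := ft_extend free (convolution_tridendriform P tdP) lc cM.
exists (fun x y => h x y); split.
- by split=> [y|x]; [lin | exact: lappP].
- by move=> a y; rewrite hi cE.
- move=> M F o u v y bF; rewrite hM; have bo := op_bil o.
  by case: o bo => bo; apply: sw_circ.
Qed.

Variable braid : P -> P -> tensor P P.
Hypothesis braidP : braid_extension braid.
Let bbraid := braid_bil braidP.
Let braid_incl := braid_incl braidP.
Let sw_braid_left := sw_braid_left braidP.

(** Induction on x.  A generator passes a product by construction of [cross]; for
x = p op' q the crossings of q with v and of p with u are independent. *)
Lemma sw_braid_right (M : lmodType k) (F : P -> P -> M) o x u v : isbil F ->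
  (sw (y, x) <- braid x (op o u v); F y x) =
  sw (u, x) <- braid x u; sw (v, x) <- braid x v; F (op o u v) x.
Proof.
have bo := op_bil o.
suff E x' u' v' : braid x' (op o u' v') =
    sw (u, x) <- braid x' u'; sw (v, x) <- braid x v'; tens (op o u v) x.
  by move=> bF; rewrite E sw_nested.
pose g (i : P * P) x := braid x (op o i.1 i.2).
pose h (i : P * P) x :=
  sw (u, x) <- braid x i.1; sw (v, x) <- braid x i.2; tens (op o u v) x.
apply: (@gen _ _ g h _ _ _ _ (u', v')) => {x u v x' u' v' F M}.
- by move=> i; rewrite /g; lin.
- by move=> i; rewrite /h; lin.
- move=> a [u v]; rewrite /g /h /= !braid_incl sw_cross_op; last by lin.
  rewrite [RHS]sw_sw; last by lin.
  apply: tlift_ext => a1 u1; rewrite sw_tens; last by lin.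
  rewrite braid_incl [RHS]sw_sw; last by lin.
  by apply: tlift_ext => a2 v1; rewrite sw_tens //; lin.
- move=> o' p q hp hq [u v]; have bo' := op_bil o'.
  have Fp (M : lmodType k) (F : P -> P -> M) c d : isbil F ->
      (sw (y, x) <- braid p (op o c d); F y x) =
      sw (u, x) <- braid p c; sw (v, x) <- braid x d; F (op o u v) x.
    by move=> bF; have := congr1 (tlift F) (hp (c, d)); rewrite /g /h /= sw_nested.
  have Fq (M : lmodType k) (F : P -> P -> M) c d : isbil F ->
      (sw (y, x) <- braid q (op o c d); F y x) =
      sw (u, x) <- braid q c; sw (v, x) <- braid x d; F (op o u v) x.
    by move=> bF; have := congr1 (tlift F) (hq (c, d)); rewrite /g /h /= sw_nested.
  rewrite /g /h /= -[LHS]tlift_tensE sw_braid_left; last by lin.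
  rewrite Fq; last by lin.
  rewrite sw_braid_left; last by lin.
  apply: tlift_ext => u1 q1.
  under tlift_ext => v1 q2 do (rewrite Fp; last by lin).
  rewrite tlift_exch; apply: tlift_ext => u2 p1.
  by rewrite sw_braid_left //; lin.
Qed.

Section YangBaxter.

(** Two generators on the left, induction on the third strand; at the start this is
the Yang-Baxter equation of A. *)
Let yb_incl_incl a b z :
  (sw (b, a) <- sigma (tens a b); sw (a, z) <- cross z a; sw (b, z) <- cross z b;
     tens z (tens b a)) =
  sw (b, z) <- cross z b; sw (a, z) <- cross z a; sw (b, a) <- sigma (tens a b);
     tens z (tens b a).
Proof.
pose g (i : A * A) z := sw (b, a) <- sigma (tens i.1 i.2); sw (a, z) <- cross z a;
  sw (b, z) <- cross z b; tens z (tens b a).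
pose h (i : A * A) z := sw (b, z) <- cross z i.2; sw (a, z) <- cross z i.1;
  sw (b, a) <- sigma (tens a b); tens z (tens b a).
apply: (@gen _ _ g h _ _ _ _ (a, b)) => {a b z}.
- by move=> i; rewrite /g; lin.
- by move=> i; rewrite /h; lin.
- move=> c [a b]; rewrite /g /h /=.
  pose F (z : A) (b a : A) := tens (incl z) (tens b a).
  have tF : istri F by rewrite /F; tri.
  have := congr1 (tri_lift F) (ybA a b c); rewrite !sw_nested3 // /F => E.
  transitivity (sw (b, a) <- sigma (tens a b); sw (c, a) <- sigma (tens a c);
      sw (c, b) <- sigma (tens b c); tens (incl c) (tens b a)).
    apply: tlift_ext => b1 a1; rewrite cross_incl sw_sw; last by lin.
    apply: tlift_ext => c1 a2; rewrite sw_tens; last by lin.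
    rewrite cross_incl sw_sw; last by lin.
    by apply: tlift_ext => c2 b2; rewrite sw_tens //; lin.
  rewrite {}E cross_incl [RHS]sw_sw; last by lin.
  apply: tlift_ext => c1 b1; rewrite sw_tens; last by lin.
  rewrite cross_incl [RHS]sw_sw; last by lin.
  by apply: tlift_ext => c2 a1; rewrite sw_tens //; lin.
- move=> o u v hu hv [a b]; have bo := op_bil o; rewrite /g /h /=.
  have Fu (M : lmodType k) (F : P -> A -> A -> M) a0 b0 : istri F ->
      (sw (b, a) <- sigma (tens a0 b0); sw (a, z) <- cross u a; sw (b, z) <- cross z b;
        F z b a) =
      sw (b, z) <- cross u b0; sw (a, z) <- cross z a0; sw (b, a) <- sigma (tens a b);
        F z b a.
    by move=> tF; have := congr1 (tri_lift F) (hu (a0, b0)); rewrite !sw_nested3.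
  have Fv (M : lmodType k) (F : P -> A -> A -> M) a0 b0 : istri F ->
      (sw (b, a) <- sigma (tens a0 b0); sw (a, z) <- cross v a; sw (b, z) <- cross z b;
        F z b a) =
      sw (b, z) <- cross v b0; sw (a, z) <- cross z a0; sw (b, a) <- sigma (tens a b);
        F z b a.
    by move=> tF; have := congr1 (tri_lift F) (hv (a0, b0)); rewrite !sw_nested3.
  transitivity (sw (b, a) <- sigma (tens a b); sw (a, u) <- cross u a;
      sw (b, u) <- cross u b; sw (a, v) <- cross v a; sw (b, v) <- cross v b;
      tens (op o u v) (tens b a)).
    apply: tlift_ext => b1 a1; rewrite sw_cross_op; last by lin.
    apply: tlift_ext => a2 u1.
    under tlift_ext => a3 v1 do (rewrite sw_cross_op; last by lin).
    exact: tlift_exch.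
  rewrite Fu; last by tri.
  rewrite sw_cross_op; last by lin.
  apply: tlift_ext => b1 u1.
  under [RHS]tlift_ext => b2 v1 do (rewrite sw_cross_op; last by lin).
  rewrite [RHS]tlift_exch; apply: tlift_ext => a1 u2.
  by rewrite Fv //; tri.
Qed.

(** One generator on the left, induction on the middle strand. *)
Let yb_incl a y z :
  (sw (a, y) <- cross y a; sw (a, z) <- cross z a; sw (z, y) <- braid y z;
     tens z (tens y a)) =
  sw (z, y) <- braid y z; sw (a, z) <- cross z a; sw (a, y) <- cross y a;
     tens z (tens y a).
Proof.
pose g (i : A * P) y := sw (a, y) <- cross y i.1; sw (a, z) <- cross i.2 a;
  sw (z, y) <- braid y z; tens z (tens y a).
pose h (i : A * P) y := sw (z, y) <- braid y i.2; sw (a, z) <- cross z i.1;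
  sw (a, y) <- cross y a; tens z (tens y a).
apply: (@gen _ _ g h _ _ _ _ (a, z)) => {a y z}.
- by move=> i; rewrite /g; lin.
- by move=> i; rewrite /h; lin.
- move=> b [a z]; rewrite /g /h /= cross_incl sw_sw; last by lin.
  rewrite braid_incl [RHS]sw_sw; last by lin.
  pose F (z : P) (b a : A) := tens z (tens (incl b) a).
  have tF : istri F by rewrite /F; tri.
  have := congr1 (tri_lift F) (yb_incl_incl a b z); rewrite !sw_nested3 // /F => E.
  transitivity (sw (b, a) <- sigma (tens a b); sw (a, z) <- cross z a;
      sw (b, z) <- cross z b; tens z (tens (incl b) a)).
    apply: tlift_ext => b1 a1; rewrite sw_tens; last by lin.
    apply: tlift_ext => a2 z1; rewrite braid_incl sw_sw; last by lin.
    by apply: tlift_ext => b2 z2; rewrite sw_tens //; lin.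
  rewrite {}E; apply: tlift_ext => b1 z1; rewrite sw_tens; last by lin.
  apply: tlift_ext => a1 z2; rewrite cross_incl [RHS]sw_sw; last by lin.
  by apply: tlift_ext => b2 a2; rewrite sw_tens //; lin.
- move=> o u v hu hv [a z]; have bo := op_bil o; rewrite /g /h /=.
  have Fu (M : lmodType k) (F : P -> P -> A -> M) a0 z0 : istri F ->
      (sw (a, y) <- cross u a0; sw (a, z) <- cross z0 a; sw (z, y) <- braid y z; F z y a) =
      sw (z, y) <- braid u z0; sw (a, z) <- cross z a0; sw (a, y) <- cross y a; F z y a.
    by move=> tF; have := congr1 (tri_lift F) (hu (a0, z0)); rewrite !sw_nested3.
  have Fv (M : lmodType k) (F : P -> P -> A -> M) a0 z0 : istri F ->
      (sw (a, y) <- cross v a0; sw (a, z) <- cross z0 a; sw (z, y) <- braid y z; F z y a) =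
      sw (z, y) <- braid v z0; sw (a, z) <- cross z a0; sw (a, y) <- cross y a; F z y a.
    by move=> tF; have := congr1 (tri_lift F) (hv (a0, z0)); rewrite !sw_nested3.
  rewrite sw_cross_op; last by lin.
  transitivity (sw (z, v) <- braid v z; sw (a, u) <- cross u a; sw (a, z) <- cross z a;
      sw (z, u) <- braid u z; sw (a, v) <- cross v a; tens z (tens (op o u v) a)).
    rewrite [RHS]tlift_exch; apply: tlift_ext => a1 u1.
    transitivity (sw (a, v) <- cross v a1; sw (a, z) <- cross z a; sw (z, v) <- braid v z;
        sw (z, u) <- braid u1 z; tens z (tens (op o u v) a)).
      apply: tlift_ext => a2 v1; apply: tlift_ext => a3 z1.
      by rewrite sw_braid_left //; lin.
    rewrite Fv; last by tri.
    by apply: tlift_ext => z1 v1; apply: tlift_ext => a2 z2; apply: tlift_exch.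
  rewrite sw_braid_left; last by lin.
  apply: tlift_ext => z1 v1; rewrite Fu; last by tri.
  apply: tlift_ext => z2 u1; apply: tlift_ext => a1 z3.
  by rewrite sw_cross_op //; lin.
Qed.

(** Induction on the left strand.  When a strand is a product u op v, the relation is
applied to u and to v in turn, and crossings of disjoint pairs of strands are
exchanged. *)
Lemma braid_yang_baxter x y z :
  (sw (y, x) <- braid x y; sw (z, x) <- braid x z; sw (z, y) <- braid y z;
     tens z (tens y x)) =
  sw (z, y) <- braid y z; sw (z, x) <- braid x z; sw (y, x) <- braid x y;
     tens z (tens y x).
Proof.
pose g (i : P * P) x := sw (y, x) <- braid x i.1; sw (z, x) <- braid x i.2;
  sw (z, y) <- braid y z; tens z (tens y x).
pose h (i : P * P) x := sw (z, y) <- braid i.1 i.2; sw (z, x) <- braid x z;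
  sw (y, x) <- braid x y; tens z (tens y x).
apply: (@gen _ _ g h _ _ _ _ (y, z)) => {x y z}.
- by move=> i; rewrite /g; lin.
- by move=> i; rewrite /h; lin.
- move=> a [y z]; rewrite /g /h /= braid_incl sw_sw; last by lin.
  pose F (z y : P) (a : A) := tens z (tens y (incl a)).
  have tF : istri F by rewrite /F; tri.
  have := congr1 (tri_lift F) (yb_incl a y z); rewrite !sw_nested3 // /F => E.
  transitivity (sw (a, y) <- cross y a; sw (a, z) <- cross z a; sw (z, y) <- braid y z;
      tens z (tens y (incl a))).
    apply: tlift_ext => a1 y1; rewrite sw_tens; last by lin.
    rewrite braid_incl sw_sw; last by lin.
    by apply: tlift_ext => a2 z1; rewrite sw_tens //; lin.
  rewrite {}E; apply: tlift_ext => z1 y1; rewrite braid_incl [RHS]sw_sw; last by lin.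
  apply: tlift_ext => a1 z2; rewrite sw_tens; last by lin.
  rewrite braid_incl [RHS]sw_sw; last by lin.
  by apply: tlift_ext => a2 y2; rewrite sw_tens //; lin.
- move=> o u v hu hv [y z]; have bo := op_bil o; rewrite /g /h /=.
  have Fu (M : lmodType k) (F : P -> P -> P -> M) y0 z0 : istri F ->
      (sw (y, x) <- braid u y0; sw (z, x) <- braid x z0; sw (z, y) <- braid y z; F z y x) =
      sw (z, y) <- braid y0 z0; sw (z, x) <- braid u z; sw (y, x) <- braid x y; F z y x.
    by move=> tF; have := congr1 (tri_lift F) (hu (y0, z0)); rewrite !sw_nested3.
  have Fv (M : lmodType k) (F : P -> P -> P -> M) y0 z0 : istri F ->
      (sw (y, x) <- braid v y0; sw (z, x) <- braid x z0; sw (z, y) <- braid y z; F z y x) =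
      sw (z, y) <- braid y0 z0; sw (z, x) <- braid v z; sw (y, x) <- braid x y; F z y x.
    by move=> tF; have := congr1 (tri_lift F) (hv (y0, z0)); rewrite !sw_nested3.
  rewrite sw_braid_left; last by lin.
  transitivity (sw (y, v) <- braid v y; sw (z, v) <- braid v z; sw (z, y) <- braid y z;
      sw (z, u) <- braid u z; sw (y, u) <- braid u y; tens z (tens y (op o u v))).
    apply: tlift_ext => y1 v1.
    transitivity (sw (y, u) <- braid u y1; sw (z, v) <- braid v1 z; sw (z, u) <- braid u z;
        sw (z, y) <- braid y z; tens z (tens y (op o u v))).
      by apply: tlift_ext => y2 u1; rewrite sw_braid_left //; lin.
    rewrite tlift_exch; apply: tlift_ext => z1 v2.
    by rewrite Fu //; tri.
  rewrite Fv; last by tri.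
  apply: tlift_ext => z1 y1; rewrite sw_braid_left; last by lin.
  apply: tlift_ext => z2 v1; rewrite tlift_exch; apply: tlift_ext => z3 u1.
  by rewrite sw_braid_left //; lin.
Qed.

End YangBaxter.

Section Naturality.
Variables (R : lmodType k) (tau : tensor R R -> tensor R R).
Variables (opR : operation -> R -> R -> R) (psi : A -> R) (Psi : P -> R).
Hypothesis ltau : islin tau.
Hypothesis opR_bil : forall o, isbil (opR o).
Hypothesis tauR : forall o, compat_right tau (opR o).
Hypothesis tauL : forall o, compat_left tau (opR o).
Hypothesis lpsi : islin psi.
Hypothesis psi_braid : forall a b, tau (tens (psi a) (psi b)) =
  sw (b, a) <- sigma (tens a b); tens (psi b) (psi a).
Hypothesis lPsi : islin Psi.
Hypothesis Psi_op : forall o x y, Psi (op o x y) = opR o (Psi x) (Psi y).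
Hypothesis Psi_incl : forall a, Psi (incl a) = psi a.

Lemma cross_natural a y :
  (sw (a, y) <- cross y a; tens (Psi y) (psi a)) = tau (tens (psi a) (Psi y)).
Proof.
pose g (a : A) y := sw (a, y) <- cross y a; tens (Psi y) (psi a).
pose h (a : A) y := tau (tens (psi a) (Psi y)).
apply: (@gen _ _ g h _ _ _ _ a) => {a y}.
- by move=> i; rewrite /g; lin.
- by move=> i; rewrite /h; lin.
- move=> b a; rewrite /g /h Psi_incl psi_braid cross_incl sw_sw; last by lin.
  by apply: tlift_ext => b1 a1; rewrite sw_tens ?Psi_incl //; lin.
- move=> o u v hu hv a; have bo := op_bil o; have boR := opR_bil o.
  rewrite /g /h in hu hv *.
  rewrite sw_cross_op; last by lin.
  rewrite Psi_op tauR -hu sw_sw; last by lin.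
  apply: tlift_ext => a1 u1; rewrite sw_tens; last by lin.
  rewrite -hv sw_sw; last by lin.
  by apply: tlift_ext => a2 v1; rewrite sw_tens ?Psi_op //; lin.
Qed.

(** By induction on x: if Psi intertwines the braidings for u and for v, then also for
u op v, since both braidings are compatible with the products. *)
Lemma braid_natural x y :
  (sw (y, x) <- braid x y; tens (Psi y) (Psi x)) = tau (tens (Psi x) (Psi y)).
Proof.
pose g (y : P) x := sw (y, x) <- braid x y; tens (Psi y) (Psi x).
pose h (y : P) x := tau (tens (Psi x) (Psi y)).
apply: (@gen _ _ g h _ _ _ _ y) => {x y}.
- by move=> i; rewrite /g; lin.
- by move=> i; rewrite /h; lin.
- move=> a y; rewrite /g /h Psi_incl -cross_natural braid_incl sw_sw; last by lin.
  by apply: tlift_ext => a1 y1; rewrite sw_tens ?Psi_incl //; lin.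
- move=> o u v hu hv y; have bo := op_bil o; have boR := opR_bil o.
  rewrite /g /h in hu hv *.
  rewrite sw_braid_left; last by lin.
  rewrite Psi_op tauL -hv sw_sw; last by lin.
  apply: tlift_ext => y1 v1; rewrite sw_tens; last by lin.
  rewrite -hu sw_sw; last by lin.
  by apply: tlift_ext => y2 u1; rewrite sw_tens ?Psi_op //; lin.
Qed.

End Naturality.

End BraidedGeneration.

(** * Crossing of words *)

Section Words.
Variables (k : fieldType) (V : lmodType k) (sigma : tensor V V -> tensor V V).

(** A letter crosses a word; the continuation F receives the new word and the new
letter.  With continuations no identification of a tensor power of size m + n
with a tensor product is needed. *)
Fixpoint cross_word (M : lmodType k) (a : V) (s : seq V) (F : seq V -> V -> M) : M :=
  if s is b :: s' then
    sw (b, a) <- sigma (tens a b); cross_word a s' (fun u c => F (b :: u) c)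
  else F [::] a.

(** The letters of s cross s', starting with the last one. *)
Fixpoint cross_words (M : lmodType k) (s s' : seq V) (F : seq V -> seq V -> M) : M :=
  if s is a :: s0 then
    cross_words s0 s' (fun u v => cross_word a u (fun u c => F u (c :: v)))
  else F s' [::].

Lemma cross_word_ext (M : lmodType k) a s (F G : seq V -> V -> M) :
  (forall u c, size u = size s -> F u c = G u c) ->
  cross_word a s F = cross_word a s G.
Proof.
elim: s a F G => [|b s IH] a F G FG /=; first exact: FG.
apply: tlift_ext => b' a'; apply: IH => u c su; apply: FG.
by rewrite /= su.
Qed.

Lemma cross_word_comp (M N : lmodType k) (h : M -> N) a s (F : seq V -> V -> M) :
  islin h -> h (cross_word a s F) = cross_word a s (fun u c => h (F u c)).
Proof.
move=> lh; elim: s a F => [|b s IH] a F //=; rewrite tlift_comp //.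
by apply: tlift_ext => b' a'; apply: IH.
Qed.

Lemma cross_word_cat (M : lmodType k) a s1 s2 (F : seq V -> V -> M) :
  cross_word a (s1 ++ s2) F =
  cross_word a s1 (fun u c => cross_word c s2 (fun v d => F (u ++ v) d)).
Proof.
elim: s1 a F => [|b s IH] a F //=.
by apply: tlift_ext => b' a'; apply: IH.
Qed.

Lemma cross_words_ext (M : lmodType k) s s' (F G : seq V -> seq V -> M) :
  (forall u v, size u = size s' -> size v = size s -> F u v = G u v) ->
  cross_words s s' F = cross_words s s' G.
Proof.
elim: s F G => [|a s IH] F G FG /=; first exact: FG.
apply: IH => u v su sv; apply: cross_word_ext => u' c su'.
by apply: FG; rewrite /= ?su' ?sv.
Qed.

Lemma cross_words_comp (M N : lmodType k) (h : M -> N) s s' (F : seq V -> seq V -> M) :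
  islin h -> h (cross_words s s' F) = cross_words s s' (fun u v => h (F u v)).
Proof.
move=> lh; elim: s F => [|a s IH] F //=; rewrite IH.
by apply: cross_words_ext => u v _ _; apply: cross_word_comp.
Qed.

Lemma cross_words_cat (M : lmodType k) s1 s2 s' (F : seq V -> seq V -> M) :
  cross_words (s1 ++ s2) s' F =
  cross_words s2 s' (fun u v => cross_words s1 u (fun u' v' => F u' (v' ++ v))).
Proof. by elim: s1 F => [|a s IH] F //=; rewrite IH. Qed.

Hypothesis lsigma : islin sigma.

Lemma sigma_at_lin i n : islin (@sigma_at k V sigma i n).
Proof.
elim: n i => [|n IH] [|i] //=.
by case: i => [|i]; [case: n {IH} => [|n] //; apply: brd_fst_lin | apply: tmap_linear].
Qed.

Lemma sigma_word_lin l n : islin (@sigma_word k V sigma l n).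
Proof.
elim: l => [|i l IH] //=; exact: (lin_comp (@sigma_at_lin i n) IH).
Qed.

Lemma sigma_word_cat l1 l2 n (t : tpow V n) :
  sigma_word sigma (l1 ++ l2) t = sigma_word sigma l1 (sigma_word sigma l2 t).
Proof. by elim: l1 => //= i l ->. Qed.

Lemma sigma_word_shift l n v (t : tpow V n) : all (leq 1) l ->
  sigma_word sigma (map S l) (n := n.+1) (tens v t) = tens v (sigma_word sigma l t).
Proof.
elim: l => //= -[//|i] l IH /= /IH ->.
by rewrite tmap_tens //; exact: (@sigma_at_lin i.+1 n).
Qed.

Lemma iota_succ m n : map S (iota m n) = iota m.+1 n.
Proof. by rewrite -[m.+1]/(1 + m)%N iotaDl. Qed.

(** s_j ... s_1 moves the first letter to the right, one position at a time. *)
Lemma cross_word_link (M : lmodType k) N (h : tpow V N.+1 -> M) a u v : islin h ->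
  size (u ++ v) = N ->
  h (sigma_word sigma (rev (iota 1 (size u))) (tpure N.+1 (a :: u ++ v))) =
  cross_word a u (fun u' c => h (tpure N.+1 (u' ++ c :: v))).
Proof.
elim: u a N h => [|b u IH] a N h lh //=.
case: N h lh => // N h lh [szN].
rewrite rev_cons -cats1 sigma_word_cat.
rewrite -iota_succ.
rewrite [sigma_word _ [:: 1%N] _]/= brd_fst_tens // -map_rev.
rewrite (tlift_comp _ _ (@sigma_word_lin _ _)) (tlift_comp _ _ lh).
apply: tlift_ext => b' a'; rewrite sigma_word_shift; last first.
  by rewrite all_rev; apply/allP => i; rewrite mem_iota => /andP[].
by rewrite -(IH a' N (fun t => h (tens b' t))) //; apply: (lin_comp lh); apply: lin_tensr.
Qed.

(** The block of the first letter comes last in the composition; what precedes it is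
the word for the other letters, moved one position to the right. *)
Lemma chi_wordS i j :
  chi_word i.+1 j = rev (iota 1 j) ++ map S (chi_word i j).
Proof.
rewrite /chi_word /mkseq /= map_flatten -map_comp; congr (_ ++ flatten _).
rewrite -iota_succ -map_comp; apply: eq_map => a /=.
by rewrite map_rev iota_succ.
Qed.

Lemma beta_link (M : lmodType k) s s' (h : tpow V (size s + size s') -> M) :
  islin h ->
  h (beta sigma (i := size s) (j := size s') (tpure (size s + size s') (s ++ s'))) =
  cross_words s s' (fun u v => h (tpure (size s + size s') (u ++ v))).
Proof.
rewrite /beta; elim: s h => [|a s IH] h lh /=; first by rewrite cats0.
rewrite chi_wordS sigma_word_cat sigma_word_shift; last first.
  apply/allP => i /flattenP[w /mapP[c _ ->]].
  by rewrite mem_rev mem_iota => /andP[+ _]; apply: leq_trans.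
pose h' t := h (sigma_word sigma (rev (iota 1 (size s'))) (n := (size s + size s').+1) (tens a t)).
have lh' : islin h'.
  apply: (lin_comp lh); apply: (lin_comp (@sigma_word_lin _ (size s + size s').+1)).
  exact: lin_tensr.
rewrite -[LHS]/(h' _) IH //; apply: cross_words_ext => u v su sv.
rewrite /h' -[X in iota 1 X]su.
by rewrite -(@cross_word_link _ _ h) // size_cat su sv addnC.
Qed.
End Words.

(** * Comparison with the braiding defined on trees *)

Section BraidOfTerms.
Variables (k : fieldType) (A P : lmodType k) (mul : A -> A -> A).
Variable sigma : tensor A A -> tensor A A.
Hypothesis lsigma : islin sigma.
Variables (prec succ dot : P -> P -> P) (incl : A -> P).
Hypothesis free : free_tridendriform mul prec succ dot incl.
Variables (cross : P -> A -> tensor A P) (braid : P -> P -> tensor P P).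
Hypothesis crossP : crossing sigma prec succ dot incl cross.
Hypothesis braidP : braid_extension prec succ dot incl cross braid.
Local Notation ev := (eval prec succ dot incl).
Let bcross := cross_bil crossP.
Let bbraid := braid_bil braidP.
Let lincl := ft_incl_lin free.

Let op_bil o : isbil (operate prec succ dot o).
Proof. by apply/isbilP; case: (ft_tridendriform free) => *; case: o. Qed.

(** Letter by letter, [cross] is [cross_word]: a product is passed factor by factor,
and a letter crosses a concatenation by crossing its two parts. *)
Lemma cross_eval e a : cross (ev e) a =
  cross_word sigma a (letters e) (fun u c => tens c (ev (relabel 0 e u))).
Proof.
elim: e a => [b|o e1 IH1 e2 IH2] a /=; first exact: (cross_incl crossP).
have bo := op_bil o.
rewrite -[LHS]tlift_tensE (sw_cross_op crossP); last by lin.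
rewrite IH1 cross_word_comp; last by lin.
rewrite cross_word_cat; apply: cross_word_ext => u c su.
rewrite sw_tens; last by lin.
rewrite IH2 cross_word_comp; last by lin.
apply: cross_word_ext => v c' sv; rewrite sw_tens; last by lin.
by rewrite relabel_cat ?su // -su drop_size_cat.
Qed.

Lemma braid_eval e e' : braid (ev e) (ev e') =
  cross_words sigma (letters e) (letters e')
    (fun u v => tens (ev (relabel 0 e' u)) (ev (relabel 0 e v))).
Proof.
elim: e e' => [a|o e1 IH1 e2 IH2] e' /=.
  rewrite (braid_incl braidP) cross_eval cross_word_comp; last by lin.
  by apply: cross_word_ext => u c su; rewrite sw_tens //; lin.
have bo := op_bil o.
rewrite -[LHS]tlift_tensE (sw_braid_left braidP); last by lin.
rewrite IH2 cross_words_comp; last by lin.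
rewrite cross_words_cat; apply: cross_words_ext => u v su sv.
rewrite sw_tens; last by lin.
rewrite IH1 cross_words_comp; last by lin.
rewrite letters_relabel //; apply: cross_words_ext => u' v' su' sv'.
rewrite sw_tens; last by lin.
by rewrite relabel_relabel relabel_cat ?sv' // -sv' drop_size_cat.
Qed.

End BraidOfTerms.

Section PAbarBraiding.
Variables (k : fieldType) (A : lmodType k) (mul : A -> A -> A).
Hypotheses (bmul : isbil mul) (mulA : associative mul).
Local Notation P := (PAbar A).
Local Notation prec := (PA_prec mul).
Local Notation succ := (PA_succ mul).
Local Notation dot := (PA_dot mul).
Local Notation incl := (@PA_incl k A).

Lemma PAbar_free : free_tridendriform mul prec succ dot incl.
Proof.
split.
- exact: PA_tridendriform.
- exact: incl_lin.
- exact: inclM.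
- move=> R precR succR dotR psi tdR lpsi psiM.
  exists (PA_hat precR succR dotR psi); split.
  + exact: PA_hat_lin.
  + exact: (PA_hat_operate bmul).
  + exact: PA_hat_incl.
- exact: PAbar_gen.
Qed.

Variable sigma : tensor A A -> tensor A A.
Hypothesis lsigma : islin sigma.
Variables (cross : P -> A -> tensor A P) (braid : P -> P -> tensor P P).
Hypothesis crossP : crossing sigma prec succ dot incl cross.
Hypothesis braidP : braid_extension prec succ dot incl cross braid.

Lemma decorate_node (T : tree A) (s : seq A) : size s = size (angles T) ->
  dense_node T -> dense_node (decorate 0 T s).
Proof.
move=> sz /andP[dT nT]; rewrite /dense_node is_leaf_decorate nT andbT.
have [+ _] := @decorateP A A 0 T s [::] sz; rewrite cats0 => shT.
by rewrite -dense_shape shT dense_shape.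
Qed.

Lemma tree_vect_decorate (T : tree A) (s : seq A) : size s = size (angles T) ->
  dense_node T ->
  tree_vect (decorate 0 T s) =
  eval prec succ dot incl (relabel 0 (tree_term 0 T) s) :> P.
Proof.
move=> sz dT; rewrite -(tree_eval_incl bmul) ?decorate_node // /tree_eval.
by rewrite tree_term_decorate //; case/andP: dT.
Qed.

(** Both sides let the letters of T cross those of T', on the left by [beta_link] and
on the right by [braid_eval] applied to the expressions of the two trees. *)
Lemma tree_braidE (T T' : tree A) : dense_node T -> dense_node T' ->
  tree_braid sigma T T' = braid (tree_vect T) (tree_vect T').
Proof.
move=> dT dT'; have [nT nT'] : ~~ is_leaf T /\ ~~ is_leaf T'.
  by case/andP: dT dT' => _ -> /andP[].
have mG : multilinear (size (angles T) + size (angles T'))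
    (fun s => tens (tree_vect (decorate 0 T' (take (size (angles T')) s)) : P)
                   (tree_vect (decorate 0 T (drop (size (angles T')) s)) : P)).
  (* A letter that varies is either among the first n, which decorate T', or among
     those that decorate T. *)
  move=> s1 s2 a x y sz; set n := size (angles T') in sz *.
  have [lt|ge] := ltnP (size s1) n.
    have tk z : take n (s1 ++ z :: s2) = s1 ++ z :: take (n - size s1).-1 s2.
      rewrite take_cat ltnNge ltnW //=; case E: (n - size s1)%N => //; lia.
    have dr z : drop n (s1 ++ z :: s2) = drop (n - size s1).-1 s2.
      rewrite drop_cat ltnNge ltnW //=; case E: (n - size s1)%N => //; lia.
    rewrite !tk !dr (tree_vect_lin (decorate_lin _ _ _ _ _)) //.
    by rewrite (lin_tensl _ a).
  have tk z : take n (s1 ++ z :: s2) = take n s1 by rewrite takel_cat.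
  have dr z : drop n (s1 ++ z :: s2) = drop n s1 ++ z :: s2.
    rewrite drop_cat; case: ltngtP ge => // E _.
    by rewrite E subnn drop_size.
  rewrite !tk !dr (tree_vect_lin (decorate_lin _ _ _ _ _)) ?size_drop //; last first.
    by rewrite ltn_subLR // addnC -sz addnS ltnS leq_addr.
  by rewrite (lin_tensr _ a).
rewrite -!(tree_eval_incl bmul) // (braid_eval PAbar_free crossP braidP).
rewrite !letters_tree_term // /tree_braid (beta_link lsigma); last exact: tpow_lift_linear.
apply: cross_words_ext => u v su sv.
rewrite tpow_lift_pure //; last by rewrite size_cat su sv addnC.
by rewrite -su take_size_cat // drop_size_cat // !tree_vect_decorate.
Qed.

Lemma PA_sigmaE t : PA_sigma sigma t = tlift braid t.
Proof.
apply: tlift_ext => x y; have bb := braid_bil braidP.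
transitivity (PA_lift (fun T => braid (tree_vect T) y) x); last first.
  by apply: (@PA_lift_tree_vect _ _ _ (fun x => braid x y)); lin.
apply: PA_lift_ext => T dT.
transitivity (PA_lift (fun T' => braid (tree_vect T) (tree_vect T')) y); last first.
  by apply: (@PA_lift_tree_vect _ _ _ (fun y => braid (tree_vect T) y)); lin.
by apply: PA_lift_ext => T' dT'; apply: tree_braidE.
Qed.

End PAbarBraiding.

(** * The free braided tridendriform algebra *)

Section FreeBraided.
Variables (k : fieldType) (A P : lmodType k) (mul : A -> A -> A).
Variable sigma : tensor A A -> tensor A A.
Hypothesis hA : braided_algebra mul sigma.
Variables (prec succ dot : P -> P -> P) (incl : A -> P).
Hypothesis free : free_tridendriform mul prec succ dot incl.
Variables (cross : P -> A -> tensor A P) (braid : P -> P -> tensor P P).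
Hypothesis crossP : crossing sigma prec succ dot incl cross.
Hypothesis braidP : braid_extension prec succ dot incl cross braid.
Local Notation op := (operate prec succ dot).

Let bmul : isbil mul. Proof. by apply/isbilP; case: hA. Qed.
Let lsigma : islin sigma. Proof. by case: hA => _ _ []. Qed.
Let mulR : compat_right sigma mul.
Proof. by case: hA => _ _ _ /(braid_compatP lsigma bmul)[]. Qed.
Let mulL : compat_left sigma mul.
Proof. by case: hA => _ _ _ /(braid_compatP lsigma bmul)[]. Qed.
Let ybA a b c : yb_left sigma a b c = yb_right sigma a b c.
Proof. by case: hA => _ _ [_ /(yang_baxterP lsigma)]. Qed.

Let bbraid := braid_bil braidP.
Let lbraid : islin (tlift braid). Proof. exact: lin_sw. Qed.
Let braidE x y : tlift braid (tens x y) = braid x y. Proof. exact: sw_tens. Qed.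

Let op_bil o : isbil (op o).
Proof. by apply/isbilP; case: (ft_tridendriform free) => *; case: o. Qed.

Lemma free_braid_compat o : braid_compat (tlift braid) (op o).
Proof.
apply/(braid_compatP lbraid (op_bil o)); have bo := op_bil o.
split=> x y z; rewrite braidE -[LHS]tlift_tensE.
  rewrite (sw_braid_right free crossP braidP); last by lin.
  by rewrite braidE; apply: tlift_ext => u v; rewrite braidE.
rewrite (sw_braid_left braidP); last by lin.
by rewrite braidE; apply: tlift_ext => u v; rewrite braidE.
Qed.

Lemma free_braiding : braiding (tlift braid).
Proof.
split=> //; apply/(yang_baxterP lbraid) => x y z.
transitivity (sw (y, x) <- braid x y; sw (z, x) <- braid x z; sw (z, y) <- braid y z;
    tens z (tens y x)).
  rewrite /yb_left braidE; apply: tlift_ext => ? ?; rewrite braidE.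
  by apply: tlift_ext => ? ?; rewrite braidE.
rewrite (braid_yang_baxter lsigma ybA free crossP braidP).
rewrite /yb_right braidE; apply: tlift_ext => ? ?; rewrite braidE.
by apply: tlift_ext => ? ?; rewrite braidE.
Qed.

Lemma free_braided_tridendriform : braided_tridendriform prec succ dot (tlift braid).
Proof.
split; [exact: (ft_tridendriform free) | exact: free_braiding | | | ].
- exact: (free_braid_compat Prec).
- exact: (free_braid_compat Succ).
- exact: (free_braid_compat Dot).
Qed.

Lemma incl_braided_hom : braided_algebra_hom mul sigma dot (tlift braid) incl.
Proof.
have lincl := ft_incl_lin free; split; [exact: lincl | exact: (ft_incl_mul free) |].
apply: tensor_ext => [||a b]; try by lin.
rewrite tmap_tens // braidE (braid_incl braidP) (cross_incl crossP) sw_sw; last by lin.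
by apply: tlift_ext => ? ?; rewrite sw_tens //; lin.
Qed.

Section Hom.
Variables (R : lmodType k) (precR succR dotR : R -> R -> R).
Variables (tau : tensor R R -> tensor R R) (psi : A -> R).
Hypothesis hR : braided_tridendriform precR succR dotR tau.
Hypothesis hpsi : braided_algebra_hom mul sigma dotR tau psi.

Lemma free_braided_hom (h : P -> R) : islin h ->
  (forall o x y, h (op o x y) = operate precR succR dotR o (h x) (h y)) ->
  (forall a, h (incl a) = psi a) ->
  braided_tridendriform_hom prec succ dot (tlift braid) precR succR dotR tau h.
Proof.
move=> lh hM hi; have [tdR [ltau _] cp cs cd] := hR.
have {ltau}ltau : islin tau by [].
have [lpsi psiM psiB] := hpsi; have {lpsi}lpsi : islin psi by [].
have bR o : isbil (operate precR succR dotR o).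
  by apply/isbilP; case: tdR => *; case: o.
have cR o : compat_right tau (operate precR succR dotR o) /\
    compat_left tau (operate precR succR dotR o).
  by apply/(braid_compatP ltau (bR o)); case: o.
have psi_braid a b : tau (tens (psi a) (psi b)) =
    sw (b, a) <- sigma (tens a b); tens (psi b) (psi a).
  by rewrite -(tmap_tens a b lpsi lpsi) -psiB.
split=> //; [exact: (hM Prec) | exact: (hM Succ) | exact: (hM Dot) |].
apply: tensor_ext => [||x y]; try by lin.
rewrite tmap_tens // braidE.
by apply: (braid_natural free crossP braidP ltau bR _ _ lpsi psi_braid lh hM hi) => o;
  case: (cR o).
Qed.

End Hom.
End FreeBraided.

Theorem theorem4p7 (k : fieldType) (char0 : [pchar k] =i pred0)
    (A : lmodType k) (mul : A -> A -> A) (sigma : tensor A A -> tensor A A)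
    (hA : braided_algebra mul sigma) :
  braided_tridendriform (PA_prec mul) (PA_succ mul) (PA_dot mul)
    (PA_sigma sigma) /\
  braided_algebra_hom mul sigma (PA_dot mul) (PA_sigma sigma) (@PA_incl k A) /\
  forall (R : lmodType k) (precR succR dotR : R -> R -> R)
      (tau : tensor R R -> tensor R R) (psi : A -> R),
    braided_tridendriform precR succR dotR tau ->
    braided_algebra_hom mul sigma dotR tau psi ->
    exists! psi_hat : PAbar A -> R,
      braided_tridendriform_hom (PA_prec mul) (PA_succ mul) (PA_dot mul)
        (PA_sigma sigma) precR succR dotR tau psi_hat /\
      psi =1 psi_hat \o @PA_incl k A.
Proof.
have [/isbilP bmul mulA [lsigma _] cmul] := hA.
have {}lsigma : islin sigma by [].
have [mulR mulL] := (braid_compatP lsigma bmul).1 cmul.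
have free := PAbar_free bmul mulA.
have [cross crossP] := crossing_exists lsigma mulR free.
have [braid braidP] := braid_exists bmul mulL free crossP.
have -> : PA_sigma sigma = tlift braid.
  by apply/funext => t; apply: (PA_sigmaE bmul mulA lsigma crossP braidP).
split; first exact: (free_braided_tridendriform hA free crossP braidP).
split; first exact: (incl_braided_hom hA free crossP braidP).
move=> R precR succR dotR tau psi hR hpsi; have [tdR _ _ _ _] := hR.
have [lpsi psiM _] := hpsi; have {}lpsi : islin psi by [].
have [h [lh hM hi]] := ft_extend free tdR lpsi psiM.
exists h; split.
  by split; [exact: (free_braided_hom free crossP braidP hR hpsi) | move=> a /=; rewrite hi].
move=> h' [[lh' hp hs hd _] hi']; apply/funext => x.
apply: (ft_generated free (g := fun _ : unit => h) (h := fun=> h')) => //.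
- by move=> a _; rewrite hi; apply: hi'.
- move=> o y z /(_ tt) hy /(_ tt) hz _; rewrite hM hy hz.
  by case: o => /=; rewrite ?hp ?hs ?hd.
Qed.
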